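(* Let $N\ge1$. After applying the bijection $\Phi$, the PT chain on permutation tableaux of half-perimeter $N+1$ is the Markov chain on the symmetric group $S_{N+1}$ with exactly the following transitions between distinct states, from a permutation $\pi\in S_{N+1}$ (with the remaining probability the chain stays at $\pi$). (a) ''Particle enters from the left''. Suppose $\pi(2)=1$. Let $i+1$ be the minimal number greater than $2$ which is a non-excedance of $\pi$ (if there is none, put $i=N+1$). Let $\sigma$ be the permutation of $\{1,3,4,\dots,N+1\}\cup\{i+\frac12\}$ obtained by collapsing $\pi$ at $2$ and adding a fixed point at $i+\frac12$. There is a transition $\pi\to\mathrm{Norm}(\sigma)$ with probability $\frac{\alpha}{N+1}$. (b) ''Particle hops right''. Suppose that for some $i\ge2$, $i\le N$, $\pi(i)\ge i$ and $\pi(i+1)<i+1$. Define $\sigma$ as follows. Case 1: If $\pi(i)=i$, let $j+1$ be the smallest non-excedance of $\pi$ with $j>i$ (if there is none, put $j=N+1$); $\sigma$ is the permutation of $(\{1,\dots,N+1\}\setminus\{i\})\cup\{j+\frac12\}$ obtained by deleting the fixed point $i$ of $\pi$ and inserting a new fixed point at $j+\frac12$. Case 2: If $\pi(i)>i$ and $\pi(i+1)<i$, then $\sigma(i)=\pi(i+1)$, $\sigma(i+1)=\pi(i)$, and $\sigma(k)=\pi(k)$ for $k\ne i,i+1$. Case 3: If $\pi(i)>i$ and $\pi(i+1)=i$, let $j$ be the greatest number less than $i$ which is a weak excedance of $\pi$, and let $b=\pi^{-1}(j)$; $\sigma$ is the permutation of $(\{1,\dots,N+1\}\setminus\{i+1\})\cup\{j+\frac12\}$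 obtained by collapsing $\pi$ at $i+1$ and then replacing $b\mapsto j$ by $\sigma(b)=j+\frac12$ and $\sigma(j+\frac12)=j$. There is a transition $\pi\to\mathrm{Norm}(\sigma)$ with probability $\frac1{N+1}$. (c) ''Particle exits to the right''. If $\pi(N+1)=N+1$, let $i$ be the maximal number less than $N+1$ with $\pi(i)\ge i$, and let $a=\pi^{-1}(i)$. Let $\sigma$ be the permutation of $\{1,\dots,N\}\cup\{i+\frac12\}$ obtained by deleting the fixed point $N+1$ of $\pi$ and replacing $\pi(a)=i$ by $\sigma(a)=i+\frac12$ and $\sigma(i+\frac12)=i$. There is a transition $\pi\to\mathrm{Norm}(\sigma)$ with probability $\frac{\beta}{N+1}$. (d) ''Particle hops left''. If $\pi(i)<i$ and $\pi(i+1)\ge i+1$ for some $i\le N$, let $\sigma(i)=\pi(i+1)$, $\sigma(i+1)=\pi(i)$ and $\sigma(k)=\pi(k)$ for $k\neq i,i+1$. There is a transition $\pi\to\sigma$ with probability $\frac q{N+1}$.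
   Context: Parameters: $\alpha,\beta>0$ and $q\ge 0$ are real numbers such that all transition probabilities lie in $[0,1]$ (e.g. $0<\alpha,\beta\le 1$, $0\le q\le 1$). Permutations. A weak excedance of $\pi$ is an index $i$ with $\pi(i)\ge i$; a non-excedance is an index $i$ with $\pi(i)<i$. If $\pi$ is a permutation of a finite set $S$ of reals and $i\in S$ with $\pi(i)\ne i$, the collapse of $\pi$ at $i$ is the permutation $\sigma$ of $S\setminus\{i\}$ with $\sigma(\pi^{-1}(i))=\pi(i)$ and $\sigma(j)=\pi(j)$ for $j\ne\pi^{-1}(i)$. If $\pi$ is a permutation of $S=\{s_1<\dots<s_n\}$, its normalization $\mathrm{Norm}(\pi)$ is the permutation of $\{1,\dots,n\}$ obtained by replacing each $s_i$ by $i$. Permutation tableaux. A partition $\lambda=(\lambda_1\ge\dots\ge\lambda_t)$, $t\ge 1$, is a weakly decreasing sequence of nonnegative integers (parts equal to $0$ are allowed and counted as rows). Its Young diagram is left-justified with $\lambda_i$ boxes in row $i$ (rows numbered from top to bottom); its half-perimeter is the number of rows plus the number of columns, $t+\lambda_1$. The length of a row or column is its number of boxes. A permutation tableau of shape $\lambda$ is a filling of the boxes with $0$'s and $1$'s such that (1) each column contains at least one $1$; (2) there is no $0$ which has both a $1$ above it in the same column and a $1$ to its left in the same row. A $1$ is superfluous if there is another $1$ above it in its column, and necessary if it is the unique $1$ in its column. The bijection $\Phi$ (known to be a bijection from permutation tableaux of half-perimeter $n$ to $S_n$). Let $\mathcal T$ have shape $\lambda$ and half-perimeter $n$. Label the unit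 steps of the south-east border path of the Young diagram, from north-east corner to south-west corner, by $1,\dots,n$ (explicitly, for $r=1,\dots,t$ in turn: one south step, then $\lambda_r-\lambda_{r+1}$ west steps, with $\lambda_{t+1}:=0$). Each south step labels a row (at its right end), each west step labels a column (at its bottom). Define $\pi=\Phi(\mathcal T)$: if $i$ labels a row containing no $1$, then $\pi(i)=i$. If $i$ labels a row containing a $1$, start at the leftmost $1$ of this row and first go south; if $i$ labels a column, start at the topmost $1$ of this column and first go east. From then on proceed in zig-zag: going south from a $1$, move to the nearest $1$ below it in its column and turn east there, or, if there is none, end at the label of that column; going east from a $1$, move to the nearest $1$ to its right in its row and turn south there, or, if there is none, end at the label of that row. $\pi(i)$ is the label where the path ends. The PT chain is the Markov chain on the permutation tableaux of half-perimeter $N+1$ whose transitions from a tableau $\mathcal S$ of shape $\lambda=(\lambda_1,\dots,\lambda_t)$ are the following (inserting a row ''as far south as possible'' means below all rows of length at least that of the new row; inserting a column ''as far east as possible'' means to the right of all columns of length at least that of the new column). Particle enters from the left: if the rightmost column of $\mathcal S$ exists and has length $1$, delete this column and insert a new all-zero row of length $\lambda_1-1$ as far south as possible; probability $\alpha/(N+1)$. Particle hops right: for every $j\ge 2$ with $\lambda_j>\lambda_{j+1}$ (where $\lambda_{t+1}:=0$) there is one transition, of probability $1/(N+1)$. Case 1: if the rightmost entry of row $j$ is $0$ (then row $j$ is all zeros), delete row $j$ and insert a new row of $\lambda_j-1$ zeros as far south as possible. Case 2: if the rightmost entry of row $j$ is a superfluous $1$, delete that box. Case 3: if the rightmost entry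 of row $j$ is a necessary $1$, delete the column containing it (which has length $j$) and insert, as far east as possible, a new column of length $j-1$ consisting of $0$'s except for a $1$ in its bottom box. Particle exits to the right: if $t\ge 2$ and $\lambda_t=0$, delete row $t$ and insert, as far to the right as possible, a new column of length $t-1$ consisting (top to bottom) of $t-2$ zeros followed by a $1$; probability $\beta/(N+1)$. Particle hops left: for every $1\le j\le t-1$ with $\lambda_j>\lambda_{j+1}$, increase the length of row $j+1$ by $1$ and fill the new box with a $1$; probability $q/(N+1)$. All other transitions between distinct states have probability $0$, and with the remaining probability the chain stays in its current state. ''After applying $\Phi$'' means that the transition probability from $\Phi(\mathcal S)$ to $\Phi(\mathcal T)$ is the PT-chain transition probability from $\mathcal S$ to $\mathcal T$. *)

(* Defs.v *)
From HB Require Import structures.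
From mathcomp Require Import all_boot all_order all_algebra all_fingroup.

Set Implicit Arguments.
Unset Strict Implicit.
Unset Printing Implicit Defensive.

Import Order.TTheory GRing.Theory Num.Theory.

Local Open Scope nat_scope.

(* Tableaux are lists of rows, from top to bottom; the shape is the list of
   the lengths of the rows (a row may be empty), and rows and columns are
   numbered from 0. [entry s r c] is also [false] outside of the diagram. *)

Definition raw_tableau := seq (seq bool).

Implicit Types (s : raw_tableau) (r c : nat).

Definition row_at s r : seq bool := nth [::] s r.
Definition entry s r c : bool := nth false (row_at s r) c.
Definition nrows s : nat := size s.
Definition ncols s : nat := size (head [::] s).
Definition row_len s r : nat := size (row_at s r).
Definition col_len s c : nat := count (fun row => c < size row) s.
Definition half_perimeter s : nat := nrows s + ncols s.

Definition one_above s r c : bool := has (fun r' => entry s r' c) (iota 0 r).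
Definition one_left s r c : bool := has (fun c' => entry s r c') (iota 0 c).

Definition is_tableau (n : nat) s : bool :=
  [&& s != [::],
      sorted geq (map size s),
      half_perimeter s == n,
      all (fun c => has (fun r => entry s r c) (iota 0 (nrows s)))
          (iota 0 (ncols s))
    & all (fun r => all (fun c =>
             ~~ [&& ~~ entry s r c, one_above s r c & one_left s r c])
           (iota 0 (row_len s r))) (iota 0 (nrows s))].

Definition tableau (n : nat) := {s : raw_tableau | is_tableau n s}.

(* The south-east border, as the list of its steps from the north-east to the
   south-west corner: [inl r] is the south step at the end of row [r] and
   [inr c] is the west step at the bottom of column [c]. The [k]-th step,
   counted from 0, carries the label [k.+1]. *)

Definition step : Type := (nat + nat)%type.

Fixpoint border_from r s : seq step :=
  if s is row :: s' then
    let m := size (head [::] s') in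
    inl r :: [seq inr c | c <- rev (iota m (size row - m))]
      ++ border_from r.+1 s'
  else [::].

Definition border s : seq step := border_from 0 s.

Definition leftmost_one s r : option nat :=
  ohead [seq c <- iota 0 (row_len s r) | entry s r c].
Definition topmost_one s c : option nat :=
  ohead [seq r <- iota 0 (nrows s) | entry s r c].
Definition next_one_below s r c : option nat :=
  ohead [seq r' <- iota r.+1 (nrows s - r.+1) | entry s r' c].
Definition next_one_right s r c : option nat :=
  ohead [seq c' <- iota c.+1 (row_len s r - c.+1) | entry s r c'].

(* The zig-zag path leaving the 1 in box [(r, c)], going south if [south] and
   east otherwise; the result is the border step where it ends. Every move
   increases [r + c], so that [fuel = half_perimeter s] is never exhausted
   (see [zigzag_fuel] below). *)
Fixpoint zigzag (fuel : nat) s (south : bool) r c : step :=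
  if fuel is k.+1 then
    if south then
      if next_one_below s r c is Some r' then zigzag k s false r' c else inr c
    else
      if next_one_right s r c is Some c' then zigzag k s true r c' else inl r
  else inl r.

Definition path_end s (x : step) : step :=
  match x with
  | inl r => if leftmost_one s r is Some c
             then zigzag (half_perimeter s) s true r c else inl r
  | inr c => if topmost_one s c is Some r
             then zigzag (half_perimeter s) s false r c else inr c
  end.

(* Here and below, the elements [1, ..., N + 1] are represented by the ordinals
   of values [0, ..., N]. *)
Definition Phi_fun N s (i : 'I_N.+1) : 'I_N.+1 :=
  inord (index (path_end s (nth (inl 0) (border s) i)) (border s)).

Section ZigzagInjective.

Variable s : raw_tableau.

Let state := (bool * nat * nat)%type.
Implicit Types (x y z : state).

Let succ x : state + step :=
  let: (d, r, c) := x in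
  if d then
    if next_one_below s r c is Some r' then inl (false, r', c) else inr (inr c)
  else
    if next_one_right s r c is Some c' then inl (true, r, c') else inr (inl r).

Let rank x : nat := x.1.2 + x.2.

Let one x : bool := entry s x.1.2 x.2.

Let ohead_filter_iota (P : pred nat) m k :
  if ohead [seq i <- iota m k | P i] is Some i
  then [/\ P i, m <= i < m + k & forall j, m <= j < i -> ~~ P j]
  else forall j, m <= j < m + k -> ~~ P j.
Proof.
elim: k m => [|k IH] m /=.
  by move=> j; rewrite addn0 => /andP[a b]; have := leq_ltn_trans a b; rewrite ltnn.
case: ifPn => Pm /=.
  split=> //; first by rewrite leqnn -addSnnS leq_addr.
  by move=> j /andP[a b]; have := leq_ltn_trans a b; rewrite ltnn.
have := IH m.+1; case: ohead => [i|].
  move=> [Pi /andP[a b] H]; split=> //.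
    by rewrite (ltnW a) -addSnnS b.
  move=> j /andP[]; rewrite leq_eqVlt => /orP[/eqP <- //|mj] ji.
  by apply: H; rewrite mj ji.
move=> H j /andP[]; rewrite leq_eqVlt => /orP[/eqP <- //|mj] ji.
by apply: H; rewrite mj addSnnS.
Qed.

Let entry_row r c : entry s r c -> r < nrows s.
Proof.
rewrite /entry /row_at /nrows; case: ltnP => // h.
by rewrite (nth_default _ h) nth_nil.
Qed.

Let entry_col r c : entry s r c -> c < row_len s r.
Proof.
by rewrite /entry /row_len; case: ltnP => // h; rewrite nth_default.
Qed.

Let leftmost_oneP r :
  if leftmost_one s r is Some c
  then entry s r c /\ forall c', c' < c -> ~~ entry s r c'
  else forall c, ~~ entry s r c.
Proof.
have := ohead_filter_iota (entry s r) 0 (row_len s r).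
rewrite -/(leftmost_one s r); case: leftmost_one => [c [h _ H]|H c].
  by split=> // c' c'c; apply: H.
by apply/negP => h; move: (H c); rewrite h add0n (entry_col h) => /(_ isT).
Qed.

Let topmost_oneP c :
  if topmost_one s c is Some r
  then entry s r c /\ forall r', r' < r -> ~~ entry s r' c
  else forall r, ~~ entry s r c.
Proof.
have := ohead_filter_iota (fun r => entry s r c) 0 (nrows s).
rewrite -/(topmost_one s c); case: topmost_one => [r [h _ H]|H r].
  by split=> // r' r'r; apply: H.
by apply/negP => h; move: (H r); rewrite h add0n (entry_row h) => /(_ isT).
Qed.

Let next_one_belowP r c :
  if next_one_below s r c is Some r'
  then [/\ entry s r' c, r < r' & forall i, r < i < r' -> ~~ entry s i c]
  else forall i, r < i -> ~~ entry s i c.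
Proof.
have := ohead_filter_iota (fun i => entry s i c) r.+1 (nrows s - r.+1).
rewrite -/(next_one_below s r c).
case: next_one_below => [r' [h /andP[a _] H] //|H i ri].
apply/negP => h; move: (H i); rewrite h ri subnKC ?(entry_row h) => [/(_ isT)//|].
exact: leq_trans ri (ltnW (entry_row h)).
Qed.

Let next_one_rightP r c :
  if next_one_right s r c is Some c'
  then [/\ entry s r c', c < c' & forall i, c < i < c' -> ~~ entry s r i]
  else forall i, c < i -> ~~ entry s r i.
Proof.
have := ohead_filter_iota (entry s r) c.+1 (row_len s r - c.+1).
rewrite -/(next_one_right s r c).
case: next_one_right => [c' [h /andP[a _] H] //|H i ci].
apply/negP => h; move: (H i); rewrite h ci subnKC ?(entry_col h) => [/(_ isT)//|].
exact: leq_trans ci (ltnW (entry_col h)).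
Qed.

Let succ_one x y : succ x = inl y -> one y /\ rank x < rank y.
Proof.
case: x => [[[] r] c]; rewrite /one /rank /=.
  have := next_one_belowP r c; case: next_one_below => // r' [h rr' _] [<-] /=.
  by rewrite ltn_add2r.
have := next_one_rightP r c; case: next_one_right => // c' [h cc' _] [<-] /=.
by rewrite ltn_add2l.
Qed.

Let succ_inj x y : one x -> one y -> succ x = succ y -> x = y.
Proof.
case: x y => [[[] r] c] [[[] r'] c']; rewrite /one /= => h h'.
- have := next_one_belowP r c; have := next_one_belowP r' c'.
  case: next_one_below => [r1 [e1 l1 H1]|H1];
    case: next_one_below => [r2 [e2 l2 H2]|H2] //.
    move=> [e e']; subst r2 c'; case: (ltngtP r r') => [l|l|->] //.
      by have := H2 r'; rewrite l l1 h' => /(_ isT).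
    by have := H1 r; rewrite l l2 h => /(_ isT).
  move=> [e']; subst c'; case: (ltngtP r r') => [l|l|->] //.
    by have := H2 r'; rewrite l h' => /(_ isT).
  by have := H1 r; rewrite l h => /(_ isT).
- by case: next_one_below => [?|]; case: next_one_right.
- by case: next_one_right => [?|]; case: next_one_below.
- have := next_one_rightP r c; have := next_one_rightP r' c'.
  case: next_one_right => [r1 [e1 l1 H1]|H1];
    case: next_one_right => [r2 [e2 l2 H2]|H2] //.
    move=> [e e']; subst r2 r'; case: (ltngtP c c') => [l|l|->] //.
      by have := H2 c'; rewrite l l1 h' => /(_ isT).
    by have := H1 c; rewrite l l2 h => /(_ isT).
  move=> [e']; subst r'; case: (ltngtP c c') => [l|l|->] //.
    by have := H2 c'; rewrite l h' => /(_ isT).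
  by have := H1 c; rewrite l h => /(_ isT).
Qed.

Inductive ends_at : state -> step -> Prop :=
| ends_now x b of succ x = inr b : ends_at x b
| ends_later x y b of succ x = inl y & ends_at y b : ends_at x b.

Inductive reach x : state -> Prop :=
| reach0 : reach x x
| reachS y z of one y & reach x y & succ y = inl z : reach x z.

Let reach_left x y z : one x -> succ x = inl y -> reach y z -> reach x z.
Proof.
move=> ox xy; elim=> [|u v ou _ xu uv]; last exact: reachS xu uv.
by apply: reachS xy => //; apply: reach0.
Qed.

Let ends_last x b : one x -> ends_at x b ->
  exists y, [/\ one y, reach x y & succ y = inr b].
Proof.
move=> ox H; elim: H ox => [{}x {}b e ox|{}x y {}b e _ IH ox].
  by exists x; split=> //; apply: reach0.
have [oy _] := succ_one e; have [z [oz yz zb]] := IH oy.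
by exists z; split=> //; apply: reach_left yz.
Qed.

Let ends_comparable x y b : one x -> one y ->
  ends_at x b -> ends_at y b -> reach x y \/ reach y x.
Proof.
move=> ox oy H; elim: H ox oy => [{}x {}b e ox oy|{}x z {}b e _ IH ox oy] yb.
  have [u [ou yu ub]] := ends_last oy yb; right.
  by rewrite (@succ_inj x u) // e ub.
have [oz _] := succ_one e; have [zy|yz] := IH oz oy yb.
  by left; apply: reach_left zy.
case: yz e => [|u v ou yu uv] e.
  by left; apply: reachS e => //; apply: reach0.
by right; rewrite (@succ_inj x u) // e uv.
Qed.

Definition start x : Prop := one x /\ forall y, one y -> succ y <> inl x.

Let start_inj x y b : start x -> start y ->
  ends_at x b -> ends_at y b -> x = y.
Proof.
move=> [ox sx] [oy sy] xb yb.
case: (ends_comparable ox oy xb yb).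
  by move=> xy; case: xy sy => // u v ou _ uv sv; case: (sv u ou).
by move=> yx; case: yx sx => // u v ou _ uv sv; case: (sv u ou).
Qed.

Let start_row r c : leftmost_one s r = Some c -> start (true, r, c).
Proof.
move=> e; have := leftmost_oneP r; rewrite e => -[h H]; split=> //.
move=> [[[] r'] c'] /= h'; first by case: next_one_below.
have := next_one_rightP r' c'; case: next_one_right => // c1 [h1 l1 _] [e1 e2].
by subst r' c1; case/negP: (H _ l1); exact: h'.
Qed.

Let start_col r c : topmost_one s c = Some r -> start (false, r, c).
Proof.
move=> e; have := topmost_oneP c; rewrite e => -[h H]; split=> //.
move=> [[[] r'] c'] /= h'; last by case: next_one_right.
have := next_one_belowP r' c'; case: next_one_below => // r1 [h1 l1 _] [e1 e2].
by subst c' r1; case/negP: (H _ l1); exact: h'.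
Qed.

Lemma entry_lt r c : sorted geq (map size s) -> entry s r c ->
  r < nrows s /\ c < ncols s.
Proof.
move=> ss h; split; first exact: entry_row h.
apply: leq_trans (entry_col h) _; rewrite /row_len /row_at /ncols.
have hr := entry_row h; rewrite -nth0 -!(nth_map [::] 0 size) //; last first.
  exact: leq_ltn_trans hr.
by apply: (sorted_leq_nth (rev_trans leq_trans) leqnn) => //;
  rewrite inE size_map //; apply: leq_ltn_trans hr.
Qed.

Lemma zigzag_fuel k d r c : sorted geq (map size s) -> entry s r c ->
  half_perimeter s <= k + (r + c) ->
  ends_at (d, r, c) (zigzag k s d r c).
Proof.
move=> ss; elim: k d r c => [|k IH] d r c h.
  have [a b] := entry_lt ss h.
  by rewrite leqNgt add0n -addSn leq_add // ltnW.
rewrite addSn => hk.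
case: d => /=.
  have := next_one_belowP r c; case e: next_one_below => [r'|].
    move=> [h' l _]; apply: (@ends_later _ (false, r', c)); first by rewrite /= e.
    by apply: IH => //; apply: leq_trans hk _; rewrite -addnS leq_add2l -addSn leq_add2r.
  by move=> _; apply: ends_now; rewrite /= e.
have := next_one_rightP r c; case e: next_one_right => [c'|].
  move=> [h' l _]; apply: (@ends_later _ (true, r, c')); first by rewrite /= e.
  by apply: IH => //; apply: leq_trans hk _; rewrite -!addnS !leq_add2l.
by move=> _; apply: ends_now; rewrite /= e.
Qed.

Definition in_diagram (b : step) : Prop :=
  match b with inl r => r < nrows s | inr c => c < ncols s end.

Let ends_in x b : sorted geq (map size s) -> one x -> ends_at x b -> in_diagram b.
Proof.
move=> ss ox H; elim: H ox => [{}x {}b|{}x y {}b e _ IH ox].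
  case: x => [[d r] c]; rewrite /one /= => e ox.
  have [hr hc] := entry_lt ss ox; move: e.
  by case: d; [case: next_one_below|case: next_one_right] => // -[<-].
by have [oy _] := succ_one e; apply: IH.
Qed.

Let ends_row_one x r : one x -> ends_at x (inl r) -> exists c, entry s r c.
Proof.
move=> ox H; have [[[d r'] c'] [oy _ /=]] := ends_last ox H; rewrite /one /= in oy.
case: d; first by case: next_one_below.
by case: next_one_right => // -[<-]; exists c'.
Qed.

Lemma zigzag_start d r c : sorted geq (map size s) -> start (d, r, c) ->
  ends_at (d, r, c) (zigzag (half_perimeter s) s d r c).
Proof. by move=> ss [h _]; apply: zigzag_fuel => //; apply: leq_addr. Qed.

Lemma path_end_in b : sorted geq (map size s) -> in_diagram b ->
  in_diagram (path_end s b).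
Proof.
move=> ss; case: b => [r|c] /= h.
  case e: leftmost_one => [c|//]; have st := start_row e.
  exact: (ends_in ss st.1 (zigzag_start ss st)).
case e: topmost_one => [r|//]; have st := start_col e.
exact: (ends_in ss st.1 (zigzag_start ss st)).
Qed.

Lemma path_end_inj b b' : sorted geq (map size s) ->
  (forall c, c < ncols s -> exists r, entry s r c) ->
  in_diagram b -> in_diagram b' -> path_end s b = path_end s b' -> b = b'.
Proof.
move=> ss hcol.
have top c : c < ncols s -> exists r, topmost_one s c = Some r.
  move=> /hcol[r h]; have := topmost_oneP c.
  by case e: topmost_one => [r'|]; [exists r' | move=> /(_ r); rewrite h].
have rowfix r r' c : leftmost_one s r = None -> forall d, start (d, r', c) ->
    inl r <> zigzag (half_perimeter s) s d r' c.
  move=> e d st er; have := zigzag_start ss st; rewrite -er => H.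
  have [c' h] := ends_row_one st.1 H.
  by have := leftmost_oneP r; rewrite e => /(_ c'); rewrite h.
case: b b' => [r|c] [r'|c'] /= hb hb'.
- case e: leftmost_one => [c|]; case e': leftmost_one => [c'|].
  + move=> E; have := zigzag_start ss (start_row e); rewrite E => H.
    by have [-> _] := start_inj (start_row e) (start_row e') H
                       (zigzag_start ss (start_row e')).
  + by move=> /esym E; case: (rowfix _ _ _ e' _ (start_row e)).
  + by move=> E; case: (rowfix _ _ _ e _ (start_row e')).
  + by [].
- have [r' e'] := top _ hb'; rewrite e'; case e: leftmost_one => [c|].
  + move=> E; have := zigzag_start ss (start_row e); rewrite E => H.
    by have := start_inj (start_row e) (start_col e') H
                       (zigzag_start ss (start_col e')).
  + by move=> E; case: (rowfix _ _ _ e _ (start_col e')).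
- have [r e] := top _ hb; rewrite e; case e': leftmost_one => [c'|].
  + move=> E; have := zigzag_start ss (start_col e); rewrite E => H.
    by have := start_inj (start_col e) (start_row e') H
                       (zigzag_start ss (start_row e')).
  + by move=> /esym E; case: (rowfix _ _ _ e' _ (start_col e)).
- have [r e] := top _ hb; have [r' e'] := top _ hb'; rewrite e e' => E.
  have := zigzag_start ss (start_col e); rewrite E => H.
  by have [_ ->] := start_inj (start_col e) (start_col e') H
                     (zigzag_start ss (start_col e')).
Qed.

End ZigzagInjective.

Lemma mem_border_from r s (b : step) : sorted geq (map size s) ->
  (b \in border_from r s) =
  match b with
  | inl i => r <= i < r + nrows s
  | inr c => c < ncols s
  end.
Proof.
elim: s r b => [|row s IH] r b ss.
  by case: b => [i|c] //; rewrite /nrows /= addn0; case: ltngtP.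
have ss' : sorted geq (map size s) by apply: path_sorted ss.
have hd : size (head [::] s) <= size row.
  by move: ss; case: (s) => [|row' s'] //= /andP[].
rewrite /= inE mem_cat IH //; case: b => [i|c] /=.
  have -> : (inl i \in [seq inr c | c <- rev (iota (size (head [::] s))
              (size row - size (head [::] s)))]) = false :> bool.
    by apply/negP => /mapP[].
  rewrite /= /nrows /= addSnnS; have -> : (inl i == inl r :> step) = (i == r) by [].
  by case: ltngtP => //= ->; rewrite -[X in X < _]addn0 ltn_add2l.
rewrite mem_map; last by move=> ? ? [].
rewrite mem_rev mem_iota subnKC // /ncols /=.
by case: (ltnP c (size (head [::] s))) => h; rewrite ?orbT ?orbF //= (leq_trans h hd).
Qed.

Lemma uniq_border_from r s : sorted geq (map size s) -> uniq (border_from r s).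
Proof.
elim: s r => [|row s IH] r ss //=.
have ss' : sorted geq (map size s) by apply: path_sorted ss.
rewrite cat_uniq mem_cat negb_or mem_border_from // ltnn /= IH // andbT.
apply/and3P; split; first by apply/negP => /mapP[].
  by rewrite map_inj_uniq ?rev_uniq ?iota_uniq // => ? ? [].
rewrite andbT; apply/hasPn => -[i|c]; rewrite mem_border_from // => h; apply/negP => /mapP[x] //.
by rewrite mem_rev mem_iota => /andP[a _] [e]; move: h; rewrite ltnNge /ncols e a.
Qed.

Lemma size_border_from r s : sorted geq (map size s) ->
  size (border_from r s) = half_perimeter s.
Proof.
elim: s r => [|row s IH] r ss //=.
have ss' : sorted geq (map size s) by apply: path_sorted ss.
have hd : size (head [::] s) <= size row.
  by move: ss; case: (s) => [|row' s'] //= /andP[].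
rewrite size_cat size_map size_rev size_iota IH // /half_perimeter /nrows /ncols /=.
by rewrite addSn addnCA subnK.
Qed.

Lemma Phi_fun_inj N (S : tableau N.+1) : injective (@Phi_fun N (val S)).
Proof.
case: S => s /= /and5P[_ ss /eqP hp /allP hcol _] i j.
have szb : size (border s) = N.+1 by rewrite size_border_from.
have hin (k : 'I_N.+1) : nth (inl 0) (border s) k \in border s.
  by rewrite mem_nth // szb.
have hin' b : b \in border s -> in_diagram s b.
  by rewrite mem_border_from //; case: b.
have hout b : in_diagram s b -> b \in border s.
  by rewrite mem_border_from //; case: b.
have hend (k : 'I_N.+1) : path_end s (nth (inl 0) (border s) k) \in border s.
  by apply/hout/path_end_in/hin'/hin.
move=> /(congr1 val); rewrite /= !inordK; last 2 first.
- by rewrite -[X in _ < X]szb index_mem.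
- by rewrite -[X in _ < X]szb index_mem.
move=> /(congr1 (nth (inl 0) (border s))); rewrite !nth_index // => E.
apply/val_inj/eqP; rewrite -(nth_uniq (inl 0) _ _ (uniq_border_from 0 ss)).
- apply/eqP; apply: path_end_inj E => //; try exact/hin'/hin.
  move=> c hc; have /hasP[r _ h] : has ((entry s)^~ c) (iota 0 (nrows s)).
    by apply: hcol; rewrite mem_iota.
  by exists r.
- by rewrite -/(border s) szb ltn_ord.
- by rewrite -/(border s) szb ltn_ord.
Qed.

Definition Phi N (S : tableau N.+1) : 'S_N.+1 := perm (@Phi_fun_inj N S).

Definition corner s r : bool := row_len s r.+1 < row_len s r.

Definition del_row s r : raw_tableau := take r s ++ drop r.+1 s.

Definition del_col s c : raw_tableau :=
  [seq take c row ++ drop c.+1 row | row <- s].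

(* New rows are inserted as far south, and new columns as far east, as
   possible. *)
Definition insert_zero_row s (m : nat) : raw_tableau :=
  let p := count (fun row => m <= size row) s in
  take p s ++ nseq m false :: drop p s.

Definition insert_col s (col : seq bool) : raw_tableau :=
  let p := count (fun c => size col <= col_len s c) (iota 0 (ncols s)) in
  [seq (let row := row_at s r in
        if r < size col then take p row ++ nth false col r :: drop p row
        else row) | r <- iota 0 (nrows s)].

Definition bottom_one_col (m : nat) : seq bool := rcons (nseq m.-1 false) true.

Definition enter_left s : seq raw_tableau :=
  let c := (ncols s).-1 in
  if (0 < ncols s) && (col_len s c == 1)
  then [:: insert_zero_row (del_col s c) c] else [::].

(* The corner box at the end of row [r] is the bottom box of its column, so
   that a 1 in it is either superfluous or necessary according to whether there
   is a 1 above it. *)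
Definition hop_right_at s r : raw_tableau :=
  let c := (row_len s r).-1 in
  if ~~ entry s r c then insert_zero_row (del_row s r) c
  else if one_above s r c then set_nth [::] s r (take c (row_at s r))
  else insert_col (del_col s c) (bottom_one_col r).

Definition hop_right s : seq raw_tableau :=
  [seq hop_right_at s r | r <- iota 1 (nrows s).-1 & corner s r].

Definition exit_right s : seq raw_tableau :=
  let r := (nrows s).-1 in
  if (1 < nrows s) && (row_len s r == 0)
  then [:: insert_col (del_row s r) (bottom_one_col r)] else [::].

Definition hop_left s : seq raw_tableau :=
  [seq set_nth [::] s r.+1 (rcons (row_at s r.+1) true)
    | r <- iota 0 (nrows s).-1 & corner s r].

(* Permutations of finite sets of rationals; the values of [set_fun] outside of
   [support] are irrelevant. *)

Record set_perm := SetPerm { support : seq rat; set_fun :> rat -> rat }.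

Implicit Types (sigma : set_perm).

Definition half (k : nat) : rat := (k%:R + 2^-1)%R.

Definition collapse sigma (i : rat) : set_perm :=
  SetPerm (rem i (support sigma))
    (fun x => if sigma x == i then sigma i else sigma x).

Definition del_fixpoint sigma (i : rat) : set_perm :=
  SetPerm (rem i (support sigma)) sigma.

Definition add_fixpoint sigma (x : rat) : set_perm :=
  SetPerm (x :: support sigma) [eta sigma with x |-> x].

(* [b |-> j] is replaced by [b |-> x |-> j], where [b] is the inverse image of
   [j]. *)
Definition insert_before sigma (j x : rat) : set_perm :=
  SetPerm (x :: support sigma)
    (fun y => if y == x then j else if sigma y == j then x else sigma y).

Definition swap_values sigma (i j : rat) : set_perm :=
  SetPerm (support sigma) [eta sigma with i |-> sigma j, j |-> sigma i].

Definition sorted_support sigma : seq rat := sort <=%R (support sigma).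

Definition Norm N sigma : {ffun 'I_N.+1 -> 'I_N.+1} :=
  let t := sorted_support sigma in
  [ffun k : 'I_N.+1 => inord (index (sigma (nth 0%R t k)) t)].

Definition fun_at N (f : {ffun 'I_N.+1 -> 'I_N.+1}) (k : nat) : nat :=
  (f (inord k.-1)).+1.

(* Moves on permutations of [{1, ..., N + 1}], given as functions [p] on the
   integers. *)

Section PermutationMoves.

Variables (N : nat) (p : nat -> nat).

Definition to_set_perm : set_perm :=
  SetPerm [seq k%:R%R | k <- iota 1 N.+1] (fun x => (p (Num.truncn x))%:R%R).

Definition weak_excedance (k : nat) : bool := k <= p k.
Definition non_excedance (k : nat) : bool := p k < k.

(* The smallest non-excedance greater than [m], or [N + 2] if there is none. *)
Definition next_non_excedance (m : nat) : nat :=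
  head N.+2 [seq k <- iota m.+1 (N.+1 - m) | non_excedance k].

(* The greatest weak excedance smaller than [m]; it exists for [m > 1], since
   [1] is a weak excedance. *)
Definition prev_weak_excedance (m : nat) : nat :=
  last 1 [seq k <- iota 1 m.-1 | weak_excedance k].

Definition perm_enter_left : seq set_perm :=
  if p 2 == 1 then
    let i := (next_non_excedance 2).-1 in
    [:: add_fixpoint (collapse to_set_perm 2%:R) (half i)]
  else [::].

Definition perm_hop_right_at (i : nat) : set_perm :=
  if p i == i then
    let j := (next_non_excedance i.+1).-1 in
    add_fixpoint (del_fixpoint to_set_perm i%:R) (half j)
  else if p i.+1 < i then swap_values to_set_perm i%:R i.+1%:R
  else
    let j := prev_weak_excedance i in
    insert_before (collapse to_set_perm i.+1%:R) j%:R (half j).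

Definition perm_hop_right : seq set_perm :=
  [seq perm_hop_right_at i
    | i <- iota 2 N.-1 & weak_excedance i && non_excedance i.+1].

Definition perm_exit_right : seq set_perm :=
  if p N.+1 == N.+1 then
    let i := prev_weak_excedance N.+1 in
    [:: insert_before (del_fixpoint to_set_perm N.+1%:R) i%:R (half i)]
  else [::].

Definition perm_hop_left : seq set_perm :=
  [seq swap_values to_set_perm i%:R i.+1%:R
    | i <- iota 1 N & non_excedance i && weak_excedance i.+1].

End PermutationMoves.

Section Chains.

Local Open Scope ring_scope.

Variables (R : realFieldType) (N : nat) (alpha beta q : R).

(* [moves x] lists the moves from [x] with their probabilities; the chain stays
   at [x] with the remaining probability. *)
Definition transition (T : eqType) (moves : T -> seq (R * T)) (x y : T) : R :=
  if x == y then 1 - \sum_(m <- moves x | m.2 != x) m.1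
  else \sum_(m <- moves x | m.2 == y) m.1.

Definition weighted (T : Type) (w : R) (l : seq T) : seq (R * T) :=
  [seq (w / N.+1%:R, x) | x <- l].

Definition tableau_moves (s : raw_tableau) : seq (R * raw_tableau) :=
  weighted alpha (enter_left s) ++ weighted 1 (hop_right s)
    ++ weighted beta (exit_right s) ++ weighted q (hop_left s).

Definition PT_chain (S T : tableau N.+1) : R :=
  transition tableau_moves (val S) (val T).

(* [Norm] does nothing for [perm_hop_left], which leaves the support
   unchanged. *)
Definition perm_moves (f : {ffun 'I_N.+1 -> 'I_N.+1}) :
    seq (R * {ffun 'I_N.+1 -> 'I_N.+1}) :=
  let p := fun_at f in
  let norm := map (@Norm N) in
  weighted alpha (norm (perm_enter_left N p))
    ++ weighted 1 (norm (perm_hop_right N p))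
    ++ weighted beta (norm (perm_exit_right N p))
    ++ weighted q (norm (perm_hop_left N p)).

Definition perm_chain (pi tau : 'S_N.+1) : R :=
  transition perm_moves [ffun i => pi i] [ffun i => tau i].

End Chains.

(* Main.v *)
Require Import Defs.
From mathcomp Require Import all_boot all_order all_algebra all_fingroup.

Set Implicit Arguments.
Unset Strict Implicit.
Unset Printing Implicit Defensive.

Import Order.TTheory GRing.Theory Num.Theory.

Local Open Scope ring_scope.

(** The zig-zag paths through a tableau can be drawn all at once.  Let every
    row be entered by a path from the left and every column from above, let a
    path go straight on through a 0 and turn at a 1.  Then the two paths that
    enter a box leave it exchanged exactly if the box contains a 1, so that the
    permutation of the tableau is a product of transpositions
    (row label, column label), one for each 1, in reading order
    ([label_path_end]); transpositions of boxes that share neither a row nor a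
    column commute.

    The steps of the border are labels from an ordered set, a row [i] and a
    column [j] meet in a box exactly if [i < j], and every column contains a 1.
    Hence a tableau is nothing but a finite relation [E i j] on its labels which
    says that the box [(i, j)] contains a 1 ([tableau_rel]): its columns are the
    labels that are second components of [E], and all other labels are rows.
    Labels are rational numbers, and only their order matters, so that a row or
    a column can be deleted, or inserted at a half-integer, without touching the
    other labels.  In these terms every move of the chain is a composition of
    very few local changes:
    - the label of an empty row is deleted or inserted: the product of
      transpositions is unchanged and a fixed point is deleted or added;
    - a column with a single 1, in a corner, is deleted or inserted: its
      transposition commutes with all later ones and may be taken to be the last
      factor, so that deleting it is a collapse ([path_perm_add_col],
      [path_perm_del_col]);
    - a 1 is added to or deleted from a corner: besides the last factor
      [(i, j)], the labels of the row and the column exchange their roles, which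
      conjugates by the same transposition; altogether the permutation is
      composed with [(i, j)] on the right ([path_perm_add_box],
      [path_perm_remove_box]).

    Since paths only go south and east, a label is a column exactly if it is a
    non-excedance ([is_col_lt]).  The corners are therefore the weak excedances
    [i] followed by a non-excedance [j], and the three kinds of corners are
    told apart by whether [i] is a fixed point and whether [j] is mapped below
    [i] ([corner_eq_row], [corner_lt_row]).  This matches the cases of the moves
    on both sides.  It also gives the bijectivity: looking at the first corner,
    a tableau and its permutation can be reduced simultaneously, and each step
    can be undone ([path_perm_surj], [path_perm_rel_inj]).

    The rest of the proof relates the relations to the fillings ([raw]) and
    their borders, and reads each operation on fillings as one of the local
    changes above. *)

(** * Products of transpositions *)

Definition transp (T : eqType) (i j x : T) : T :=
  if x == i then j else if x == j then i else x.

Definition run (T : eqType) (P : seq (T * T)) (x : T) : T :=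
  foldl (fun y p => transp p.1 p.2 y) x P.

Lemma transpL (T : eqType) (i j : T) : transp i j i = j.
Proof. by rewrite /transp eqxx. Qed.

Lemma transpR (T : eqType) (i j : T) : transp i j j = i.
Proof. by rewrite /transp eqxx; case: eqP. Qed.

Lemma transpD (T : eqType) (i j x : T) : x != i -> x != j -> transp i j x = x.
Proof. by rewrite /transp => /negbTE-> /negbTE->. Qed.

Lemma transpK (T : eqType) (i j : T) : involutive (transp i j).
Proof.
move=> x; rewrite {2}/transp; case: eqP => [->|/eqP xi]; first exact: transpR.
by case: eqP => [->|/eqP xj]; [exact: transpL | exact: transpD].
Qed.

Lemma transp_inj (T : eqType) (i j : T) : injective (transp i j).
Proof. exact: inv_inj (@transpK T i j). Qed.

Lemma run_cat (T : eqType) (P Q : seq (T * T)) x :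
  run (P ++ Q) x = run Q (run P x).
Proof. exact: foldl_cat. Qed.

Lemma run_inj (T : eqType) (P : seq (T * T)) : injective (run P).
Proof. by elim: P => [|p P IH] x y //= /IH/transp_inj. Qed.

Definition avoids (T : eqType) (P : seq (T * T)) (x : T) : Prop :=
  {in P, forall p, (x != p.1) && (x != p.2)}.

Lemma avoids_cons (T : eqType) p (P : seq (T * T)) x :
  avoids (p :: P) x -> [/\ x != p.1, x != p.2 & avoids P x].
Proof.
move=> H; have /andP[-> ->] := H p (mem_head _ _); split=> // p' hp'.
by apply: H; rewrite inE hp' orbT.
Qed.

Lemma run_avoids (T : eqType) (P : seq (T * T)) x : avoids P x -> run P x = x.
Proof.
by elim: P => [|p P IH] //= /avoids_cons[h1 h2 /IH]; rewrite transpD.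
Qed.

Lemma run_transp (T : eqType) (P : seq (T * T)) i j x :
  avoids P i -> avoids P j -> run P (transp i j x) = transp i j (run P x).
Proof.
elim: P x => [|[a b] P IH] x //= /avoids_cons[/= ia ib Pi] /avoids_cons[/= ja jb Pj].
rewrite -IH //; congr run.
have [->|xi] := eqVneq x i; first by rewrite transpL !(transpD ja jb) (transpD ia ib) transpL.
have [->|xj] := eqVneq x j; first by rewrite transpR !(transpD ia ib) (transpD ja jb) transpR.
rewrite (transpD xi xj) [RHS]transpD //= /transp.
  by case: (x =P a) => _; [rewrite eq_sym | case: (x =P b) => // _; rewrite eq_sym].
by case: (x =P a) => _; [rewrite eq_sym | case: (x =P b) => // _; rewrite eq_sym].
Qed.

Lemma run_map (T : eqType) (f : T -> T) (P : seq (T * T)) x : injective f ->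
  run [seq (f p.1, f p.2) | p <- P] (f x) = f (run P x).
Proof.
move=> f_inj; elim: P x => [|p P IH] x //=; rewrite -IH; congr run.
by rewrite /transp !(inj_eq f_inj); case: eqP => // _; case: eqP.
Qed.

(** * Strictly sorted lists of labels *)

Definition asc : seq rat -> bool := sorted <%R.

Lemma gt_trans_rat : transitive (>%R : rel rat).
Proof. by move=> a b c /= h1 h2; apply: lt_trans h2 h1. Qed.

Lemma asc_uniq ell : asc ell -> uniq ell.
Proof. exact: (sorted_uniq lt_trans ltxx). Qed.

Lemma asc_filter a ell : asc ell -> asc (filter a ell).
Proof. exact: (sorted_filter lt_trans). Qed.

Lemma asc_eq ell ell' : asc ell -> asc ell' -> ell =i ell' -> ell = ell'.
Proof. exact: (irr_sorted_eq lt_trans ltxx). Qed.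

Lemma asc_index ell x y : asc ell -> x \in ell -> y \in ell ->
  (index x ell < index y ell)%N = (x < y).
Proof.
move=> s hx hy; apply/idP/idP.
  by move=> h; apply: (sorted_ltn_index lt_trans s).
apply: contraTT; rewrite -leqNgt -leNgt.
rewrite leq_eqVlt => /orP[/eqP e|h]; last exact/ltW/(sorted_ltn_index lt_trans s).
by rewrite -(nth_index 0 hx) -e nth_index.
Qed.

(** Singles out the first transposition that moves a given label, or the
    transposition of a given box. *)
Lemma sorted_split (T : eqType) (r : rel T) (P : seq T) p :
  transitive r -> irreflexive r -> sorted r P -> p \in P ->
  P = filter (r^~ p) P ++ p :: filter (r p) P.
Proof.
move=> tr irr + pP; case/splitPr: pP => A B.
rewrite sorted_pairwise // pairwise_cat pairwise_cons => /and3P[+ _ /andP[/allP pB _]].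
move=> /allrelP AB.
have e1 : filter (r^~ p) A = A.
  by rewrite (eq_in_filter (a2 := xpredT)) ?filter_predT // => a aA; rewrite AB ?mem_head.
have e2 : filter (r p) B = B.
  by rewrite (eq_in_filter (a2 := xpredT)) ?filter_predT // => b /pB.
have e3 : filter (r p) A = [::].
  apply/eqP; rewrite -[_ == _]negbK -has_filter; apply/hasPn => a aA; apply/negP => pa.
  by have := tr _ _ _ (AB a p aA (mem_head _ _)) pa; rewrite irr.
have e4 : filter (r^~ p) B = [::].
  apply/eqP; rewrite -[_ == _]negbK -has_filter; apply/hasPn => b bB; apply/negP => bp.
  by have := tr _ _ _ bp (pB _ bB); rewrite irr.
by rewrite !filter_cat /= !irr e1 e2 e3 e4 cats0.
Qed.

Definition consecutive (ell : seq rat) (i j : rat) : Prop :=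
  [/\ i \in ell, j \in ell, i < j & {in ell, forall x, (x <= i) || (j <= x)}].

Lemma asc_consecutive A B i j : asc (A ++ i :: j :: B) ->
  consecutive (A ++ i :: j :: B) i j.
Proof.
rewrite /asc sorted_pairwise; last exact: lt_trans.
rewrite pairwise_cat !pairwise_cons /= => /and3P[+ _ /and3P[/andP[ij _] /allP jB _]].
move=> /allrelP AB; split; rewrite ?mem_cat ?inE ?eqxx ?orbT //.
move=> x; rewrite mem_cat !inE => /or4P[xA|/eqP->|/eqP->|/jB/ltW->]; rewrite ?lexx ?orbT //.
by rewrite ltW // AB // mem_head.
Qed.

Lemma consecutive_lt ell i j x : consecutive ell i j -> x \in ell -> i < x -> j <= x.
Proof. by case=> _ _ _ H /H; case: leP. Qed.

Lemma consecutive_gt ell i j x : consecutive ell i j -> x \in ell -> x < j -> x <= i.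
Proof. by case=> _ _ _ H /H; case: (leP x i) => //= _; case: leP. Qed.

(** No label lies between [i] and [j]; so exchanging them reverses no comparison
    but their own. *)
Lemma transp_lt ell i j x y : consecutive ell i j -> x \in ell -> y \in ell ->
  x < y -> ~~ ((x == i) && (y == j)) -> transp i j x < transp i j y.
Proof.
move=> c hx hy xy n; have ij : i < j by case: c.
rewrite /transp; case: (eqVneq x i) n => [xi|xi] /= n.
  subst x; rewrite (negbTE n) (gt_eqF xy) lt_neqAle (consecutive_lt c) //.
  by rewrite eq_sym n.
case: (eqVneq x j) => [xj|xj].
  by subst x; rewrite !gt_eqF //; apply: lt_trans xy.
case: (eqVneq y i) => [yi|yi]; first by subst y; apply: lt_trans ij.
case: (eqVneq y j) => [yj|yj //].
by subst y; rewrite lt_neqAle xi (consecutive_gt c).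
Qed.

(** * Permutation tableaux as relations *)

(** A permutation tableau with labels in [ell]; [E i j] says that row [i] and
    column [j] meet in a box filled with a 1.  As every column contains a 1, the
    columns can be recovered as the labels [j] with some [E i j]; all other
    labels are rows.  The field [rel_bip] says that no label is both a row and a
    column, and [rel_le] is the condition on the 0s: row labels increase
    from top to bottom and column labels from right to left. *)
Record tableau_rel (ell : seq rat) (E : rel rat) : Prop := TableauRel {
  rel_dom : forall i j, E i j -> [/\ i \in ell, j \in ell & i < j];
  rel_bip : forall i j k, E i j -> E j k -> False;
  rel_le : forall k i j l, E k j -> E i l -> k < i -> i < j -> j < l -> E i j }.

(** Rows come from top to bottom and, in a row, columns from left to right,
    that is, by decreasing labels. *)
Definition reading (p q : rat * rat) : bool :=
  (p.1 < q.1) || (p.1 == q.1) && (q.2 < p.2).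

Definition ones (E : rel rat) (ell : seq rat) : seq (rat * rat) :=
  [seq p <- [seq (i, j) | i <- ell, j <- rev ell] | E p.1 p.2].

(** The permutation of the tableau: at a 1, the path that goes along the row and
    the path that goes along the column exchange their directions. *)
Definition path_perm (E : rel rat) (ell : seq rat) : rat -> rat := run (ones E ell).

Implicit Types (E : rel rat) (ell : seq rat).

Lemma reading_trans : transitive reading.
Proof.
move=> [b b'] [a a'] [c c']; rewrite /reading /=.
case/orP=> [ab|/andP[/eqP-> ab]]; case/orP=> [bc|/andP[/eqP<- bc]].
- by rewrite (lt_trans ab bc).
- by rewrite ab.
- by rewrite bc.
- by rewrite eqxx (lt_trans bc ab) orbT.
Qed.

Lemma reading_irr : irreflexive reading.
Proof. by move=> p; rewrite /reading !ltxx andbF. Qed.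

Lemma mem_ones E ell p :
  (p \in ones E ell) = [&& p.1 \in ell, p.2 \in ell & E p.1 p.2].
Proof.
rewrite mem_filter andbC andbA; congr (_ && _).
case: p => i j /=; apply/allpairsP/andP => [[[i' j'] /= [hi hj [-> ->]]]|[hi hj]].
  by rewrite hi -mem_rev.
by exists (i, j); rewrite /= mem_rev.
Qed.

Lemma sorted_ones E ell : asc ell -> sorted reading (ones E ell).
Proof.
move=> s; apply: sorted_filter; first exact: reading_trans.
have: sorted >%R (rev ell) by rewrite rev_sorted.
move: (rev ell) => B sB; elim: ell s => [|a A IH] //= sA.
rewrite (sorted_pairwise reading_trans) pairwise_cat -!(sorted_pairwise reading_trans).
rewrite IH ?andbT; last exact: path_sorted sA.
apply/andP; split.
  apply/allrelP => _ _ /mapP[b bB ->] /allpairsP[[a' b'] /= [a'A _ ->]].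
  move: sA; rewrite (path_sortedE lt_trans) => /andP[/allP/(_ _ a'A) aa' _].
  by rewrite /reading /= aa'.
rewrite sorted_map; apply: sub_sorted sB => x y xy.
by rewrite /reading /= ltxx eqxx.
Qed.

Lemma ones_ext E E' ell ell' : asc ell -> asc ell' ->
  (forall i j, [&& i \in ell, j \in ell & E i j]
             = [&& i \in ell', j \in ell' & E' i j]) ->
  ones E ell = ones E' ell'.
Proof.
move=> s s' e; apply: (irr_sorted_eq reading_trans reading_irr); try exact: sorted_ones.
by move=> p; rewrite !mem_ones.
Qed.

Lemma eq_path_perm E E' ell x : E =2 E' -> path_perm E ell x = path_perm E' ell x.
Proof. by move=> e; rewrite /path_perm /ones; congr run; apply: eq_filter => p; rewrite e. Qed.

(** Empty rows contain no 1, so their labels can be added and removed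
    freely. *)
Lemma path_perm_supp E ell ell' x : asc ell -> asc ell' ->
  tableau_rel ell E -> tableau_rel ell' E -> path_perm E ell x = path_perm E ell' x.
Proof.
move=> s s' t t'; rewrite /path_perm; congr run; apply: ones_ext => // i j.
apply/and3P/and3P => -[_ _ h]; split=> //.
all: by [have [] := rel_dom t h|have [] := rel_dom t' h].
Qed.

Lemma tableau_rel_sub ell ell' E : tableau_rel ell E ->
  (forall i j, E i j -> i \in ell' /\ j \in ell') -> tableau_rel ell' E.
Proof.
move=> t h; split; [|exact: rel_bip t|exact: rel_le t].
by move=> i j e; have [-> ->] := h _ _ e; have [] := rel_dom t e.
Qed.

Lemma run_closed (T : eqType) (S : pred T) (P : seq (T * T)) x :
  {in P, forall p, S p.1 && S p.2} -> S x -> S (run P x).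
Proof.
elim: P x => [|p P IH] x //= H Sx; apply: IH.
  by move=> q qP; apply: H; rewrite inE qP orbT.
by have /andP[? ?] := H p (mem_head _ _); rewrite /transp; case: eqP => // _; case: eqP.
Qed.

Lemma path_perm_mem ell E x : x \in ell -> path_perm E ell x \in ell.
Proof.
apply: (@run_closed _ [in ell]) => p; rewrite mem_ones => /and3P[h1 h2 _].
exact/andP.
Qed.

Lemma path_perm_inj ell E : injective (path_perm E ell).
Proof. exact: run_inj. Qed.

Lemma path_perm_id ell E x :
  (forall k, ~~ E k x) -> (forall k, ~~ E x k) -> path_perm E ell x = x.
Proof.
move=> h1 h2; apply: run_avoids => -[i j]; rewrite mem_ones => /and3P[_ _ /= e].
by apply/andP; split; apply/eqP => xe; [move: (h2 j)|move: (h1 i)]; rewrite xe e.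
Qed.

(** * Excedances *)

(** The properties of the list of the 1s of a tableau which are inherited by its
    suffixes, as needed for inductions along a path. *)
Definition reading_word (P : seq (rat * rat)) : Prop :=
  [/\ pairwise reading P, {in P, forall p, p.1 < p.2} &
      {in P &, forall p q, p.2 != q.1}].

Lemma reading_word_cons p P : reading_word (p :: P) ->
  [/\ reading_word P, p.1 < p.2, {in P, forall q, p.1 <= q.1},
      {in P, forall q, q.1 = p.1 -> q.2 < p.2} &
      {in P, forall q, (p.2 != q.1) && (q.2 != p.1)}].
Proof.
have sub q : q \in P -> q \in p :: P by rewrite inE orbC => ->.
move=> [/=/andP[/allP r1 r2] lt bip].
split; [split=> //| | | |].
- by move=> q /sub/lt.
- by move=> q q' /sub h /sub; apply: bip.
- by apply: lt; apply: mem_head.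
- by move=> q /r1; rewrite /reading => /orP[/ltW|/andP[/eqP->]].
- by move=> q /r1 + e; rewrite /reading e ltxx eqxx.
- by move=> q /sub h; rewrite !bip ?mem_head.
Qed.

Lemma ones_word ell E : asc ell -> tableau_rel ell E -> reading_word (ones E ell).
Proof.
move=> s t; split.
- by rewrite -(sorted_pairwise reading_trans); apply: sorted_ones.
- by move=> p; rewrite mem_ones => /and3P[_ _ /(rel_dom t)[]].
- move=> p q; rewrite !mem_ones => /and3P[_ _ h] /and3P[_ _ h'].
  by apply/eqP => e; apply: (rel_bip t h (k := q.2)); rewrite e.
Qed.

(** The 1s above row [x] do not involve [x], and all others lie in rows and
    columns with labels at least [x]. *)
Lemma run_ge P x : reading_word P -> {in P, forall p, p.2 != x} -> x <= run P x.
Proof.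
elim: P => [|p P IH] //= w h.
have [wP lt le _ _] := reading_word_cons w.
have [px|xp] := ltP p.1 x.
  rewrite (transpD (negbT (gt_eqF px))); last by rewrite eq_sym h ?mem_head.
  by apply: IH => // q qP; apply: h; rewrite inE qP orbT.
apply: (@run_closed _ (fun z => x <= z)); last first.
  by rewrite /transp; case: ifP => _; [exact: le_trans xp (ltW lt)|case: ifP].
move=> q qP; have /= xq := le_trans xp (le q qP); rewrite xq /=.
by case: wP => _ wP _; apply: le_trans xq (ltW (wP _ qP)).
Qed.

(** The path that runs along [y], having just turned in row [x], meets no other
    1 of this row, since these lie further east. *)
Lemma run_gt P x y : reading_word P -> {in P, forall p, x <= p.1} -> x < y ->
  {in P, forall p, p.1 = x -> p.2 < y} -> x < run P y.
Proof.
elim: P => [|p P IH] //= w ge xy h.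
have [wP lt le _ _] := reading_word_cons w.
have := ge p (mem_head _ _); rewrite le_eqVlt => /orP[/eqP e|xp].
  rewrite transpD -?e ?gt_eqF //; last by apply: h; rewrite ?mem_head.
  apply: IH => // q qP; first by apply: ge; rewrite inE qP orbT.
  by apply: h; rewrite inE qP orbT.
apply: (@run_closed _ (fun z => x < z)); last first.
  by rewrite /transp; case: ifP => _; [exact: lt_trans xp lt|case: ifP].
move=> q qP; have /= xq := lt_le_trans xp (le q qP); rewrite xq /=.
by case: wP => _ wP _; apply: lt_trans xq (wP _ qP).
Qed.

Lemma run_row_gt P x j : reading_word P -> {in P, forall p, p.2 != x} ->
  (x, j) \in P -> x < run P x.
Proof.
elim: P => [|p P IH] //= w h; rewrite inE => xj.
have [wP lt le rd bip] := reading_word_cons w.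
have [px|xp|xp] := ltgtP p.1 x.
- rewrite (transpD (negbT (gt_eqF px))); last by rewrite eq_sym h ?mem_head.
  apply: IH => //; first by move=> q qP; apply: h; rewrite inE qP orbT.
  by case/orP: xj => // /eqP e; move: px; rewrite -e ltxx.
- case/orP: xj => [/eqP e|/le /=]; first by move: xp; rewrite -e ltxx.
  by rewrite leNgt xp.
- rewrite -{2}xp transpL; apply: run_gt => //.
  + by move=> q /le; rewrite xp.
  + by rewrite -xp.
  + by move=> q qP; rewrite -xp; apply: rd.
Qed.

(** A path east of column [x] stays there: from row [y] it can only turn into
    the columns with a 1 in this row, and columns only lead further east. *)
Lemma run_lt P x y : reading_word P -> y < x ->
  {in P, forall p, p.1 = y -> p.2 < x} -> run P y < x.
Proof.
elim: P y => [|p P IH] y //= w yx h.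
have [wP lt le rd bip] := reading_word_cons w.
apply: IH => //; rewrite /transp.
  case: eqP => [e|_]; first by apply: h; rewrite ?mem_head.
  by case: eqP => // e; apply: lt_trans yx; rewrite e.
move=> q qP; case: eqP => [_ e|py].
  by have /andP[/eqP[]] := bip _ qP; rewrite e.
case: eqP => [yp e|_]; last by apply: h; rewrite inE qP orbT.
by apply: lt_trans yx; rewrite yp; apply: rd.
Qed.

Lemma run_col_lt P x k : reading_word P -> (k, x) \in P -> run P x < x.
Proof.
elim: P => [|p P IH] //= w; rewrite inE => kx.
have [wP lt le rd bip] := reading_word_cons w.
have [xp|xp] := eqVneq x p.2.
  rewrite xp transpR; apply: run_lt => //.
have kP : (k, x) \in P by case/orP: kx xp => // /eqP<-; rewrite eqxx.
by rewrite transpD //; [exact: IH|have /andP[] := bip _ kP].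
Qed.

(** A path never leaves the quarter plane south-east of its start, so that the
    path from a row ends on the border at or after the label of this row. *)
Lemma path_perm_row_ge ell E x : asc ell -> tableau_rel ell E ->
  (forall k, ~~ E k x) -> x <= path_perm E ell x.
Proof.
move=> s t h; apply: run_ge; first exact: ones_word.
move=> p; rewrite mem_ones => /and3P[_ _ e]; apply/eqP => px.
by move: (h p.1); rewrite -px e.
Qed.

Lemma path_perm_row_gt ell E x j : asc ell -> tableau_rel ell E ->
  E x j -> x < path_perm E ell x.
Proof.
move=> s t h; apply: (run_row_gt (j := j)); first exact: ones_word.
  move=> p; rewrite mem_ones => /and3P[_ _ e]; apply/eqP => px.
  by apply: (rel_bip t e (k := j)); rewrite px.
by rewrite mem_ones /= h andbT; have [-> ->] := rel_dom t h.
Qed.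

(** The path from a column turns east at its topmost 1, and then stays strictly
    to the right of this column. *)
Lemma path_perm_col_lt ell E k x : asc ell -> tableau_rel ell E ->
  E k x -> path_perm E ell x < x.
Proof.
move=> s t h; apply: (run_col_lt (k := k)); first exact: ones_word.
by rewrite mem_ones /= h andbT; have [-> ->] := rel_dom t h.
Qed.

Definition is_col (E : rel rat) (ell : seq rat) (j : rat) : bool :=
  has (E^~ j) ell.

Lemma is_colP ell E j : tableau_rel ell E -> reflect (exists i, E i j) (is_col E ell j).
Proof.
move=> t; apply: (iffP hasP) => [[i _ h]|[i h]]; first by exists i.
by exists i => //; have [] := rel_dom t h.
Qed.

Lemma is_colPn ell E j : tableau_rel ell E ->
  reflect (forall i, ~~ E i j) (~~ is_col E ell j).
Proof.
move=> t; apply: (iffP idP) => [h i|h]; last by apply/hasPn => i _.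
by apply: contra h => h; apply/(is_colP _ t); exists i.
Qed.

Lemma is_col_lt ell E x : asc ell -> tableau_rel ell E ->
  is_col E ell x = (path_perm E ell x < x).
Proof.
move=> s t; case: (is_colP x t) => [[k h]|h]; first by rewrite (path_perm_col_lt s t h).
rewrite ltNge path_perm_row_ge // => k; apply/negP => e; apply: h; by exists k.
Qed.

(** * Local changes *)

Definition add_one (E : rel rat) i j : rel rat :=
  fun x y => E x y || (x == i) && (y == j).
Definition del_one (E : rel rat) i j : rel rat :=
  fun x y => E x y && ~~ ((x == i) && (y == j)).
Definition relabel (f : rat -> rat) (E : rel rat) : rel rat :=
  fun x y => E (f x) (f y).

Lemma add_oneP E i j x y : reflect (E x y \/ x = i /\ y = j) (add_one E i j x y).
Proof.
apply: (iffP orP) => -[h|h]; try by left.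
  by right; case/andP: h => /eqP-> /eqP->.
by right; case: h => -> ->; rewrite !eqxx.
Qed.

Lemma del_oneP E i j x y :
  reflect (E x y /\ ~ (x = i /\ y = j)) (del_one E i j x y).
Proof.
apply: (iffP andP) => -[e n]; split=> //.
  by move=> [xi yj]; rewrite xi yj !eqxx in n.
by apply/negP => /andP[/eqP xi /eqP yj]; apply: n.
Qed.

Lemma add_oneK E i j : ~~ E i j -> del_one (add_one E i j) i j =2 E.
Proof.
rewrite /del_one /add_one => h x y.
have [/andP[/eqP-> /eqP->]|_] := boolP ((x == i) && (y == j)).
  by rewrite andbF (negbTE h).
by rewrite orbF andbT.
Qed.

Lemma del_oneK E i j : E i j -> add_one (del_one E i j) i j =2 E.
Proof.
rewrite /del_one /add_one => h x y.
have [/andP[/eqP-> /eqP->]|_] := boolP ((x == i) && (y == j)).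
  by rewrite orbT h.
by rewrite orbF andbT.
Qed.

(** The hypotheses say that no 1 that is read after the box [(i, j)] lies in
    row [i] or in column [j], so that its transposition commutes with all later
    ones and may come last. *)
Lemma path_perm_add ell E i j x : asc ell -> i \in ell -> j \in ell ->
  (forall l, E i l -> j < l) -> (forall k, E k j -> k < i) ->
  (forall l, ~~ E j l) -> (forall k, ~~ E k i) ->
  path_perm (add_one E i j) ell x = transp i j (path_perm E ell x).
Proof.
move=> s hi hj Ei Ej Nj Ni; rewrite /path_perm.
set P := ones (add_one E i j) ell.
have ijP : (i, j) \in P by rewrite mem_ones /= hi hj /add_one !eqxx orbT.
have PE : ones E ell = filter (predC1 (i, j)) P.
  have nE : ~~ E i j by apply/negP => /Ei; rewrite ltxx.
  rewrite /P /ones -filter_predI; apply: eq_filter => -[x' y'] /=.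
  by rewrite xpair_eqE -(add_oneK nE) /del_one andbC.
have := sorted_split reading_trans reading_irr (sorted_ones _ s) ijP.
rewrite -/P; set A := filter _ P; set B := filter _ P => defP.
have AE : filter (predC1 (i, j)) A = A.
  rewrite -[RHS]filter_predT; apply: eq_in_filter => p; rewrite mem_filter /=.
  by move=> /andP[r _]; apply: contraTneq r => ->; rewrite reading_irr.
have BE : filter (predC1 (i, j)) B = B.
  rewrite -[RHS]filter_predT; apply: eq_in_filter => p; rewrite mem_filter /=.
  by move=> /andP[r _]; apply: contraTneq r => ->; rewrite reading_irr.
rewrite PE defP filter_cat /= eqxx /= AE BE !run_cat /=.
have inB p : p \in B -> E p.1 p.2 /\ reading (i, j) p.
  rewrite -BE mem_filter /= => /andP[n]; rewrite mem_filter /= => /andP[r].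
  rewrite /P mem_ones => /and3P[_ _].
  rewrite /add_one => /orP[//|e]; case/negP: n.
  by case: p e {r} => p1 p2 /=; rewrite xpair_eqE.
rewrite run_transp // => p /inB[e r].
  apply/andP; split; apply/eqP => h.
    move: r; rewrite -h in e *; rewrite /reading /= -h ltxx eqxx /=.
    by move=> /lt_trans/(_ (Ei _ e)); rewrite ltxx.
  by case/negP: (Ni p.1); rewrite h.
apply/andP; split; apply/eqP => h.
  by case/negP: (Nj p.2); rewrite h.
move: r; rewrite /reading /= -h ltxx andbF orbF => /lt_trans H.
by rewrite -h in e; have := H _ (Ej _ e); rewrite ltxx.
Qed.

Lemma transp_mem ell i j x : i \in ell -> j \in ell -> x \in ell ->
  transp i j x \in ell.
Proof. by rewrite /transp; case: eqP => // _; case: eqP. Qed.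

(** Exchanging the labels of a column and of the row just after it leaves the
    order of the rows and that of the columns unchanged, hence also the reading
    order of the 1s. *)
Lemma path_perm_relabel ell E i j x : asc ell -> tableau_rel ell E ->
  consecutive ell i j -> (forall k, ~~ E i k) -> (forall k, ~~ E k j) ->
  path_perm (relabel (transp i j) E) ell x
    = transp i j (path_perm E ell (transp i j x)).
Proof.
move=> s t c Ni Nj; have [hi hj _ _] := c.
rewrite -[in LHS](transpK i j x) /path_perm -run_map; last exact: transp_inj.
have mono a b a' b' : E a b -> E a' b' -> a < a' -> transp i j a < transp i j a'.
  move=> e e' l; have [ha _ _] := rel_dom t e; have [ha' _ _] := rel_dom t e'.
  rewrite (transp_lt c) //; apply/negP => /andP[/eqP ai _].
  by case/negP: (Ni b); rewrite -ai.
congr run; apply: (irr_sorted_eq reading_trans reading_irr).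
- exact: sorted_ones.
- apply: homo_sorted_in (allss _) (sorted_ones E s).
  move=> [a b] [a' b']; rewrite !mem_ones /reading /=.
  move=> /and3P[_ _ e] /and3P[_ _ e'] /orP[l|/andP[/eqP aa' l]].
    by rewrite (mono _ _ _ _ e e').
  subst a'; rewrite eqxx (_ : transp i j b' < transp i j b) ?orbT //.
  apply: (transp_lt c) => //.
  + by have [] := rel_dom t e'.
  + by have [] := rel_dom t e.
  by apply/negP => /andP[_ /eqP bj]; case/negP: (Nj a); rewrite -bj.
- move=> [a b]; rewrite mem_ones; apply/and3P/mapP => /= [[ha hb e]|].
    exists (transp i j a, transp i j b); last by rewrite /= !transpK.
    by rewrite mem_ones /= !transp_mem.
  move=> [[a' b']]; rewrite mem_ones /= => /and3P[ha' hb' e] [-> ->].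
  by rewrite !transp_mem // /relabel !transpK.
Qed.

(** Filling the notch between the column [i] and the row [j] that follows it
    with a box containing a 1.  The two border steps change places, so the row
    gets the label [i] and the column the label [j]. *)
Definition add_box i j E : rel rat := add_one (relabel (transp i j) E) i j.

Lemma add_box_rel ell E i j : tableau_rel ell E -> consecutive ell i j ->
  (forall k, ~~ E i k) -> (forall k, ~~ E k j) -> tableau_rel ell (add_box i j E).
Proof.
move=> t c Ni Nj; have [hi hj ij _] := c.
have mem x : transp i j x \in ell -> x \in ell.
  by move=> h; rewrite -(transpK i j x); apply: transp_mem.
have dom x y : relabel (transp i j) E x y ->
    [/\ x \in ell, y \in ell, x < y, x != j & y != i].
  rewrite /relabel => e; have [hx hy l] := rel_dom t e; split; try exact: mem.
  - rewrite -(transpK i j x) -[ltRHS](transpK i j y) (transp_lt c) //.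
    by apply/negP => /andP[/eqP xi _]; case/negP: (Ni (transp i j y)); move: e; rewrite xi.
  - by apply/eqP => xj; case/negP: (Ni (transp i j y)); move: e; rewrite xj transpR.
  - by apply/eqP => yi; case/negP: (Nj (transp i j x)); move: e; rewrite yi transpL.
split.
- by move=> x y /add_oneP[/dom[]|[-> ->]].
- move=> x y z /add_oneP[e|[_ ->]] /add_oneP[e'|[yi _]].
  + exact: (rel_bip t e e').
  + by have [_ _ _ _] := dom _ _ e; rewrite yi eqxx.
  + by have [_ _ _] := dom _ _ e'; rewrite eqxx.
  + by move: ij; rewrite yi ltxx.
move=> k x y l ky xl kx xy yl.
have [hx [hy [yi xj]]] : x \in ell /\ (y \in ell) /\ (y != i) /\ (x != j).
  have [hy yi] : (y \in ell) /\ (y != i).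
    by case/add_oneP: ky => [/dom[]|[_ ->]] //; rewrite gt_eqF.
  have [hx xj] : (x \in ell) /\ (x != j).
    by case/add_oneP: xl => [/dom[]|[-> _]] //; rewrite lt_eqF.
  by split.
have {}ky : relabel (transp i j) E k y.
  case/add_oneP: ky => // -[ki yj]; subst k y.
  by have := consecutive_gt c hx xy; rewrite leNgt kx.
have {}xl : relabel (transp i j) E x l.
  case/add_oneP: xl => // -[xi lj]; subst x l.
  by have := consecutive_lt c hy xy; rewrite leNgt yl.
have [hk _ _ kj _] := dom _ _ ky; have [_ hl _ _ li] := dom _ _ xl.
apply/add_oneP; case: (boolP ((x == i) && (y == j))) => [/andP[/eqP-> /eqP->]|n].
  by right.
left.
apply: (rel_le t ky xl); rewrite (transp_lt c) //.
  by rewrite (negbTE xj) andbF.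
by rewrite (negbTE yi).
Qed.

(** The conjugation that comes from the relabelling and the transposition of the
    new box combine to a single transposition, applied first. *)
Lemma path_perm_add_box ell E i j x : asc ell -> tableau_rel ell E ->
  consecutive ell i j -> (forall k, ~~ E i k) -> (forall k, ~~ E k j) ->
  path_perm (add_box i j E) ell x = path_perm E ell (transp i j x).
Proof.
move=> s t c Ni Nj; have [hi hj ij _] := c.
have mem z : transp i j z \in ell -> z \in ell.
  by move=> h; rewrite -(transpK i j z); apply: transp_mem.
rewrite path_perm_add //; first by rewrite path_perm_relabel // transpK.
- rewrite /relabel transpL => l e; have [_ /mem hl jl] := rel_dom t e.
  have li : l != i by apply/eqP => li; move: jl e; rewrite li transpL ltxx.
  have lj : l != j.
    by apply/eqP => lj; move: jl; rewrite lj transpR ltNge (ltW ij).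
  by move: jl; rewrite transpD.
- rewrite /relabel transpR => k e; have [/mem hk _ ki] := rel_dom t e.
  have kj : k != j by apply/eqP => kj; move: ki; rewrite kj transpR ltxx.
  have nki : k != i.
    by apply/eqP => nki; move: ki; rewrite nki transpL ltNge (ltW ij).
  by move: ki; rewrite transpD.
- by move=> l; rewrite /relabel transpR.
- by move=> l; rewrite /relabel transpL.
Qed.

Definition remove_box i j E : rel rat := relabel (transp i j) (del_one E i j).

Lemma remove_box_rel ell E i j : tableau_rel ell E -> consecutive ell i j ->
  E i j -> tableau_rel ell (remove_box i j E).
Proof.
move=> t c ij; have [hi hj lij _] := c.
have mem x : transp i j x \in ell -> x \in ell.
  by move=> h; rewrite -(transpK i j x); apply: transp_mem.
have lt x y : transp i j x \in ell -> transp i j y \in ell ->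
    transp i j x < transp i j y ->
    ~ (transp i j x = i /\ transp i j y = j) -> x < y.
  move=> hx hy l n; rewrite -(transpK i j x) -[ltRHS](transpK i j y).
  by apply: (transp_lt c) => //; apply/negP => /andP[/eqP xi /eqP yj]; apply: n.
split.
- move=> x y /del_oneP[e n]; have [hx hy l] := rel_dom t e.
  by split; [exact: mem|exact: mem|exact: lt].
- by move=> x y z /del_oneP[e _] /del_oneP[e' _]; apply: (rel_bip t e e').
move=> k x y l /del_oneP[ky _] /del_oneP[xl _] kx xy yl.
have [hk hy _] := rel_dom t ky; have [hx hl _] := rel_dom t xl.
apply/del_oneP; split.
  apply: (rel_le t ky xl); rewrite (transp_lt c) //; try exact: mem.
  - apply/negP => /andP[/eqP ki _]; apply: (rel_bip t ij (k := transp i j y)).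
    by move: ky; rewrite ki transpL.
  - apply/negP => /andP[/eqP xi _]; apply: (rel_bip t ij (k := transp i j l)).
    by move: xl; rewrite xi transpL.
  - apply/negP => /andP[_ /eqP lj]; move: xl; rewrite lj transpR => /(rel_bip t).
    by move=> h; apply: h ij.
move=> [xi yj]; move: xy.
by rewrite -(transpK i j x) -[ltRHS](transpK i j y) xi yj transpL transpR ltNge ltW.
Qed.

Lemma remove_boxK E i j : E i j -> add_box i j (remove_box i j E) =2 E.
Proof.
by move=> e x y; rewrite -(del_oneK e) /add_box /remove_box /add_one /relabel !transpK.
Qed.

Lemma remove_box_row ell E i j k : tableau_rel ell E -> E i j ->
  ~~ remove_box i j E i k.
Proof.
move=> t ij; rewrite /remove_box /relabel transpL; apply/negP => /del_oneP[e _].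
exact: (rel_bip t ij e).
Qed.

Lemma remove_box_col ell E i j k : tableau_rel ell E -> E i j ->
  ~~ remove_box i j E k j.
Proof.
move=> t ij; rewrite /remove_box /relabel transpR; apply/negP => /del_oneP[e _].
exact: (rel_bip t e ij).
Qed.

Lemma remove_box_above ell E i j k : tableau_rel ell E -> E i j ->
  E k j -> k != i -> remove_box i j E k i.
Proof.
move=> t ij kj ki; rewrite /remove_box /relabel transpL transpD ?ki //.
  by rewrite /del_one kj (negbTE ki).
by apply/eqP => e; apply: (rel_bip t ij (k := j)); rewrite -[X in E X _]e.
Qed.

Lemma path_perm_remove_box ell E i j x : asc ell -> tableau_rel ell E ->
  consecutive ell i j -> E i j ->
  path_perm (remove_box i j E) ell x = path_perm E ell (transp i j x).
Proof.
move=> s t c ij; rewrite -(eq_path_perm _ _ (remove_boxK ij)) path_perm_add_box ?transpK //.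
- exact: remove_box_rel.
- by move=> k; exact: (remove_box_row k t ij).
- by move=> k; exact: (remove_box_col k t ij).
Qed.

(** The new column [j] has a single 1, in its bottom box: its 0s have no 1 above
    them, and no box lies to the right of this 1, as [i] and [j] are
    consecutive. *)
Lemma add_col_rel ell ell' E i j : tableau_rel ell E ->
  {subset ell <= ell'} -> j \notin ell -> consecutive ell' i j ->
  (forall k, ~~ E k i) -> tableau_rel ell' (add_one E i j).
Proof.
move=> t sub nj c Ni; have [hi hj ij _] := c.
have nEj k : ~~ E k j by apply: contra nj => /(rel_dom t)[].
have nEj' k : ~~ E j k by apply: contra nj => /(rel_dom t)[].
split.
- move=> x y /add_oneP[e|[-> ->]] //.
  by have [hx hy l] := rel_dom t e; split => //; apply: sub.
- move=> x y z /add_oneP[e|[_ ->]] /add_oneP[e'|[yi _]].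
  + exact: (rel_bip t e e').
  + by case/negP: (Ni x); rewrite -yi.
  + by case/negP: (nEj' z).
  + by move: ij; rewrite yi ltxx.
move=> k x y l /add_oneP[ky|[-> ->]].
  move=> /add_oneP[xl|[-> ->]] kx xy yl.
    by apply/add_oneP; left; apply: (rel_le t ky xl _ _ _).
  have [_ /sub hy _] := rel_dom t ky.
  by have := consecutive_lt c hy xy; rewrite leNgt yl.
move=> /add_oneP[xl|[-> _]]; last by rewrite ltxx.
move=> ix xj; have [/sub hx _ _] := rel_dom t xl.
by have := consecutive_gt c hx xj; rewrite leNgt ix.
Qed.

Lemma path_perm_add_col ell ell' E i j x : asc ell -> asc ell' ->
  tableau_rel ell E -> {subset ell <= ell'} -> j \notin ell ->
  consecutive ell' i j -> (forall k, ~~ E k i) ->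
  path_perm (add_one E i j) ell' x = transp i j (path_perm E ell x).
Proof.
move=> s s' t sub nj c Ni; have [hi hj ij _] := c.
have nEj k : ~~ E k j by apply: contra nj => /(rel_dom t)[].
have nEj' k : ~~ E j k by apply: contra nj => /(rel_dom t)[].
rewrite path_perm_add //.
- rewrite (path_perm_supp _ s' s) //; apply: (tableau_rel_sub t) => a b.
  by move=> /(rel_dom t)[/sub-> /sub->].
- move=> l e; have [_ hl il] := rel_dom t e.
  rewrite lt_neqAle (consecutive_lt c) ?sub // andbT.
  by apply: contra nj => /eqP->.
- by move=> k e; case/negP: (nEj k).
Qed.

Lemma del_col_rel ell E i j : tableau_rel ell E -> E i j ->
  (forall k, E k j -> k = i) ->
  tableau_rel (filter (predC1 j) ell) (del_one E i j).
Proof.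
move=> t ij Ej; split.
- move=> x y /del_oneP[e n]; have [hx hy l] := rel_dom t e.
  rewrite !mem_filter /= hx hy !andbT; split=> //; apply/eqP => e'; subst.
    exact: (rel_bip t ij e).
  by apply: n; rewrite (Ej _ e).
- by move=> x y z /del_oneP[e _] /del_oneP[e' _]; apply: (rel_bip t e e').
move=> k x y l /del_oneP[ky n] /del_oneP[xl _] kx xy yl.
apply/del_oneP; split; first exact: (rel_le t ky xl _ _ _).
by move=> [_ e]; subst y; apply: n; rewrite (Ej _ ky).
Qed.

Lemma path_perm_del_col ell E i j x : asc ell -> tableau_rel ell E ->
  consecutive ell i j -> E i j -> (forall k, E k j -> k = i) ->
  path_perm E ell x
    = transp i j (path_perm (del_one E i j) (filter (predC1 j) ell) x).
Proof.
move=> s t c ij Ej; rewrite -(eq_path_perm _ _ (del_oneK ij)).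
apply: path_perm_add_col => //.
- exact: asc_filter.
- exact: del_col_rel.
- by move=> y; rewrite mem_filter => /andP[].
- by rewrite mem_filter /= eqxx.
- by move=> k; apply/negP => /del_oneP[e _]; apply: (rel_bip t e ij).
Qed.

(** * The three kinds of corners *)

(** The column [j] has a 1, which lies above the 0 in its bottom box; so no 1
    is to the left of this 0, and there is no box to its right. *)
Lemma corner_zero ell E i j k : tableau_rel ell E -> consecutive ell i j ->
  (forall l, ~~ E l i) -> E k j -> ~~ E i j -> forall l, ~~ E i l.
Proof.
move=> t c Ni kj nij l; apply: contra nij => il.
have [hk _ lkj] := rel_dom t kj; have [_ hl lil] := rel_dom t il.
have := consecutive_lt c hl lil; rewrite le_eqVlt => /orP[/eqP-> //|jl].
have := consecutive_gt c hk lkj; rewrite le_eqVlt => /orP[/eqP<- //|ki].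
have [_ _ ij _] := c; exact: (rel_le t kj il ki ij jl).
Qed.

(** The path from the top of column [j] goes straight down to the corner and then
    leaves row [i] at once. *)
Lemma corner_necessary ell E i j : asc ell -> tableau_rel ell E ->
  consecutive ell i j -> E i j -> (forall k, E k j -> k = i) ->
  path_perm E ell j = i.
Proof.
move=> s t c ij Ej; rewrite (path_perm_del_col _ s t c ij Ej) path_perm_id ?transpR //.
  by move=> k; apply/negP => /del_oneP[e]; rewrite (Ej _ e); apply.
by move=> k; apply/negP => /del_oneP[e _]; apply: (rel_bip t ij e).
Qed.

(** After the removal of the corner box, [i] is the label of the column, which
    still contains a 1; hence [i] is a non-excedance, and its image is the
    former image of [j]. *)
Lemma corner_superfluous ell E i j k : asc ell -> tableau_rel ell E ->
  consecutive ell i j -> E i j -> E k j -> k != i -> path_perm E ell j < i.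
Proof.
move=> s t c ij kj ki.
rewrite -[X in path_perm E ell X](transpL i j) -path_perm_remove_box //.
apply: (path_perm_col_lt (k := k)) => //; first exact: remove_box_rel.
exact: (remove_box_above t ij).
Qed.

Lemma corner_eq_row ell E i j : asc ell -> tableau_rel ell E ->
  consecutive ell i j -> (forall l, ~~ E l i) -> is_col E ell j ->
  (path_perm E ell i == i) = ~~ E i j.
Proof.
move=> s t c Ni /(is_colP _ t)[k kj].
case: (boolP (E i j)) => [ij|nij].
  by rewrite gt_eqF // (path_perm_row_gt s t ij).
by rewrite path_perm_id ?eqxx //; apply: (corner_zero t c Ni kj).
Qed.

Lemma corner_lt_row ell E i j : asc ell -> tableau_rel ell E ->
  consecutive ell i j -> E i j ->
  (path_perm E ell j < i) = has (fun k => E k j && (k != i)) ell.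
Proof.
move=> s t c ij; case: hasP => [[k _ /andP[kj ki]]|h].
  by rewrite (corner_superfluous s t c ij kj ki).
rewrite (corner_necessary s t c ij) ?ltxx // => k kj; apply/eqP/negPn/negP => ki.
by apply: h; exists k; [have [] := rel_dom t kj|rewrite kj].
Qed.

(** * Bijectivity *)

(** Finds the first corner: [a] tells the columns from the rows. *)
Lemma first_switch (T : Type) (a : pred T) (x0 : T) s : has a s -> ~~ a (head x0 s) ->
  exists A i j B, [/\ s = A ++ i :: j :: B, ~~ has a (rcons A i), a j &
                      find a s = (size A).+1].
Proof.
elim: s => [|i [|j s] IH] //=; first by rewrite orbF => ->.
move=> + nai; rewrite (negbTE nai) /= => h.
case: (boolP (a j)) => aj; first by exists [::], i, j, s; rewrite /= orbF aj.
have [|//|A [i' [j' [B [e hA aj' eA]]]]] := IH; first by [].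
exists (i :: A), i', j', B; split=> //=; first by rewrite e.
  by rewrite negb_or nai.
by move: eA; rewrite /= (negbTE aj) => ->.
Qed.

(** The differences [f y - y] are nonnegative and sum up to 0. *)
Lemma no_descent_id ell (f : rat -> rat) : uniq ell ->
  {in ell, forall x, f x \in ell} -> {in ell &, injective f} ->
  {in ell, forall x, x <= f x} -> {in ell, forall x, f x = x}.
Proof.
move=> u fm fi le x hx.
have pe : perm_eq (map f ell) ell.
  apply: uniq_perm => //; first by rewrite map_inj_in_uniq.
  apply: (uniq_min_size _ _ _).2 => //; first by rewrite map_inj_in_uniq.
    by move=> _ /mapP[y hy ->]; apply: fm.
  by rewrite size_map.
have : \sum_(y <- ell) (f y - y) == 0.
  by rewrite sumrB subr_eq0 -(big_map f xpredT id) /= (perm_big _ pe).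
rewrite big_seq psumr_eq0 => [/allP/(_ _ hx)|y hy]; last by rewrite subr_ge0 le.
by rewrite hx subr_eq0 => /eqP.
Qed.

Lemma head_le ell x : asc ell -> x \in ell -> head 0 ell <= x.
Proof.
case: ell => [|h ell] //= s; rewrite inE => /predU1P[-> //|hx].
by move: s; rewrite /asc /= (path_sortedE lt_trans) => /andP[/allP/(_ _ hx)/ltW].
Qed.

(** At the first non-excedance [j], just after the weak excedance [i], the three
    kinds of corners are told apart as in [corner_eq_row] and [corner_lt_row];
    undoing the corner deletes a label or moves the first non-excedance to the
    left. *)
Lemma path_perm_surj ell f : asc ell -> {in ell, forall x, f x \in ell} ->
  {in ell &, injective f} ->
  exists2 E, tableau_rel ell E & {in ell, path_perm E ell =1 f}.
Proof.
have [n] := ubnP (size ell); elim: n => // n IHn in ell f *; rewrite ltnS => sz.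
have [m] := ubnP (find (fun y => f y < y) ell).
elim: m => // m IHm in f *; rewrite ltnS => fm s fin finj.
have u := asc_uniq s.
case: (boolP (has (fun y => f y < y) ell)) => [h|/hasPn h]; last first.
  exists (fun _ _ => false); first by split.
  move=> x hx; rewrite path_perm_id // (no_descent_id u fin finj _ hx) // => y hy.
  by rewrite leNgt; apply: h.
have hd : ~~ (f (head 0 ell) < head 0 ell).
  rewrite -leNgt; apply: head_le => //; apply: fin; case: (ell) h => //= *.
  by rewrite mem_head.
have [A [i [j [B [defell nA fj eA]]]]] := first_switch h hd.
have c : consecutive ell i j by rewrite defell; apply: asc_consecutive; rewrite -defell.
have [hi hj ij _] := c.
have fi : i <= f i by move: nA; rewrite has_rcons negb_or leNgt => /andP[].
have del_size x : x \in ell -> (size (filter (predC1 x) ell) < n)%N.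
  move=> hx; apply: leq_trans sz; rewrite -(count_predC (pred1 x) ell) size_filter.
  by rewrite -[X in (X < _)%N]add0n ltn_add2r -has_count has_pred1.
have [fii|fii] := eqVneq (f i) i.
  have [x hx|x y hx hy|E t e] := IHn (filter (predC1 i) ell) f (del_size _ hi) (asc_filter _ s).
  - move: hx; rewrite !mem_filter /= => /andP[xi hx]; rewrite fin // andbT.
    by apply: contra xi => /eqP e; apply/eqP/finj; rewrite ?fii.
  - by move: hx hy; rewrite !mem_filter => /andP[_ hx] /andP[_ hy]; apply: finj.
  have t' : tableau_rel ell E.
    apply: (tableau_rel_sub t) => x y /(rel_dom t).
    by rewrite !mem_filter => -[/andP[_ ->] /andP[_ ->]].
  exists E => // x hx; rewrite (path_perm_supp _ s (asc_filter (predC1 i) s)) //.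
  have [->|xi] := eqVneq x i; last by apply: e; rewrite mem_filter /= xi.
  by rewrite path_perm_id ?fii // => k; apply/negP => /(rel_dom t)[];
    rewrite !mem_filter /= eqxx.
have fji : f j <= i by apply: consecutive_gt c _ fj; apply: fin.
move: fji; rewrite le_eqVlt => /predU1P[fji|fji].
  (* the collapse of [f] at [j] *)
  pose g x := if f x == j then i else f x.
  have E0 := IHn (filter (predC1 j) ell) g (del_size _ hj) (asc_filter _ s).
  have [x hx|x y hx hy|{E0}E t e] := E0.
  - move: hx; rewrite !mem_filter /= /g => /andP[xj hx].
    by case: (f x =P j) => [_|/eqP->]; [rewrite lt_eqF|exact: fin].
  - move: hx hy; rewrite !mem_filter /= /g => /andP[xj hx] /andP[yj hy].
    case: (f x =P j) => [e1|_]; case: (f y =P j) => [e2|_].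
    + by move=> _; apply: finj => //; rewrite e1.
    + by rewrite -fji => /(finj _ _ hj hy) e; rewrite e eqxx in yj.
    + by rewrite -fji => /(finj _ _ hx hj) e; rewrite e eqxx in xj.
    + exact: finj.
  have sub : {subset filter (predC1 j) ell <= ell} by move=> x; rewrite mem_filter => /andP[].
  have nj : j \notin filter (predC1 j) ell by rewrite mem_filter /= eqxx.
  have hi' : i \in filter (predC1 j) ell by rewrite mem_filter /= lt_eqF.
  have Ni : forall k, ~~ E k i.
    apply/(is_colPn _ t); rewrite (is_col_lt _ (asc_filter _ s) t) e // /g -leNgt.
    by case: ifP.
  exists (add_one E i j) => [|x hx]; first exact: add_col_rel t sub nj c Ni.
  rewrite (path_perm_add_col _ (asc_filter _ s) s t sub nj c Ni).
  have [->|xj] := eqVneq x j.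
    by rewrite path_perm_id ?transpR // => k; apply: contra nj => /(rel_dom t)[].
  rewrite e ?mem_filter /= ?xj // /g; case: (f x =P j) => [->|/eqP fxj]; first exact: transpL.
  rewrite transpD // -fji; apply: contra xj => /eqP/(finj _ _ hx hj)->.
  exact: eqxx.
(* with values exchanged, [i] is a non-excedance: the first one moved left *)
pose g x := f (transp i j x).
have [||x y hx hy|E t e] := IHm g _ s.
- apply: leq_trans fm; rewrite eA defell find_cat ltnS; case: ifP => _.
    exact: find_size.
  by rewrite /= /g transpL fji addn0.
- by move=> x hx; apply: fin; apply: transp_mem.
- by move=> /finj e; apply: (@transp_inj _ i j); apply: e; apply: transp_mem.
have Ni : forall k, ~~ E i k.
  have/(is_colP _ t)[k ki] : is_col E ell i by rewrite (is_col_lt _ s t) e // /g transpL.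
  by move=> l; apply/negP => il; apply: (rel_bip t ki il).
have Nj : forall k, ~~ E k j.
  apply/(is_colPn _ t); rewrite (is_col_lt _ s t) e // /g transpR -leNgt.
  by apply: consecutive_lt c (fin _ hi) _; rewrite lt_neqAle eq_sym fii.
exists (add_box i j E) => [|x hx]; first exact: add_box_rel.
by rewrite path_perm_add_box // e ?transp_mem // /g transpK.
Qed.

(** The same reduction shows that the tableau is determined: the permutation
    tells which corner there is at the first non-excedance. *)
Lemma path_perm_rel_inj ell E E' : asc ell -> tableau_rel ell E -> tableau_rel ell E' ->
  {in ell, path_perm E ell =1 path_perm E' ell} -> E =2 E'.
Proof.
have [n] := ubnP (size ell); elim: n => // n IHn in ell E E' *; rewrite ltnS => sz.
have [m] := ubnP (find (is_col E ell) ell).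
elim: m => // m IHm in E E' *; rewrite ltnS => fm s t t' e.
have e_col x : x \in ell -> is_col E ell x = is_col E' ell x.
  by move=> hx; rewrite !(is_col_lt _ s) // e.
case: (boolP (has (is_col E ell) ell)) => [h|/hasPn h]; last first.
  move=> i j; apply/idP/idP => ij.
    have [_ hj _] := rel_dom t ij; case/negP: (h _ hj).
    by apply/(is_colP _ t); exists i.
  have [_ hj _] := rel_dom t' ij; case/negP: (h _ hj).
  by rewrite e_col //; apply/(is_colP _ t'); exists i.
have hd : ~~ is_col E ell (head 0 ell).
  rewrite (is_col_lt _ s t) -leNgt; apply: head_le => //; apply: path_perm_mem.
  by case: (ell) h => //= *; rewrite mem_head.
have [A [i [j [B [defell nA cj eA]]]]] := first_switch h hd.
have c : consecutive ell i j by rewrite defell; apply: asc_consecutive; rewrite -defell.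
have [hi hj ij _] := c.
have ci : ~~ is_col E ell i by move: nA; rewrite has_rcons negb_or => /andP[].
have ci' : ~~ is_col E' ell i by rewrite -e_col.
have cj' : is_col E' ell j by rewrite -e_col.
have Ni := elimT (is_colPn _ t) ci; have Ni' := elimT (is_colPn _ t') ci'.
have del_size x : x \in ell -> (size (filter (predC1 x) ell) < n)%N.
  move=> hx; apply: leq_trans sz; rewrite -(count_predC (pred1 x) ell) size_filter.
  by rewrite -[X in (X < _)%N]add0n ltn_add2r -has_count has_pred1.
have eij : E i j = E' i j.
  by apply: negb_inj; rewrite -(corner_eq_row s t c) // -(corner_eq_row s t' c) // e.
case: (boolP (E i j)) => [Eij|nij]; last first.
  have zero F : tableau_rel ell F -> (forall k, ~~ F k i) -> is_col F ell j ->
      ~~ F i j -> tableau_rel (filter (predC1 i) ell) F.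
    move=> tF NF /(is_colP _ tF)[k kj] nF; apply: (tableau_rel_sub tF) => x y xy.
    have [hx hy _] := rel_dom tF xy; rewrite !mem_filter hx hy /= !andbT.
    split; apply/eqP => xi; subst.
      by case/negP: (corner_zero tF c NF kj nF y).
    by case/negP: (NF x).
  have z := zero _ t Ni cj nij; have z' := zero _ t' Ni' cj' _.
  apply: (IHn _ _ _ (del_size _ hi) (asc_filter _ s)) => //.
    by apply: z'; rewrite -eij.
  move=> x; rewrite mem_filter => /andP[_ hx].
  rewrite !(path_perm_supp x (asc_filter (predC1 i) s) s) ?e //.
  by apply: z'; rewrite -eij.
have Eij' : E' i j by rewrite -eij.
have lij := corner_lt_row s t c Eij; have lij' := corner_lt_row s t' c Eij'.
move: lij lij'; rewrite -e //; case: (boolP (path_perm E ell j < i)) => _.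
  move=> /esym/hasP[k _ /andP[kj ki]] _.
  have D := remove_box_rel t c Eij; have D' := remove_box_rel t' c Eij'.
  have eD : remove_box i j E =2 remove_box i j E'.
    apply: (IHm _ _ _ s D D'); last first.
      by move=> x hx; rewrite !path_perm_remove_box // e // transp_mem.
    apply: leq_trans fm; rewrite eA defell find_cat ltnS -defell; case: ifP => _.
      exact: find_size.
    rewrite /= (_ : is_col _ _ i = true) ?addn0 //; apply/(is_colP _ D).
    by exists k; apply: (remove_box_above t).
  move=> x y; rewrite -(remove_boxK Eij) -(remove_boxK Eij').
  by rewrite /add_box /add_one /relabel eD.
have single F : tableau_rel ell F -> false = has (fun k => F k j && (k != i)) ell ->
    forall k, F k j -> k = i.
  move=> tF /esym/hasPn nF k kj; have [hk _ _] := rel_dom tF kj.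
  by apply/eqP; move: (nF k hk); rewrite kj negbK.
move=> /(single _ t) u /(single _ t') u'.
have eD : del_one E i j =2 del_one E' i j.
  apply: (IHn _ _ _ (del_size _ hj) (asc_filter _ s)).
  - exact: del_col_rel.
  - exact: del_col_rel.
  move=> x; rewrite mem_filter => /andP[_ hx]; apply: (@transp_inj _ i j).
  by rewrite -!path_perm_del_col ?e.
by move=> x y; rewrite -(del_oneK Eij) -(del_oneK Eij') /add_one eD.
Qed.

(** * From relations to fillings *)

Definition rows E ell : seq rat := [seq i <- ell | ~~ is_col E ell i].
(** Columns are listed from left to right, hence by decreasing labels. *)
Definition cols E ell : seq rat := rev [seq j <- ell | is_col E ell j].
Definition raw E ell : raw_tableau :=
  [seq [seq E i j | j <- cols E ell & i < j] | i <- rows E ell].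

Lemma sorted_filter_take (T : Type) (r : rel T) (a : pred T) s :
  transitive r -> sorted r s -> (forall x y, r x y -> a y -> a x) ->
  filter a s = take (count a s) s /\ filter (predC a) s = drop (count a s) s.
Proof.
move=> tr + ar; elim: s => [|x s IH] //= xs.
have [e1 e2] := IH (path_sorted xs).
case: (boolP (a x)) => ax /=; first by rewrite e1 e2.
have /negbTE nas : ~~ has a s.
  rewrite -all_predC; move: xs; rewrite (path_sortedE tr) => /andP[xs _].
  by apply: sub_all xs => y xy; apply: contra ax; apply: ar.
rewrite add0n in e1 e2 *; move: e1 e2; rewrite (_ : count a s = 0)%N; last first.
  by apply/eqP; rewrite -leqn0 leqNgt -has_count nas.
by rewrite take0 !drop0 => -> ->; rewrite take0.
Qed.

Lemma mem_rows E ell i : (i \in rows E ell) = (~~ is_col E ell i) && (i \in ell).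
Proof. by rewrite mem_filter. Qed.

Lemma mem_cols E ell j : (j \in cols E ell) = is_col E ell j && (j \in ell).
Proof. by rewrite mem_rev mem_filter. Qed.

Lemma rows_asc E ell : asc ell -> asc (rows E ell).
Proof. exact: asc_filter. Qed.

Lemma cols_desc E ell : asc ell -> sorted >%R (cols E ell).
Proof. by move=> s; rewrite rev_sorted; apply: asc_filter. Qed.

Lemma size_rows_cols E ell : (size (rows E ell) + size (cols E ell))%N = size ell.
Proof. by rewrite size_rev !size_filter addnC count_predC. Qed.

Lemma nth_rows_mem E ell r : (r < size (rows E ell))%N ->
  [/\ nth 0 (rows E ell) r \in rows E ell, nth 0 (rows E ell) r \in ell &
      ~~ is_col E ell (nth 0 (rows E ell) r)].
Proof. by move=> h; have := mem_nth 0 h; rewrite mem_rows => h'; case/andP: (h') => -> ->. Qed.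

Lemma nth_cols_mem E ell c : (c < size (cols E ell))%N ->
  [/\ nth 0 (cols E ell) c \in cols E ell, nth 0 (cols E ell) c \in ell &
      is_col E ell (nth 0 (cols E ell) c)].
Proof. by move=> h; have := mem_nth 0 h; rewrite mem_cols => h'; case/andP: (h') => -> ->. Qed.

Lemma nth_rows_lt E ell r r' : asc ell -> (r < size (rows E ell))%N ->
  (r' < size (rows E ell))%N ->
  (nth 0 (rows E ell) r < nth 0 (rows E ell) r') = (r < r')%N.
Proof.
move=> s hr hr'; have s' := rows_asc E s.
by rewrite -(asc_index s') ?mem_nth // !index_uniq ?asc_uniq.
Qed.

Lemma nth_cols_lt E ell c c' : asc ell -> (c < size (cols E ell))%N ->
  (c' < size (cols E ell))%N ->
  (nth 0 (cols E ell) c < nth 0 (cols E ell) c') = (c' < c)%N.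
Proof.
move=> s hc hc'; apply/idP/idP; last first.
  by move=> h; apply: (sorted_ltn_nth _ _ (cols_desc E s)) => //; apply: gt_trans_rat.
apply: contraTT; rewrite -leqNgt -leNgt leq_eqVlt => /predU1P[->//|h].
by apply/ltW/(sorted_ltn_nth _ _ (cols_desc E s)) => //; apply: gt_trans_rat.
Qed.

Lemma cols_filter_gt E ell i : asc ell ->
  let m := count (fun j => i < j) (cols E ell) in
  [seq j <- cols E ell | i < j] = take m (cols E ell) /\
  [seq j <- cols E ell | ~~ (i < j)] = drop m (cols E ell).
Proof.
move=> s; apply: (sorted_filter_take _ (cols_desc E s)) => [x y z /= h1 h2|x y /= h1 h2].
  exact: lt_trans h2 h1.
exact: lt_trans h2 h1.
Qed.

Lemma count_cols_gt E ell (i : rat) c : asc ell -> (c < size (cols E ell))%N ->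
  (c < count (fun j => (i < j)%R) (cols E ell))%N = (i < nth 0 (cols E ell) c).
Proof.
move=> s hc; have /= := cols_filter_gt E i s.
set m := count _ _ => -[e1 e2].
have sm : (m <= size (cols E ell))%N by apply: count_size.
case: ltnP => h; apply/esym.
  have : nth 0 (cols E ell) c \in take m (cols E ell).
    by rewrite -(nth_take _ h) mem_nth // size_takel.
  by rewrite -e1 mem_filter => /andP[].
have : nth 0 (cols E ell) c \in drop m (cols E ell).
  by rewrite -(subnKC h) -nth_drop mem_nth // size_drop ltn_sub2r // (leq_ltn_trans h).
by rewrite -e2 mem_filter => /andP[/negbTE].
Qed.

Lemma nrows_raw E ell : nrows (raw E ell) = size (rows E ell).
Proof. exact: size_map. Qed.

Lemma row_at_raw E ell r : (r < size (rows E ell))%N ->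
  row_at (raw E ell) r =
    [seq E (nth 0 (rows E ell) r) j | j <- cols E ell & nth 0 (rows E ell) r < j].
Proof. by move=> h; rewrite /row_at (nth_map 0). Qed.

Lemma row_len_raw E ell r : (r < size (rows E ell))%N ->
  row_len (raw E ell) r = count (fun j => nth 0 (rows E ell) r < j) (cols E ell).
Proof. by move=> h; rewrite /row_len row_at_raw // size_map size_filter. Qed.

Lemma lt_row_len_raw E ell r c : asc ell ->
  (c < row_len (raw E ell) r)%N =
    [&& (r < size (rows E ell))%N, (c < size (cols E ell))%N
      & nth 0 (rows E ell) r < nth 0 (cols E ell) c].
Proof.
move=> s; case: (ltnP r _) => hr /=; last first.
  by rewrite /row_len /row_at nth_default // size_map.
rewrite row_len_raw //; have [hc|hc] := ltnP c (size (cols E ell)); first exact: count_cols_gt.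
by apply/negbTE; rewrite -leqNgt (leq_trans (count_size _ _)).
Qed.

(** Outside of the diagram both sides are [false]: there, the label of the row is
    at least that of the column, and [E] implies [<]. *)
Lemma entry_raw E ell r c : asc ell -> tableau_rel ell E ->
  entry (raw E ell) r c =
    [&& (r < size (rows E ell))%N, (c < size (cols E ell))%N
      & E (nth 0 (rows E ell) r) (nth 0 (cols E ell) c)].
Proof.
move=> s t; have := lt_row_len_raw E r c s; rewrite /entry /row_len.
case: (ltnP r _) => hr /=; last first.
  by move=> _; rewrite /row_at [nth _ _ r]nth_default ?nth_nil // size_map.
case: ltnP => h1 h2; last first.
  rewrite nth_default //; case: ltnP h2 => //= _ /esym/negbT h.
  by apply/esym/negbTE; apply: contra h => /(rel_dom t)[].
move: (h1); rewrite row_at_raw // size_map size_filter => h.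
have [e _] := cols_filter_gt E (nth 0 (rows E ell) r) s.
rewrite (nth_map 0) ?size_filter //.
by rewrite e nth_take //; move/esym: h2 => /andP[->].
Qed.

Lemma entry_raw_index E ell i j : asc ell -> tableau_rel ell E -> E i j ->
  [/\ i \in rows E ell, j \in cols E ell &
      entry (raw E ell) (index i (rows E ell)) (index j (cols E ell))].
Proof.
move=> s t e; have [hi hj _] := rel_dom t e.
have ir : i \in rows E ell.
  by rewrite mem_rows hi andbT; apply/(is_colPn _ t) => k; apply/negP => /(rel_bip t)/(_ e).
have jc : j \in cols E ell by rewrite mem_cols hj andbT; apply/(is_colP _ t); exists i.
by rewrite entry_raw // !index_mem ir jc !nth_index.
Qed.

Lemma head_row E ell x : asc ell -> tableau_rel ell E -> x \in ell ->
  ~~ is_col E ell (head 0 ell).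
Proof.
move=> s t hx; apply/(is_colPn _ t) => k; apply/negP => /(rel_dom t)[hk _].
by rewrite ltNge head_le.
Qed.

Lemma rows_cons E ell : asc ell -> tableau_rel ell E -> (0 < size ell)%N ->
  rows E ell = head 0 ell :: behead (rows E ell).
Proof.
move=> s t; case: ell s t => // h ell s t _.
by have := head_row s t (mem_head _ _); rewrite /rows /= => ->.
Qed.

Lemma ncols_raw E ell : asc ell -> tableau_rel ell E -> (0 < size ell)%N ->
  ncols (raw E ell) = size (cols E ell).
Proof.
move=> s t n0; rewrite /ncols /raw rows_cons //= size_map size_filter.
apply/eqP; rewrite -all_count; apply/allP => j; rewrite mem_cols => /andP[cj hj].
rewrite lt_neqAle head_le // andbT; apply: contraTneq cj => <-.
exact: head_row hj.
Qed.

Lemma half_perimeter_raw E ell : asc ell -> tableau_rel ell E -> (0 < size ell)%N ->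
  half_perimeter (raw E ell) = size ell.
Proof. by move=> s t n0; rewrite /half_perimeter nrows_raw ncols_raw // size_rows_cols. Qed.

Lemma raw_is_tableau E ell : asc ell -> tableau_rel ell E -> (0 < size ell)%N ->
  is_tableau (size ell) (raw E ell).
Proof.
move=> s t n0; apply/and5P; split.
- by rewrite /raw rows_cons.
- rewrite /raw -map_comp sorted_map; apply: sub_sorted (rows_asc E s) => i i' ii' /=.
  by rewrite !size_map !size_filter; apply: sub_count => j; apply: lt_trans.
- by rewrite half_perimeter_raw.
- apply/allP => c; rewrite mem_iota ncols_raw // add0n => /= hc; apply/hasP.
  have [_ _ /(is_colP _ t)[i ij]] := nth_cols_mem hc.
  have [ir _ _] := entry_raw_index s t ij.
  exists (index i (rows E ell)); first by rewrite mem_iota nrows_raw index_mem.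
  by rewrite entry_raw // index_mem ir nth_index //= ij hc.
apply/allP => r _; apply/allP => c; rewrite mem_iota add0n => /= h.
apply/and3P => -[ne /hasP[r' hr' e'] /hasP[c' hc' e'']].
case/negP: ne; move: h e' e''; rewrite lt_row_len_raw // !entry_raw //.
move=> /and3P[hr hc ij] /and3P[hr1 _ kj] /and3P[_ hc1 il] /=; rewrite hr hc /=.
move: hr' hc'; rewrite !mem_iota !add0n /= => hr' hc'.
by apply: (rel_le t kj il) => //; rewrite ?nth_rows_lt ?nth_cols_lt.
Qed.

(** * Zig-zag paths *)

Lemma ohead_iotaP (a : pred nat) m k :
  if ohead [seq i <- iota m k | a i] is Some i
  then [/\ a i, (m <= i < m + k)%N & forall j, (m <= j < i)%N -> ~~ a j]
  else forall j, (m <= j < m + k)%N -> ~~ a j.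
Proof.
case e: ohead => [i|] /=; last first.
  move=> j jm; apply/negP => aj.
  have : j \in [seq i <- iota m k | a i] by rewrite mem_filter aj mem_iota.
  by case: (filter _ _) e.
case ef: [seq i <- iota m k | a i] e => [|i' l] //= -[ii']; subst i'.
have : i \in [seq i <- iota m k | a i] by rewrite ef mem_head.
rewrite mem_filter mem_iota => /andP[ai im]; split=> // j /andP[mj ji].
apply/negP => aj; have : j \in [seq i <- iota m k | a i].
  by rewrite mem_filter aj mem_iota mj (ltn_trans ji) //; case/andP: im.
rewrite ef inE => /predU1P[ij|jl]; first by rewrite ij ltnn in ji.
have : sorted ltn (i :: l) by rewrite -ef; apply: (sorted_filter ltn_trans); apply: iota_ltn_sorted.
rewrite /= (path_sortedE ltn_trans) => /andP[/allP/(_ _ jl) /= ij _].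
by have := ltn_trans ij ji; rewrite ltnn.
Qed.

(** The transpositions before [p] do not move [x]: on its way along its row or
    column, the path goes straight on until the box [p]. *)
Lemma run_first (Q : seq (rat * rat)) p x : sorted reading Q -> p \in Q ->
  avoids [seq q <- Q | reading q p] x ->
  run Q x = run [seq q <- Q | reading p q] (transp p.1 p.2 x).
Proof.
move=> s pQ a; rewrite {1}(sorted_split reading_trans reading_irr s pQ).
by rewrite run_cat (run_avoids (P := [seq q <- Q | reading q p]) a).
Qed.

Definition label E ell (b : step) : rat :=
  match b with inl r => nth 0 (rows E ell) r | inr c => nth 0 (cols E ell) c end.

Lemma filter_reading E ell p q : reading p q ->
  [seq x <- [seq x <- ones E ell | reading p x] | reading q x]
    = [seq x <- ones E ell | reading q x].
Proof.
move=> pq; rewrite -filter_predI; apply: eq_filter => x /=.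
by case: (boolP (reading q x)) => //= qx; rewrite (reading_trans pq qx).
Qed.

(** A path that has just turned at the 1 in box [(r, c)], to the south if [d] and
    to the east otherwise, is subject to the transpositions of the 1s that are
    read after this box.  The first of them that matters belongs to the next 1
    below, or to the right, which is where the path turns again. *)
Lemma label_zigzag E ell k (d : bool) r c : asc ell -> tableau_rel ell E ->
  entry (raw E ell) r c -> (size ell <= k + (r + c))%N ->
  let i := nth 0 (rows E ell) r in let j := nth 0 (cols E ell) c in
  label E ell (zigzag k (raw E ell) d r c)
    = run [seq p <- ones E ell | reading (i, j) p] (if d then j else i).
Proof.
move=> s t; elim: k d r c => [|k IH] d r c e hk i j.
  have: (0 < size ell)%N.
    move: e; rewrite entry_raw // => /and3P[_ _ /(rel_dom t)[h _ _]].
    by case: (ell) h.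
  move: e hk; rewrite add0n entry_raw // -(size_rows_cols E ell) => /and3P[hr hc _] h n0.
  by have := leq_add hr (ltnW hc); rewrite addSn => /leq_trans/(_ h); rewrite ltnn.
have := e; rewrite entry_raw // => /and3P[hr hc]; rewrite -/i -/j => ij.
set Q := filter _ _.
have sQ : sorted reading Q by apply: (sorted_filter reading_trans); apply: sorted_ones.
have inQ p : p \in Q -> [/\ E p.1 p.2, reading (i, j) p, p.1 != j & p.2 != i].
  rewrite mem_filter mem_ones => /and4P[rd _ _ ep]; split=> //.
    by apply/eqP => pj; rewrite pj in ep; apply: (rel_bip t ij ep).
  by apply/eqP => pi; rewrite pi in ep; apply: (rel_bip t ep ij).
have memQ i' j' : E i' j' -> reading (i, j) (i', j') -> (i', j') \in Q.
  move=> e' rd; rewrite mem_filter rd mem_ones /= e'.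
  by have [-> ->] := rel_dom t e'.
case: d => /=.
  have := ohead_iotaP (fun r' => entry (raw E ell) r' c) r.+1 (nrows (raw E ell) - r.+1).
  rewrite -/(next_one_below (raw E ell) r c).
  have skip i' : E i' j -> i < i' ->
      (r < index i' (rows E ell) < nrows (raw E ell))%N /\
      entry (raw E ell) (index i' (rows E ell)) c.
    move=> e' ii'; have [ir _] := entry_raw_index s t e'; rewrite index_uniq //; last first.
      by rewrite rev_uniq; apply/asc_uniq/asc_filter.
    split=> //; rewrite nrows_raw index_mem ir andbT.
    by rewrite -(nth_rows_lt s hr) ?index_mem // nth_index.
  case: next_one_below => [r' [e' /andP[rr' _] nr']|nr'].
    have := e'; rewrite entry_raw // => /and3P[hr' _]; rewrite -/j; set i' := nth _ _ _ => i'j.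
    have rd : reading (i, j) (i', j) by rewrite /reading /= nth_rows_lt ?rr'.
    have hk' : (size ell <= k + (r' + c))%N.
      by apply: leq_trans hk _; rewrite addSnnS leq_add2l -addSn leq_add2r.
    rewrite (IH false r' c e' hk') -/i' -/j (run_first sQ (memQ _ _ i'j rd)) /=.
      by rewrite filter_reading // transpR.
    move=> [a b]; rewrite mem_filter => /andP[rd' /inQ[/= eab rd'' aj bi]].
    rewrite eq_sym aj; apply/eqP => jb; subst b.
    move: rd' rd''; rewrite /reading /= ltxx !andbF !orbF => ai' ia.
    have [/andP[h1 _] h2] := skip _ eab ia.
    suff /negP[] : ~~ entry (raw E ell) (index a (rows E ell)) c by [].
    apply: nr'; rewrite h1 /=.
    have [ar _ _] := entry_raw_index s t eab.
    by rewrite -(nth_rows_lt (E := E) s) ?index_mem // nth_index.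
  rewrite run_avoids // => -[a b] /inQ[/= eab rd aj bi].
  rewrite eq_sym aj; apply/eqP => jb; subst b.
  move: rd; rewrite /reading /= ltxx andbF orbF => ia.
  have [/andP[h1 h3] h2] := skip _ eab ia.
  suff /negP[] : ~~ entry (raw E ell) (index a (rows E ell)) c by [].
  by apply: nr'; rewrite h1 subnKC // nrows_raw.
have := ohead_iotaP (entry (raw E ell) r) c.+1 (row_len (raw E ell) r - c.+1).
rewrite -/(next_one_right (raw E ell) r c).
have rowlen c' : entry (raw E ell) r c' -> (c' < row_len (raw E ell) r)%N.
  by rewrite /entry /row_len; case: ltnP => // h; rewrite nth_default.
have skip j' : E i j' -> j' < j ->
    (c < index j' (cols E ell))%N /\ entry (raw E ell) r (index j' (cols E ell)).
  move=> e' jj'; have [_ jc] := entry_raw_index s t e'; rewrite index_uniq //; last first.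
    by apply/asc_uniq/asc_filter.
  by split=> //; rewrite -(nth_cols_lt (E := E) s) ?index_mem // nth_index.
case: next_one_right => [c' [e' /andP[cc' _] nc']|nc'].
  have := e'; rewrite entry_raw // => /and3P[_ hc']; rewrite -/i; set j' := nth _ _ c' => ij'.
  have rd : reading (i, j) (i, j') by rewrite /reading /= nth_cols_lt ?cc' ?eqxx ?orbT.
  have hk' : (size ell <= k + (r + c'))%N.
    by apply: leq_trans hk _; rewrite addSnnS leq_add2l -addnS leq_add2l.
  rewrite (IH true r c' e' hk') -/i -/j' (run_first sQ (memQ _ _ ij' rd)) /=.
    by rewrite filter_reading // transpL.
  move=> [a b]; rewrite mem_filter => /andP[rd' /inQ[/= eab rd'' aj bi]].
  rewrite [i == b]eq_sym bi andbT; apply/eqP => ia; subst a.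
  move: rd' rd''; rewrite /reading /= ltxx eqxx /= => j'b bj.
  have [h1 h2] := skip _ eab bj.
  suff /negP[] : ~~ entry (raw E ell) r (index b (cols E ell)) by [].
  apply: nc'; rewrite h1 /=.
  have [_ bc _] := entry_raw_index s t eab.
  by rewrite -(nth_cols_lt (E := E) s) ?index_mem // nth_index.
rewrite run_avoids // => -[a b] /inQ[/= eab rd aj bi].
rewrite [i == b]eq_sym bi andbT; apply/eqP => ia; subst a.
move: rd; rewrite /reading /= ltxx eqxx /= => bj.
have [h1 h2] := skip _ eab bj.
suff /negP[] : ~~ entry (raw E ell) r (index b (cols E ell)) by [].
by apply: nc'; rewrite h1 subnKC ?rowlen.
Qed.

(** A path starts at the first 1 of its row or column in reading order, and the
    1s that are read before it do not involve its label. *)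
Lemma label_path_end E ell b : asc ell -> tableau_rel ell E ->
  in_diagram (raw E ell) b ->
  label E ell (path_end (raw E ell) b) = path_perm E ell (label E ell b).
Proof.
move=> s t; have sP := sorted_ones E s.
have fuel : (0 < size ell)%N -> forall r c, (size ell <= half_perimeter (raw E ell) + (r + c))%N.
  by move=> n0 r c; rewrite half_perimeter_raw // leq_addr.
case: b => [r|c] /= hb.
  have hr : (r < size (rows E ell))%N by rewrite -nrows_raw.
  have [hi hi' ci] := nth_rows_mem hr; set i := nth _ _ _ in hi hi' ci *.
  have n0 : (0 < size ell)%N by case: (ell) hi'.
  have rowlen c' : entry (raw E ell) r c' -> (c' < row_len (raw E ell) r)%N.
    by rewrite /entry /row_len; case: ltnP => // h; rewrite nth_default.
  have noti p : p \in ones E ell -> i != p.2.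
    rewrite mem_ones => /and3P[_ _ ep]; apply/eqP => ip; case/negP: ci; rewrite ip.
    by apply/(is_colP _ t); exists p.1.
  have skip j' : E i j' -> entry (raw E ell) r (index j' (cols E ell)).
    move=> e'; have [_ _] := entry_raw_index s t e'; rewrite index_uniq //.
    exact/asc_uniq/asc_filter.
  have := ohead_iotaP (entry (raw E ell) r) 0 (row_len (raw E ell) r).
  rewrite -/(leftmost_one (raw E ell) r).
  case: leftmost_one => [c [e _ nc]|nc].
    rewrite (label_zigzag _ s t e (fuel n0 _ _)).
    have := e; rewrite entry_raw // => /and3P[_ hc]; rewrite -/i; set j := nth _ _ c => ij.
    have [hi1 hj1 lij] := rel_dom t ij.
    have ijP : (i, j) \in ones E ell by rewrite mem_ones /= hi1 hj1.
    rewrite /path_perm (run_first sP ijP) /= ?transpL // => -[a b].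
    rewrite mem_filter => /andP[rd abP]; rewrite (noti _ abP) andbT /=.
    apply/eqP => ia; subst a; move: rd abP; rewrite /reading mem_ones ltxx eqxx /=.
    move=> jb /and3P[_ _ eab].
    suff /negP[] : ~~ entry (raw E ell) r (index b (cols E ell)) by apply: skip.
    apply: nc => /=.
    have [_ bc _] := entry_raw_index s t eab.
    by rewrite -(nth_cols_lt (E := E) s) ?index_mem // nth_index.
  rewrite /path_perm run_avoids // => -[a b] abP; rewrite (noti _ abP) andbT /=.
  apply/eqP => ia; subst a; move: abP; rewrite mem_ones => /and3P[_ _ /= eab].
  suff /negP[] : ~~ entry (raw E ell) r (index b (cols E ell)) by apply: skip.
  by apply: nc; rewrite /= add0n rowlen ?skip.
have n0 : (0 < size ell)%N by case: (ell) hb.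
have hc : (c < size (cols E ell))%N by rewrite -ncols_raw.
have [hj hj' cj] := nth_cols_mem hc; set j := nth _ _ _ in hj hj' cj *.
have notj p : p \in ones E ell -> j != p.1.
  rewrite mem_ones => /and3P[_ _ ep]; apply/eqP => jp.
  by case/(is_colP _ t): cj => k kj; rewrite jp in kj; apply: (rel_bip t kj ep).
have skip i' : E i' j -> entry (raw E ell) (index i' (rows E ell)) c.
  move=> e'; have [_ _] := entry_raw_index s t e'; rewrite index_uniq //.
  by rewrite rev_uniq; apply/asc_uniq/asc_filter.
have := ohead_iotaP (fun r => entry (raw E ell) r c) 0 (nrows (raw E ell)).
rewrite -/(topmost_one (raw E ell) c).
case: topmost_one => [r [e _ nr]|nr].
  rewrite (label_zigzag _ s t e (fuel n0 _ _)).
  have := e; rewrite entry_raw // => /and3P[hr _]; rewrite -/j; set i := nth _ _ r => ij.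
  have [hi1 hj1 lij] := rel_dom t ij.
  have ijP : (i, j) \in ones E ell by rewrite mem_ones /= hi1 hj1.
  rewrite /path_perm (run_first sP ijP) /= ?transpR // => -[a b].
  rewrite mem_filter => /andP[rd abP]; rewrite (notj _ abP) /=.
  apply/eqP => jb; subst b; move: rd abP; rewrite /reading mem_ones ltxx andbF orbF /=.
  move=> ai /and3P[_ _ eab].
  suff /negP[] : ~~ entry (raw E ell) (index a (rows E ell)) c by apply: skip.
  apply: nr => /=.
  have [ar _ _] := entry_raw_index s t eab.
  by rewrite -(nth_rows_lt (E := E) s) ?index_mem // nth_index.
rewrite /path_perm run_avoids // => -[a b] abP; rewrite (notj _ abP) /=.
apply/eqP => jb; subst b; move: abP; rewrite mem_ones => /and3P[_ _ /= eab].
have [ar _ _] := entry_raw_index s t eab.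
suff /negP[] : ~~ entry (raw E ell) (index a (rows E ell)) c by apply: skip.
by apply: nr; rewrite /= add0n nrows_raw index_mem.
Qed.

(** * The border *)

(** The order of the steps along the border of a diagram whose row [r] has
    length [len r]. *)
Definition border_before (len : nat -> nat) (b b' : step) : bool :=
  match b, b' with
  | inl r, inl r' => (r < r')%N
  | inr c, inr c' => (c' < c)%N
  | inl r, inr c => (c < len r)%N
  | inr c, inl r => (len r <= c)%N
  end.

Lemma border_before_asym len b b' : border_before len b b' -> ~~ border_before len b' b.
Proof. by case: b b' => [r|c] [r'|c'] /=; rewrite -?leqNgt -?ltnNge // => /ltnW. Qed.

Lemma row_len_ncols (s : raw_tableau) r : sorted geq (map size s) ->
  (row_len s r <= ncols s)%N.
Proof.
case: s => [|row s]; first by rewrite /row_len /row_at nth_nil.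
case: r => [|r] //= h; rewrite /row_len /row_at /ncols /=.
have [hr|hr] := ltnP r (size s); last by rewrite nth_default.
have tr : transitive geq by move=> a b c /= h1 h2; apply: leq_trans h2 h1.
have /allP/(_ (size (nth [::] s r))) := order_path_min tr h.
by apply; apply: map_f; apply: mem_nth.
Qed.

Lemma pairwise_border_from len r0 s : sorted geq (map size s) ->
  (forall r, (r < size s)%N -> len (r0 + r)%N = row_len s r) ->
  pairwise (border_before len) (border_from r0 s).
Proof.
elim: s r0 => [|row s IH] r0 // ss hlen.
have ss' : sorted geq (map size s) by apply: path_sorted ss.
have hd : (size (head [::] s) <= size row)%N.
  by move: ss; case: (s) => [|row' s'] //= /andP[].
have len0 : len r0 = size row by have := hlen 0%N isT; rewrite addn0.
have len' r : (r < size s)%N -> len (r0.+1 + r)%N = row_len s r.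
  by move=> hr; rewrite addSnnS hlen.
rewrite /= pairwise_cat IH // andbT; apply/and3P; split.
- rewrite all_cat; apply/andP; split; apply/allP => b.
    move=> /mapP[c]; rewrite mem_rev mem_iota => /andP[_].
    by rewrite subnKC // => hc -> /=; rewrite len0.
  rewrite mem_border_from //; case: b => [r /andP[]//|c /= hc].
  by rewrite len0 (leq_trans hc).
- apply/allrelP => _ b /mapP[c + ->]; rewrite mem_rev mem_iota => /andP[hc _].
  rewrite mem_border_from //; case: b => [r /andP[h1 h2]|c' hc'] /=.
    rewrite -(subnKC h1) len'; last by rewrite -(ltn_add2l r0.+1) subnKC.
    exact: leq_trans (row_len_ncols _ ss') hc.
  exact: leq_trans hc' hc.
rewrite pairwise_map -sorted_pairwise; last by move=> a b c /= h1 h2; apply: ltn_trans h2 h1.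
by rewrite rev_sorted; apply: iota_ltn_sorted.
Qed.

Lemma pairwise_border s : sorted geq (map size s) ->
  pairwise (border_before (row_len s)) (border s).
Proof. by move=> ss; apply: pairwise_border_from. Qed.

Lemma mem_border s b : sorted geq (map size s) -> (b \in border s) <-> in_diagram s b.
Proof. by move=> ss; rewrite mem_border_from //; case: b. Qed.

Lemma index_border s b b' : sorted geq (map size s) -> b \in border s -> b' \in border s ->
  (index b (border s) < index b' (border s))%N = border_before (row_len s) b b'.
Proof.
move=> ss hb hb'.
have lt a a' : a \in border s -> a' \in border s ->
    (index a (border s) < index a' (border s))%N -> border_before (row_len s) a a'.
  move=> ha ha' h; have /(pairwiseP (inl 0%N))/(_ _ _ _ _ h) := pairwise_border ss.
  by rewrite !inE !index_mem !nth_index //; apply.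
apply/idP/idP; first exact: lt.
apply: contraTT; rewrite -leqNgt leq_eqVlt => /predU1P[e|h].
  have -> : b = b' by rewrite -(nth_index (inl 0%N) hb') e nth_index.
  by case: (b') => x /=; rewrite ltnn.
exact/border_before_asym/lt.
Qed.

Lemma raw_sorted E ell : asc ell -> tableau_rel ell E -> (0 < size ell)%N ->
  sorted geq (map size (raw E ell)).
Proof. by move=> s t n0; have /and5P[] := raw_is_tableau s t n0. Qed.

Lemma label_lt E ell b b' : asc ell -> tableau_rel ell E -> (0 < size ell)%N ->
  in_diagram (raw E ell) b -> in_diagram (raw E ell) b' ->
  border_before (row_len (raw E ell)) b b' -> label E ell b < label E ell b'.
Proof.
move=> s t n0; case: b b' => [r|c] [r'|c'] /=; rewrite ?nrows_raw ?ncols_raw // => hb hb'.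
- by rewrite nth_rows_lt.
- by rewrite lt_row_len_raw // => /and3P[].
- rewrite leqNgt lt_row_len_raw // hb hb' /= -leNgt le_eqVlt => /predU1P[e|//].
  have [_ _] := nth_cols_mem hb; have [_ _] := nth_rows_mem hb'.
  by rewrite e => /negbTE->.
- by rewrite nth_cols_lt.
Qed.

(** The border runs through the steps in the order of their labels, and there
    is only one increasing list of the members of [ell]. *)
Lemma border_raw E ell : asc ell -> tableau_rel ell E -> (0 < size ell)%N ->
  map (label E ell) (border (raw E ell)) = ell.
Proof.
move=> s t n0; have ss := raw_sorted s t n0; apply: asc_eq => //.
  rewrite /asc sorted_pairwise; last exact: lt_trans.
  rewrite pairwise_map; apply: (sub_in_pairwise _ (allss _) (pairwise_border ss)).
  by move=> b b' /(mem_border _ ss) hb /(mem_border _ ss) hb'; apply: label_lt.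
move=> x; apply/mapP/idP => [[b /(mem_border _ ss) hb ->]|hx].
  case: b hb => [r|c] /=; rewrite ?nrows_raw ?ncols_raw // => h.
    by have [] := nth_rows_mem h.
  by have [] := nth_cols_mem h.
case: (boolP (is_col E ell x)) => cx.
  have xc : x \in cols E ell by rewrite mem_cols cx.
  exists (inr (index x (cols E ell))); last by rewrite /= nth_index.
  by apply/(mem_border _ ss); rewrite /= ncols_raw // index_mem.
have xr : x \in rows E ell by rewrite mem_rows cx.
exists (inl (index x (rows E ell))); last by rewrite /= nth_index.
by apply/(mem_border _ ss); rewrite /= nrows_raw // index_mem.
Qed.

Lemma index_map_in (T T' : eqType) (f : T -> T') s x :
  {in s &, injective f} -> x \in s -> index (f x) (map f s) = index x s.
Proof.
move=> fi xs; have sub : forall y, y \in s -> (f y == f x) = (y == x).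
  by move=> y ys; apply/eqP/eqP => [/fi->|->].
rewrite /index find_map; apply: eq_in_find => y ys /=; exact: sub.
Qed.

Lemma Phi_raw N E ell : asc ell -> tableau_rel ell E -> size ell = N.+1 ->
  [ffun k : 'I_N.+1 => Phi_fun (raw E ell) k] =
  [ffun k : 'I_N.+1 => inord (index (path_perm E ell (nth 0 ell k)) ell) : 'I_N.+1].
Proof.
move=> s t sz; have n0 : (0 < size ell)%N by rewrite sz.
have ss := raw_sorted s t n0; have eb := border_raw s t n0.
apply/ffunP => k; rewrite !ffunE /Phi_fun; congr inord.
have hk : (k < size (border (raw E ell)))%N by rewrite -(size_map (label E ell)) eb sz.
set b := nth _ _ _; have hb : b \in border (raw E ell) by apply: mem_nth.
have hd := (mem_border _ ss).1 hb.
have -> : nth 0 ell k = label E ell b by rewrite -[in LHS]eb (nth_map (inl 0%N)).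
rewrite -label_path_end // -[X in _ = index _ X]eb index_map_in //; last first.
  by apply/(mem_border _ ss); apply: path_end_in.
move=> x y hx hy e; have u := asc_uniq s.
rewrite -(nth_index (inl 0%N) hx) -(nth_index (inl 0%N) hy); congr nth.
apply/eqP; rewrite -(nth_uniq 0 _ _ (s := map (label E ell) (border (raw E ell)))).
- by rewrite !(nth_map (inl 0%N)) ?index_mem // !nth_index // e.
- by rewrite size_map index_mem.
- by rewrite size_map index_mem.
- by rewrite eb.
Qed.

(** Normalization replaces each label by its rank, which is the position of its
    step on the border. *)
Lemma Norm_raw N E ell (sigma : set_perm) : asc ell -> tableau_rel ell E -> size ell = N.+1 ->
  perm_eq (Defs.support sigma) ell -> {in ell, sigma =1 path_perm E ell} ->
  Norm N sigma = [ffun k : 'I_N.+1 => Phi_fun (raw E ell) k].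
Proof.
move=> s t sz pe e; rewrite Phi_raw //; apply/ffunP => k; rewrite !ffunE.
have -> : sorted_support sigma = ell.
  apply: (sorted_eq le_trans le_anti); first exact: sort_le_sorted.
    by apply: sub_sorted s => x y /ltW.
  by rewrite perm_sort.
by rewrite e // mem_nth // sz.
Qed.

Definition std_labels N : seq rat := [seq k%:R | k <- iota 1 N.+1].

Lemma std_labels_asc N : asc (std_labels N).
Proof.
rewrite /asc /std_labels sorted_map; apply: sub_sorted (iota_ltn_sorted 1 N.+1) => x y /=.
by rewrite ltr_nat.
Qed.

Lemma size_std_labels N : size (std_labels N) = N.+1.
Proof. by rewrite size_map size_iota. Qed.

Lemma nth_std_labels N k : (k < N.+1)%N -> nth 0 (std_labels N) k = k.+1%:R.
Proof. by move=> h; rewrite (nth_map 0%N) ?size_iota // nth_iota. Qed.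

Lemma std_labelsP N (x : rat) :
  reflect (exists2 k, (k < N.+1)%N & x = k.+1%:R) (x \in std_labels N).
Proof.
apply: (iffP mapP) => [[[|k]]|[k hk ->]]; rewrite ?mem_iota //.
  by move=> hk ->; exists k.
by exists k.+1 => //; rewrite mem_iota.
Qed.

Lemma mem_std_labels N k : ((k%:R : rat) \in std_labels N) = (0 < k <= N.+1)%N.
Proof.
apply/std_labelsP/idP => [[k' hk' /eqP]|]; first by rewrite eqr_nat => /eqP->.
by case: k => // k hk; exists k.
Qed.

(** The label of a step is its rank on the border.  A row and a column meet in a
    box exactly if the step of the row comes first. *)
Lemma raw_surj N s : is_tableau N.+1 s ->
  exists2 E, tableau_rel (std_labels N) E & s = raw E (std_labels N).
Proof.
case/and5P => _ ss /eqP hp /allP hcol /allP hle.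
pose B := border s; pose ell := std_labels N.
have uB : uniq B by apply: uniq_border_from.
have szB : size B = N.+1 by rewrite /B /border size_border_from.
pose lbl b : rat := (index b B).+1%:R.
pose stepof (x : rat) := nth (inl 0%N) B (Num.truncn x).-1.
have lblK b : b \in B -> stepof (lbl b) = b.
  by move=> hb; rewrite /stepof /lbl natrK nth_index.
have lbl_mem b : b \in B -> lbl b \in ell.
  by move=> hb; rewrite mem_std_labels /= -szB index_mem.
have stepofK x : x \in ell -> stepof x \in B /\ lbl (stepof x) = x.
  move=> /std_labelsP[k hk ->]; rewrite /stepof natrK /lbl /=.
  by rewrite mem_nth ?szB // index_uniq ?szB.
have lbl_lt b b' : b \in B -> b' \in B -> (lbl b < lbl b') = border_before (row_len s) b b'.
  by move=> hb hb'; rewrite /lbl ltr_nat ltnS index_border.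
pose E x y := [&& x \in ell, y \in ell & match stepof x, stepof y with
  | inl r, inr c => entry s r c | _, _ => false end].
have EP x y : E x y -> exists r c, [/\ x = lbl (inl r), y = lbl (inr c),
    inl r \in B, inr c \in B & entry s r c].
  move=> /and3P[/stepofK[hx ex] /stepofK[hy ey]].
  by move: ex ey hx hy; case: (stepof x) => // r; case: (stepof y) => // c; exists r, c.
have inB r c : entry s r c -> inl r \in B /\ inr c \in B.
  by move=> e; have [h1 h2] := entry_lt ss e; split; apply/(mem_border _ ss).
have Elbl r c : inl r \in B -> inr c \in B -> E (lbl (inl r)) (lbl (inr c)) = entry s r c.
  by move=> h1 h2; rewrite /E !lbl_mem // !lblK.
have elt r c : entry s r c -> (c < row_len s r)%N.
  by rewrite /entry /row_len; case: ltnP => // h; rewrite nth_default.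
have lbl_inj b b' : b \in B -> b' \in B -> lbl b = lbl b' -> b = b'.
  by move=> hb hb' e; rewrite -(lblK b) // e lblK.
have t : tableau_rel ell E.
  split.
  - move=> x y e; have [r [c [xr yc hr hc h]]] := EP _ _ e; case/and3P: e => hx hy _.
    by split => //; rewrite xr yc lbl_lt //= elt.
  - move=> x y z /EP[r [c [_ -> _ hc _]]] /EP[r' [c' [e _ hr' _ _]]].
    by have := lbl_inj _ _ hc hr' e.
  move=> k x y l /EP[r1 [c1 [-> -> hr1 hc1 e1]]] /EP[r2 [c2 [-> -> hr2 hc2 e2]]].
  rewrite !lbl_lt //= => r12 lc c21; rewrite Elbl //.
  have hr2' : (r2 < nrows s)%N by have [] := entry_lt ss e2.
  have := hle r2; rewrite mem_iota hr2' => /(_ isT)/allP/(_ c1).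
  rewrite mem_iota lc => /(_ isT); apply: contraNT => ->; apply/and3P; split=> //.
    by apply/hasP; exists r1; rewrite ?mem_iota.
  by apply/hasP; exists c2; rewrite ?mem_iota.
exists E => //.
have col_lbl b : b \in B -> is_col E ell (lbl b) = if b is inr _ then true else false.
  move=> hb; apply/(is_colP _ t); case: b hb => [r|c] hb.
    by move=> [x /EP[r' [c' [_ e _ hc _]]]]; have := lbl_inj _ _ hb hc e.
  have hc := (mem_border _ ss).1 hb; have := hcol c; rewrite mem_iota hc.
  move=> /(_ isT)/hasP[r _ e]; exists (lbl (inl r)); rewrite Elbl //.
  by have [] := inB _ _ e.
have hin r : (r < nrows s)%N -> inl r \in B by move=> h; apply/(mem_border _ ss).
have hinc c : (c < ncols s)%N -> inr c \in B by move=> h; apply/(mem_border _ ss).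
have rowsE : rows E ell = [seq lbl (inl r) | r <- iota 0 (nrows s)].
  apply: asc_eq; first exact/rows_asc/std_labels_asc.
    rewrite /asc sorted_map.
    apply: (sub_in_sorted _ (allss _) (iota_ltn_sorted 0 _)) => r r'.
    by rewrite !mem_iota => /hin h /hin h' /=; rewrite lbl_lt.
  move=> x; rewrite mem_rows; apply/andP/mapP => [[nx /stepofK[hx ex]]|[r hr ->]].
    move: nx; rewrite -ex col_lbl //; case: (stepof x) hx => // r hr _.
    by exists r => //; rewrite mem_iota; exact: (mem_border _ ss).1 hr.
  by rewrite mem_iota in hr; rewrite lbl_mem ?col_lbl ?hin.
have colsE : cols E ell = [seq lbl (inr c) | c <- iota 0 (ncols s)].
  have tr : transitive (>%R : rel rat) by move=> a b c /= h1 h2; apply: lt_trans h2 h1.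
  apply: (irr_sorted_eq tr ltxx); first exact/cols_desc/std_labels_asc.
    rewrite sorted_map.
    apply: (sub_in_sorted _ (allss _) (iota_ltn_sorted 0 _)) => c c'.
    by rewrite !mem_iota => /hinc h /hinc h' /=; rewrite lbl_lt.
  move=> x; rewrite mem_cols; apply/andP/mapP => [[nx /stepofK[hx ex]]|[c hc ->]].
    move: nx; rewrite -ex col_lbl //; case: (stepof x) hx => // c hc _.
    by exists c => //; rewrite mem_iota; exact: (mem_border _ ss).1 hc.
  by rewrite mem_iota in hc; rewrite lbl_mem ?col_lbl ?hinc.
rewrite /raw rowsE colsE -map_comp -[LHS](mkseq_nth [::]); apply/eq_in_map => r.
rewrite mem_iota => hr /=; rewrite filter_map -map_comp.
rewrite (eq_in_filter (a2 := fun c => (c < row_len s r)%N)); last first.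
  by move=> c; rewrite mem_iota => hc /=; rewrite lbl_lt ?hin ?hinc.
rewrite (@filter_iota_ltn 0 _ _ (row_len_ncols r ss)) -[LHS](mkseq_nth false); apply/eq_in_map => c.
rewrite mem_iota => hc /=; rewrite Elbl ?hin ?hinc //.
exact: leq_trans hc (row_len_ncols _ ss).
Qed.

(** * Operations on fillings *)

Lemma eq_raw E E' ell : E =2 E' -> raw E ell = raw E' ell.
Proof.
move=> e; have ec j : is_col E ell j = is_col E' ell j.
  by apply: eq_has => k; rewrite /= e.
have er : rows E ell = rows E' ell by apply: eq_filter => i; rewrite ec.
have ecs : cols E ell = cols E' ell by rewrite /cols (eq_filter ec).
by rewrite /raw er ecs; apply: eq_map => i; apply: eq_map => j.
Qed.

Lemma rows_eq E ell s : asc ell -> asc s ->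
  (forall i, i \in ell -> (i \in s) = ~~ is_col E ell i) -> {subset s <= ell} ->
  rows E ell = s.
Proof.
move=> a a' h sub; apply: asc_eq => //; first exact: rows_asc.
move=> i; rewrite mem_rows andbC; case: (boolP (i \in ell)) => hi /=; first by rewrite h.
by apply/esym/negbTE; apply: contra hi; apply: sub.
Qed.

Lemma cols_eq E ell s : asc ell -> sorted >%R s ->
  (forall j, j \in ell -> (j \in s) = is_col E ell j) -> {subset s <= ell} ->
  cols E ell = s.
Proof.
move=> a a' h sub; apply: (irr_sorted_eq gt_trans_rat ltxx) => //; first exact: cols_desc.
move=> i; rewrite mem_cols andbC; case: (boolP (i \in ell)) => hi /=; first by rewrite h.
by apply/esym/negbTE; apply: contra hi; apply: sub.
Qed.

Lemma filter_predC1_rem (T : eqType) (x : T) s : uniq s ->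
  filter (predC1 x) s = take (index x s) s ++ drop (index x s).+1 s.
Proof. by move=> u; rewrite -remE rem_filter. Qed.

Lemma cols_uniq E ell : asc ell -> uniq (cols E ell).
Proof. by move=> s; rewrite rev_uniq; apply/asc_uniq/asc_filter. Qed.

Lemma is_col_ell ell ell' E j : tableau_rel ell E -> tableau_rel ell' E ->
  is_col E ell j = is_col E ell' j.
Proof. by move=> t t'; apply/(is_colP _ t)/(is_colP _ t'). Qed.

Lemma rows_del_label E ell x : asc ell -> tableau_rel ell E ->
  tableau_rel (filter (predC1 x) ell) E ->
  rows E (filter (predC1 x) ell) = filter (predC1 x) (rows E ell).
Proof.
move=> s t t'; apply: rows_eq; first exact: asc_filter.
- exact/asc_filter/rows_asc.
- move=> i; rewrite !mem_filter /= => /andP[-> ->] /=.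
  by rewrite (is_col_ell _ t' t) andbT.
by move=> i; rewrite !mem_filter => /and3P[-> _ ->].
Qed.

(** Empty rows do not affect the columns. *)
Lemma cols_ell E ell ell' : asc ell -> asc ell' -> tableau_rel ell E ->
  tableau_rel ell' E -> cols E ell = cols E ell'.
Proof.
move=> s s' t t'; apply: cols_eq => //; first exact: cols_desc.
  move=> j hj; rewrite mem_cols -(is_col_ell _ t t').
  by apply: andb_idr => /(is_colP _ t)[k /(rel_dom t')[]].
by move=> j; rewrite mem_cols => /andP[/(is_colP _ t')[k /(rel_dom t)[]]].
Qed.

Lemma del_row_raw E ell x : asc ell -> tableau_rel ell E ->
  tableau_rel (filter (predC1 x) ell) E -> x \in ell ->
  del_row (raw E ell) (index x (rows E ell)) = raw E (filter (predC1 x) ell).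
Proof.
move=> s t t' hx; have s' := asc_filter (predC1 x) s.
have rE := rows_del_label s t t'; have cE := cols_ell s' s t' t.
rewrite /del_row /raw rE cE -map_take -map_drop -map_cat; congr map.
by rewrite filter_predC1_rem //; apply/asc_uniq/rows_asc.
Qed.

Lemma count_lt (T : eqType) (a a' : pred T) s x : x \in s -> a' x -> ~~ a x ->
  (forall y, a y -> a' y) -> (count a s < count a' s)%N.
Proof.
move=> xs a'x nax sub; have /= h := count_predUI a (predC a) (filter a' s).
have e b : count b (filter a' s) = count (predI b a') s.
  by rewrite -size_filter -filter_predI size_filter.
have -> : count a s = count a (filter a' s).
  by rewrite e; apply: eq_count => y /=; case: (boolP (a y)) => // /sub ->.
have <- := size_filter a' s; rewrite -(count_predC a (filter a' s)).
rewrite -[X in (X < _)%N]addn0 ltn_add2l -has_count; apply/hasP; exists x => //.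
by rewrite mem_filter a'x.
Qed.

Lemma asc_cat s x : asc s -> x \notin s ->
  [/\ s = [seq y <- s | y < x] ++ [seq y <- s | x < y],
      take (count (fun y => y < x) s) s = [seq y <- s | y < x] &
      drop (count (fun y => y < x) s) s = [seq y <- s | x < y]].
Proof.
move=> a nx; have [y z yz|e1 e2] := sorted_filter_take (a := fun y => y < x) lt_trans a.
  exact: lt_trans yz.
have {}e2 : drop (count (fun y => y < x) s) s = [seq y <- s | x < y].
  rewrite -e2; apply: eq_in_filter => y ys /=; rewrite -leNgt le_eqVlt.
  by case: eqP => // xy; case/negP: nx; rewrite xy.
by split=> //; rewrite e1 -e2 cat_take_drop.
Qed.

Lemma asc_insert s s' x : asc s -> asc s' -> x \notin s -> s' =i x :: s ->
  s' = [seq y <- s | y < x] ++ x :: [seq y <- s | x < y].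
Proof.
move=> a a' nx e; apply: asc_eq => //.
  rewrite /asc (sorted_pairwise lt_trans) pairwise_cat pairwise_cons.
  rewrite -!(sorted_pairwise lt_trans) !(sorted_filter lt_trans) // !andbT.
  apply/andP; split; last by apply/allP => y; rewrite mem_filter => /andP[].
  apply/allrelP => y z; rewrite mem_filter inE => /andP[yx _] /predU1P[->//|].
  by rewrite mem_filter => /andP[xz _]; apply: lt_trans xz.
move=> y; rewrite e mem_cat !inE !mem_filter.
by case: (ltgtP y x) => [_|_|->] /=; rewrite ?orbF ?orbT // (negbTE nx).
Qed.

(** The last hypothesis makes [x] the southernmost position for a row of its
    length: any row below has fewer boxes. *)
Lemma insert_zero_row_raw E ell ell' x : asc ell -> asc ell' -> tableau_rel ell E ->
  x \notin ell -> ell' =i x :: ell ->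
  {in rows E ell, forall i, x < i -> exists2 j, j \in cols E ell & x < j < i} ->
  insert_zero_row (raw E ell) (count (fun j => x < j) (cols E ell)) = raw E ell'.
Proof.
move=> s s' t nx e h; have t' : tableau_rel ell' E.
  by apply: (tableau_rel_sub t) => i j /(rel_dom t)[]; rewrite !e !inE => -> ->; rewrite !orbT.
have nEx k : ~~ E x k by apply: contra nx => /(rel_dom t)[].
have nEx' k : ~~ E k x by apply: contra nx => /(rel_dom t)[].
have nxr : x \notin rows E ell by rewrite mem_rows (negbTE nx) andbF.
have rE : rows E ell' = [seq y <- rows E ell | y < x] ++ x :: [seq y <- rows E ell | x < y].
  apply: asc_insert => //; try exact: rows_asc.
  move=> y; rewrite mem_rows e !inE mem_rows (is_col_ell _ t' t).
  have [->|_] := eqVneq y x; last by [].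
  by rewrite /= andbT; apply/(is_colPn _ t).
have cE := cols_ell s' s t' t.
set m := count _ _; rewrite /insert_zero_row.
set p := count (fun row => _) (raw E ell).
have pE : p = count (fun y => y < x) (rows E ell).
  rewrite /p /raw count_map; apply: eq_in_count => i ir /=.
  rewrite size_map size_filter; case: (ltgtP i x) => [ix|xi|ix].
  - by apply: sub_count => y /=; apply: lt_trans.
  - have [j jc /andP[xj ji]] := h _ ir xi; apply/negbTE; rewrite -ltnNge.
    apply: (count_lt jc) => //=; first by rewrite -leNgt ltW.
    by move=> y; apply: lt_trans.
  - by case/negP: nxr; rewrite -ix.
have [_ tE dE] := asc_cat (rows_asc E s) nxr.
rewrite /raw rE cE -map_take -map_drop pE tE dE map_cat /=; congr (_ ++ _ :: _).
have /all_pred1P -> : all (pred1 false) [seq E x j | j <- cols E ell & x < j].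
  by rewrite all_map; apply/allP => j _ /=; rewrite (negbTE (nEx j)).
by rewrite size_map size_filter.
Qed.

Lemma rows_del_one E ell i j : asc ell -> tableau_rel ell E -> E i j ->
  (forall k, E k j -> k = i) ->
  rows (del_one E i j) (filter (predC1 j) ell) = rows E ell.
Proof.
move=> s t ij Ej; have t' := del_col_rel t ij Ej.
apply: rows_eq; [exact: asc_filter|exact: rows_asc| |].
  move=> k; rewrite mem_filter /= mem_rows => /andP[kj ->]; rewrite andbT.
  congr (~~ _); apply/(is_colP _ t)/(is_colP _ t') => -[y].
    by move=> e; exists y; rewrite /del_one e (negbTE kj) andbF.
  by move=> /del_oneP[e _]; exists y.
move=> k; rewrite mem_rows mem_filter /= => /andP[ck ->]; rewrite andbT.
by apply: contra ck => /eqP->; apply/(is_colP _ t); exists i.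
Qed.

Lemma cols_del_one E ell i j : asc ell -> tableau_rel ell E -> E i j ->
  (forall k, E k j -> k = i) ->
  cols (del_one E i j) (filter (predC1 j) ell) = filter (predC1 j) (cols E ell).
Proof.
move=> s t ij Ej; have t' := del_col_rel t ij Ej.
apply: cols_eq; first exact: asc_filter.
- exact: (sorted_filter gt_trans_rat _ (cols_desc E s)).
- move=> k; rewrite !mem_filter /= mem_cols => /andP[kj ->]; rewrite andbT kj /=.
  apply/(is_colP _ t)/(is_colP _ t') => -[y].
    by move=> e; exists y; rewrite /del_one e (negbTE kj) andbF.
  by move=> /del_oneP[e _]; exists y.
by move=> k; rewrite !mem_filter mem_cols => /and3P[-> _ ->].
Qed.

Lemma del_col_raw E ell i j : asc ell -> tableau_rel ell E -> E i j ->
  (forall k, E k j -> k = i) ->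
  del_col (raw E ell) (index j (cols E ell))
    = raw (del_one E i j) (filter (predC1 j) ell).
Proof.
move=> s t ij Ej; have s' := asc_filter (predC1 j) s.
have t' := del_col_rel t ij Ej.
have [hi hj _] := rel_dom t ij; have [_ jc _] := entry_raw_index s t ij.
have eE k y : y != j -> del_one E i j k y = E k y.
  by move=> yj; rewrite /del_one (negbTE yj) andbF andbT.
have rE := rows_del_one s t ij Ej.
have cE := cols_del_one s t ij Ej.
rewrite /del_col /raw rE cE -map_comp; apply: eq_map => k /=.
rewrite -map_take -map_drop -map_cat.
have [e1 e2] := cols_filter_gt E k s.
set L := [seq y <- cols E ell | k < y].
have -> : take (index j (cols E ell)) L ++ drop (index j (cols E ell)).+1 L
    = filter (predC1 j) L.
  have uL : uniq L by apply: filter_uniq; apply: cols_uniq.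
  have [kj|jk] := ltP k j.
    rewrite filter_predC1_rem //; have -> // : index j (cols E ell) = index j L.
    rewrite -{1}(cat_take_drop (count (fun y => k < y) (cols E ell)) (cols E ell)).
    by rewrite -e1 index_cat mem_filter kj jc.
  have sz : (size L <= index j (cols E ell))%N.
    by rewrite size_filter leqNgt count_cols_gt ?index_mem // nth_index // -leNgt.
  rewrite take_oversize // drop_oversize ?(leq_trans sz) // cats0 -[LHS]filter_predT.
  apply: eq_in_filter => y; rewrite mem_filter => /andP[ky _] /=.
  by apply/esym; apply: contraTneq ky => ->; rewrite -leNgt.
rewrite -!filter_predI.
rewrite (eq_filter (a2 := predI (fun y => k < y) (predC1 j))) => [|y /=]; last exact: andbC.
by apply/eq_in_map => y; rewrite mem_filter => /andP[/andP[_ yj] _]; rewrite eE.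
Qed.

Lemma lt_count_rows E ell x r : asc ell -> (r < size (rows E ell))%N ->
  (r < count (fun k => k < x)%R (rows E ell))%N = (nth 0 (rows E ell) r < x).
Proof.
move=> s hr; have a := rows_asc E s.
have [y z yz|e1 e2] := sorted_filter_take (a := fun y => y < x) lt_trans a.
  exact: lt_trans yz.
set m := count _ _ in e1 e2 *.
have sm : (m <= size (rows E ell))%N by apply: count_size.
case: ltnP => h; apply/esym.
  have : nth 0 (rows E ell) r \in take m (rows E ell).
    by rewrite -(nth_take _ h) mem_nth // size_takel.
  by rewrite -e1 mem_filter => /andP[].
have : nth 0 (rows E ell) r \in drop m (rows E ell).
  by rewrite -(subnKC h) -nth_drop mem_nth // size_drop ltn_sub2r // (leq_ltn_trans h).
by rewrite -e2 mem_filter => /andP[/negbTE].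
Qed.

Lemma size_bottom_one_col m : (0 < m)%N -> size (bottom_one_col m) = m.
Proof. by move=> h; rewrite /bottom_one_col size_rcons size_nseq prednK. Qed.

Lemma nth_bottom_one_col m r : (r < m)%N ->
  nth false (bottom_one_col m) r = (r.+1 == m).
Proof.
case: m => // m; rewrite ltnS eqSS /bottom_one_col nth_rcons size_nseq /= => h.
by rewrite nth_nseq; case: ltngtP h.
Qed.

Lemma col_len_raw E ell c : asc ell -> (c < size (cols E ell))%N ->
  col_len (raw E ell) c
    = count (fun k => k < nth 0 (cols E ell) c) (rows E ell).
Proof.
move=> s hc; rewrite /col_len /raw count_map; apply: eq_count => k /=.
by rewrite size_map size_filter count_cols_gt.
Qed.

Lemma desc_insert (s s' : seq rat) x : sorted >%R s -> sorted >%R s' ->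
  x \notin s -> s' =i x :: s ->
  s' = [seq y <- s | x < y] ++ x :: [seq y <- s | y < x].
Proof.
move=> a a' nx e; rewrite -[LHS]revK (asc_insert (s := rev s) (s' := rev s') (x := x)).
- by rewrite rev_cat rev_cons -!filter_rev !revK cat_rcons.
- by rewrite /asc rev_sorted.
- by rewrite /asc rev_sorted.
- by rewrite mem_rev.
- by move=> y; rewrite inE !mem_rev e.
Qed.

(** As the new column comes just after row [i], the columns to its left are those
    that reach at least as far down as row [i]; and its only 1 is in row [i],
    the last row that it meets. *)
Lemma insert_col_raw E ell ell' i x : asc ell -> asc ell' -> tableau_rel ell E ->
  x \notin ell -> ell' =i x :: ell -> consecutive ell' i x -> i \in rows E ell ->
  insert_col (raw E ell) (bottom_one_col (count (fun k => k < x) (rows E ell)))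
    = raw (add_one E i x) ell'.
Proof.
move=> s s' t nx e c ir.
have sub : {subset ell <= ell'} by move=> y hy; rewrite e inE hy orbT.
have ci : ~~ is_col E ell i by move: ir; rewrite mem_rows => /andP[].
have Ni := elimT (is_colPn _ t) ci.
have t' : tableau_rel ell' (add_one E i x) by apply: (add_col_rel t).
have [_ _ lix _] := c.
have eE k y : y != x -> add_one E i x k y = E k y.
  by move=> yx; rewrite /add_one (negbTE yx) andbF orbF.
have nEx k : ~~ E k x by apply: contra nx => /(rel_dom t)[].
have eEx k : add_one E i x k x = (k == i).
  by rewrite /add_one (negbTE (nEx k)) eqxx andbT.
have colE y : y != x -> is_col (add_one E i x) ell' y = is_col E ell y.
  move=> yx; apply/(is_colP _ t')/(is_colP _ t) => -[k].
    by rewrite eE // => h; exists k.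
  by move=> h; exists k; rewrite eE.
have colx : is_col (add_one E i x) ell' x.
  by apply/(is_colP _ t'); exists i; rewrite eEx.
have rE : rows (add_one E i x) ell' = rows E ell.
  apply: rows_eq => //; first exact: rows_asc.
    move=> y; rewrite e inE mem_rows => /predU1P[->|hy].
      by rewrite colx (negbTE nx) andbF.
    by rewrite hy andbT colE //; apply: contraNneq nx => <-.
  by move=> y; rewrite mem_rows => /andP[_ /sub].
have nxc : x \notin cols E ell by rewrite mem_cols (negbTE nx) andbF.
have cE : cols (add_one E i x) ell'
    = [seq y <- cols E ell | x < y] ++ x :: [seq y <- cols E ell | y < x].
  apply: desc_insert => //; try exact: cols_desc.
  move=> y; rewrite inE !mem_cols e inE.
  by have [->|yx] := eqVneq y x; [rewrite colx|rewrite colE].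
set m := count _ _.
have lm r : (r < size (rows E ell))%N -> (r < m)%N = (nth 0 (rows E ell) r < x).
  exact: lt_count_rows.
have hri : (index i (rows E ell) < size (rows E ell))%N by rewrite index_mem.
have mE : m = (index i (rows E ell)).+1.
  apply/eqP; rewrite eqn_leq andbC lm // nth_index // lix /= leqNgt; apply/negP => h.
  have hr : ((index i (rows E ell)).+1 < size (rows E ell))%N.
    by apply: leq_trans h _; apply: count_size.
  move: h; rewrite lm // => /(consecutive_gt c); have [_ h _] := nth_rows_mem hr.
  move=> /(_ (sub _ h)); apply/negP; rewrite -ltNge -[ltLHS](nth_index 0 ir).
  by rewrite nth_rows_lt.
have n0 : (0 < size ell)%N by move: ir; rewrite mem_rows => /andP[_]; case: (ell).
rewrite /insert_col size_bottom_one_col ?mE // -mE.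
set p := count _ (iota _ _).
have pE : p = count (fun y => x < y) (cols E ell).
  rewrite /p ncols_raw // -[X in count _ X = _]map_id.
  rewrite -[in RHS](mkseq_nth 0 (cols E ell)) /mkseq !count_map.
  apply: eq_in_count => d; rewrite mem_iota => /= hd.
  rewrite col_len_raw //; have [_ hy cy] := nth_cols_mem hd; set y := nth _ _ _ in hy cy *.
  have [xy|yx] := ltP x y.
    by apply: sub_count => k /= kx; apply: lt_trans xy.
  apply/negbTE; rewrite -ltnNge.
  have yi : y < i.
    rewrite lt_neqAle; apply/andP; split; first by apply: contraTneq cy => ->.
    apply: (consecutive_gt c); first exact: sub.
    by rewrite lt_neqAle yx andbT; apply: contraNneq nx => <-.
  apply: (count_lt ir) => //=; first by rewrite -leNgt ltW.
  by move=> k /= /lt_le_trans; apply.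
have [e1 e2] := cols_filter_gt E x s; rewrite -pE in e1 e2.
have {}e2 : drop p (cols E ell) = [seq y <- cols E ell | y < x].
  rewrite -e2; apply: eq_in_filter => y hy; rewrite -leNgt le_eqVlt.
  by case: eqP => // yx; rewrite -yx hy in nxc.
rewrite /raw rE cE [in RHS]/rows -/(rows E ell).
rewrite -[in RHS](mkseq_nth 0 (rows E ell)) /mkseq -map_comp.
rewrite nrows_raw; apply/eq_in_map => r; rewrite mem_iota => /= hr.
rewrite row_at_raw // lm //; set k := nth _ _ _.
have [_ hk ck] := nth_rows_mem hr; rewrite -/k in hk ck.
have [kx|xk] := ltP k x; last first.
  have {}xk : x < k.
    by rewrite lt_neqAle xk andbT; apply: contraNneq nx => ->.
  rewrite filter_cat /= (lt_gtF xk) -filter_cat.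
  have -> : [seq y <- cols E ell | x < y] ++ [seq y <- cols E ell | y < x] = cols E ell.
    by rewrite e1 -e2 cat_take_drop.
  apply/eq_in_map => y; rewrite mem_filter => /andP[ky _]; rewrite eE //.
  by rewrite gt_eqF // (lt_trans xk).
have e3 : [seq y <- cols E ell | k < y]
    = [seq y <- cols E ell | x < y] ++ [seq y <- cols E ell | k < y < x].
  rewrite -{1}(cat_take_drop p (cols E ell)) filter_cat -e1 e2 -!filter_predI.
  congr (_ ++ _); apply: eq_filter => y /=; apply: andb_idl.
  by apply: lt_trans.
rewrite e3 map_cat take_size_cat ?drop_size_cat ?size_map ?size_filter -?pE //.
rewrite filter_cat /= kx map_cat /= eEx -!filter_predI nth_bottom_one_col ?lm // mE eqSS.
congr (_ ++ _ :: _).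
- rewrite [in RHS](eq_filter (a2 := fun y => x < y)) => [|y /=]; last first.
    by apply: andb_idl; apply: lt_trans.
  by apply/eq_in_map => y; rewrite mem_filter => /andP[xy _]; rewrite eE // gt_eqF.
- apply/eqP/eqP => [rE'|ki]; first by rewrite -(nth_index 0 ir) -rE'.
  by rewrite -ki index_uniq //; apply/asc_uniq/rows_asc.
by apply/eq_in_map => y; rewrite mem_filter => /andP[/andP[_ yx] _]; rewrite eE // lt_eqF.
Qed.

(** Exchanging the labels moves neither the rows nor the columns among
    themselves. *)
Lemma transp_row_col E ell i j : asc ell -> tableau_rel ell E -> consecutive ell i j ->
  is_col E ell i -> ~~ is_col E ell j ->
  rows (add_box i j E) ell = map (transp i j) (rows E ell) /\
  cols (add_box i j E) ell = map (transp i j) (cols E ell).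
Proof.
move=> s t c ci cj; have [hi hj ij _] := c.
have [k0 ki] := elimT (is_colP _ t) ci.
have Ni k : ~~ E i k by apply/negP => /(rel_bip t ki).
have Nj := elimT (is_colPn _ t) cj.
have t' := add_box_rel t c Ni Nj.
have colE y : y \in ell -> is_col (add_box i j E) ell y = is_col E ell (transp i j y).
  move=> hy; apply/(is_colP _ t')/(is_colP _ t) => -[k].
    move=> /add_oneP[h|[_ ->]]; first by exists (transp i j k).
    by rewrite transpR; exists k0.
  by move=> h; exists (transp i j k); apply/add_oneP; left; rewrite /relabel transpK.
split.
  apply: rows_eq => //.
  - rewrite /asc sorted_map; apply: (sub_in_sorted _ (allss _) (rows_asc E s)) => x y.
    rewrite !mem_rows => /andP[cx hx] /andP[cy hy] xy /=; apply: (transp_lt c) => //.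
    by apply/negP => /andP[/eqP xi _]; move: cx; rewrite xi ci.
  - move=> y hy; rewrite colE // -[y in y \in _](transpK i j) mem_map ?mem_rows;
      last exact: transp_inj.
    by rewrite transp_mem // andbT.
  - by move=> _ /mapP[y + ->]; rewrite mem_rows => /andP[_]; apply: transp_mem.
apply: cols_eq => //.
- rewrite sorted_map; apply: (sub_in_sorted _ (allss _) (cols_desc E s)) => x y.
  rewrite !mem_cols => /andP[cx hx] /andP[cy hy] xy /=; apply: (transp_lt c) => //.
  by apply/negP => /andP[_ /eqP yj]; move: cx; rewrite yj (negbTE cj).
- move=> y hy; rewrite colE // -[y in y \in _](transpK i j) mem_map ?mem_cols;
    last exact: transp_inj.
  by rewrite transp_mem // andbT.
- by move=> _ /mapP[y + ->]; rewrite mem_cols => /andP[_]; apply: transp_mem.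
Qed.

Lemma add_box_raw E ell i j : asc ell -> tableau_rel ell E -> consecutive ell i j ->
  is_col E ell i -> ~~ is_col E ell j ->
  set_nth [::] (raw E ell) (index j (rows E ell))
      (rcons (row_at (raw E ell) (index j (rows E ell))) true)
    = raw (add_box i j E) ell.
Proof.
move=> s t c ci cj; have [hi hj ij _] := c.
have [rE cE] := transp_row_col s t c ci cj.
have jr : j \in rows E ell by rewrite mem_rows cj.
have hr : (index j (rows E ell) < size (rows E ell))%N by rewrite index_mem.
apply: (@eq_from_nth _ [::]).
  by rewrite size_set_nth !size_map rE size_map; apply/maxn_idPr.
move=> r; rewrite size_set_nth size_map (maxn_idPr hr) => h.
rewrite nth_set_nth /= -/(row_at _ r) -/(row_at _ r).
rewrite [row_at (raw (add_box _ _ _) _) _]row_at_raw ?rE ?size_map // (nth_map 0) // cE.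
set k := nth _ _ r; have [_ hk ck] := nth_rows_mem h; rewrite -/k in hk ck.
rewrite filter_map -map_comp.
have -> : (r == index j (rows E ell)) = (k == j).
  apply/eqP/eqP => [re|kj]; first by rewrite /k re nth_index.
  by rewrite -kj index_uniq //; apply/asc_uniq/rows_asc.
have [kj|kj] := eqVneq k j.
  rewrite row_at_raw // nth_index //.
  have -> : [seq y <- cols E ell | preim (transp i j) (fun y => transp i j k < y) y]
      = rcons [seq y <- cols E ell | j < y] i.
    apply: (irr_sorted_eq gt_trans_rat ltxx).
    - by apply: (sorted_filter gt_trans_rat); apply: cols_desc.
    - rewrite (sorted_pairwise gt_trans_rat) pairwise_rcons -(sorted_pairwise gt_trans_rat).
      rewrite (sorted_filter gt_trans_rat _ (cols_desc E s)) andbT.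
      by apply/allP => y; rewrite mem_filter => /andP[jy _] /=; apply: lt_trans jy.
    move=> y; rewrite mem_rcons inE !mem_filter mem_cols kj transpR /=.
    have [->|yi] := eqVneq y i; first by rewrite transpL ij ci hi.
    case: (boolP (is_col E ell y && (y \in ell))) => [/andP[cy hy]|]; last by rewrite !andbF.
    have yj : y != j by apply: contraNneq cj => <-.
    rewrite transpD // !andbT; apply/idP/idP => [iy|]; last exact: lt_trans.
    by rewrite lt_neqAle eq_sym yj (consecutive_lt c).
  rewrite map_rcons /= kj transpR transpL; congr rcons; last first.
    by apply/esym/add_oneP; right.
  apply/eq_in_map => y; rewrite mem_filter => /andP[jy _] /=.
  have yi : y != i by rewrite gt_eqF // (lt_trans ij).
  have yj : y != j by rewrite gt_eqF.
  by rewrite /add_box /add_one /relabel transpK transpL transpD // (negbTE yj) andbF orbF.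
rewrite row_at_raw // -/k.
have kni : k != i by apply: contraNneq ck => ->.
rewrite [in RHS](eq_in_filter (a2 := fun y => k < y)); last first.
  move=> y; rewrite mem_cols => /andP[cy hy] /=; apply/idP/idP => l; last first.
    by apply: (transp_lt c) => //; rewrite (negbTE kni).
  rewrite -(transpK i j k) -[ltRHS](transpK i j y).
  apply: (transp_lt c) => //; try exact: transp_mem.
  by rewrite transpD // (negbTE kni).
apply/eq_map => y /=; rewrite /add_box /add_one /relabel !transpK.
by rewrite transpD // (negbTE kni) orbF.
Qed.

Lemma remove_box_raw E ell i j : asc ell -> tableau_rel ell E -> consecutive ell i j ->
  E i j -> is_col (remove_box i j E) ell i ->
  let r := index i (rows E ell) in
  set_nth [::] (raw E ell) r (take (row_len (raw E ell) r).-1 (row_at (raw E ell) r))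
    = raw (remove_box i j E) ell.
Proof.
move=> s t c ij ci r; have [hi hj _ _] := c.
have tD := remove_box_rel t c ij; set D := remove_box i j E in ci tD *.
have cj : ~~ is_col D ell j by apply/(is_colPn _ tD) => k; apply: (remove_box_col k t ij).
have eE := remove_boxK ij; rewrite -/D in eE.
have [rE _] := transp_row_col s tD c ci cj.
have jr : j \in rows D ell by rewrite mem_rows cj.
have rD : r = index j (rows D ell).
  have : rows (add_box i j D) ell = rows E ell.
    by apply: eq_filter => y; congr (~~ _); apply: eq_has => k; rewrite /= eE.
  rewrite /r rE => <-; rewrite -[X in index X](transpR i j) index_map //.
  exact: transp_inj.
have := add_box_raw s tD c ci cj; rewrite (eq_raw _ eE) -rD => <-.
rewrite /row_len /row_at nth_set_nth /= eqxx size_rcons /= -cats1 take_size_cat //.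
have hr : (r < size (raw D ell))%N by rewrite size_map rD index_mem.
apply: (@eq_from_nth _ [::]).
  by rewrite !size_set_nth (maxn_idPr hr); apply/maxn_idPr.
move=> r' _; rewrite !nth_set_nth /= nth_set_nth /=; case: eqP => // ->.
by [].
Qed.

(** * Moves *)

Lemma index_cols E ell j : asc ell -> j \in cols E ell ->
  index j (cols E ell) = count (fun y => j < y) (cols E ell).
Proof.
move=> s jc; have hc : (index j (cols E ell) < size (cols E ell))%N by rewrite index_mem.
apply/eqP; rewrite eqn_leq andbC; apply/andP; split.
  by rewrite leqNgt count_cols_gt // nth_index // ltxx.
rewrite leqNgt; apply/negP => h; set m := count _ _ in h *.
have hm := ltn_trans h hc.
by have := count_cols_gt j s hm; rewrite ltnn -[X in X < _](nth_index 0 jc) nth_cols_lt // h.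
Qed.

Lemma index_rows E ell i : asc ell -> i \in rows E ell ->
  index i (rows E ell) = count (fun y => y < i) (rows E ell).
Proof.
move=> s ir; have hr : (index i (rows E ell) < size (rows E ell))%N by rewrite index_mem.
apply/eqP; rewrite eqn_leq andbC; apply/andP; split.
  by rewrite leqNgt lt_count_rows // nth_index // ltxx.
rewrite leqNgt; apply/negP => h; set m := count _ _ in h *.
have hm := ltn_trans h hr.
by have := lt_count_rows i s hm; rewrite ltnn -[X in _ < X](nth_index 0 ir) nth_rows_lt // h.
Qed.

Lemma lt_half k n : (Defs.half k < n%:R) = (k < n)%N.
Proof.
rewrite /Defs.half; case: leqP => h.
  apply/negbTE; rewrite -leNgt; apply: le_trans (_ : k%:R <= _); first by rewrite ler_nat.
  by rewrite lerDl invr_ge0.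
apply: lt_le_trans (_ : k.+1%:R <= _); last by rewrite ler_nat.
by rewrite -(natr1 k) ltrD2l invf_lt1 // ltr1n.
Qed.

Lemma half_lt k n : (n%:R < Defs.half k) = (n <= k)%N.
Proof.
rewrite /Defs.half; case: leqP => h.
  apply: le_lt_trans (_ : _ <= k%:R) _; first by rewrite ler_nat.
  by rewrite ltrDl invr_gt0.
apply/negbTE; rewrite -leNgt; apply: le_trans (_ : _ <= k.+1%:R) _; last by rewrite ler_nat.
by rewrite -(natr1 k) lerD2l invf_le1 // ler1n.
Qed.

Lemma half_std N k : Defs.half k \notin std_labels N.
Proof.
apply/std_labelsP => -[n _ e]; have := half_lt k n.+1; rewrite e ltxx.
by move/esym/negbT; rewrite -ltnNge -lt_half e ltxx.
Qed.

Lemma std_nat N x : x \in std_labels N -> exists2 n, (0 < n <= N.+1)%N & x = n%:R.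
Proof. by move=> /std_labelsP[k h ->]; exists k.+1. Qed.

Lemma consecutive_std N i : (0 < i <= N)%N -> consecutive (std_labels N) i%:R i.+1%:R.
Proof.
move=> /andP[i0 iN]; split; rewrite ?mem_std_labels ?i0 ?ltnS ?(leq_trans iN) //.
  by rewrite ltr_nat.
by move=> _ /std_labelsP[k _ ->]; rewrite !ler_nat -ltnS orbC leqNgt orbC orbN.
Qed.

(** The permutation of a filling, as a function; unlike [Phi] it does not ask for
    a proof that the filling is a tableau. *)
Definition Phi_ffun N (s : raw_tableau) : {ffun 'I_N.+1 -> 'I_N.+1} :=
  [ffun k : 'I_N.+1 => Phi_fun s k].

(** Agreement of the result [s] of a move on tableaux with the result [sigma] of a
    move on permutations. *)
Definition corresponds N (s : raw_tableau) (sigma : set_perm) : Prop :=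
  is_tableau N.+1 s /\ Norm N sigma = Phi_ffun N s.

(** The invariant that is followed through the intermediate steps of a move, in
    which a label may be missing or a half-integer. *)
Definition represents ell E (sigma : set_perm) : Prop :=
  [/\ asc ell, tableau_rel ell E, perm_eq (Defs.support sigma) ell &
      {in ell, sigma =1 path_perm E ell}].

Lemma represents_corresponds N ell E sigma : size ell = N.+1 ->
  represents ell E sigma -> corresponds N (raw E ell) sigma.
Proof.
move=> sz [s t pe e]; split; last exact: Norm_raw.
by rewrite -sz; apply: raw_is_tableau; rewrite ?sz.
Qed.

Definition insert_label (x : rat) ell : seq rat := sort <=%R (x :: ell).

Lemma insert_label_asc x ell : asc ell -> x \notin ell -> asc (insert_label x ell).
Proof. by move=> s nx; rewrite /asc sort_lt_sorted /= nx asc_uniq. Qed.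

Lemma mem_insert_label x ell : insert_label x ell =i x :: ell.
Proof. exact: mem_sort. Qed.

(** Here [nx] is the label of the next column, or exceeds all labels; the new row
    comes just before it. *)
Lemma insert_zero_row_represents N ell E sigma nx :
  {subset ell <= std_labels N} -> represents ell E sigma -> (0 < nx)%N ->
  ((nx <= N.+1)%N -> nx%:R \in cols E ell) ->
  represents (insert_label (Defs.half nx.-1) ell) E (add_fixpoint sigma (Defs.half nx.-1)) /\
  raw E (insert_label (Defs.half nx.-1) ell)
    = insert_zero_row (raw E ell) (count (fun j => Defs.half nx.-1 < j) (cols E ell)).
Proof.
move=> sub [s t pe e] nx0 hnx; set x := Defs.half nx.-1.
have nxl : x \notin ell by apply/negP => /sub; apply/negP/half_std.
have s' := insert_label_asc s nxl.
have t' : tableau_rel (insert_label x ell) E.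
  by apply: (tableau_rel_sub t) => i j /(rel_dom t)[]; rewrite !mem_insert_label !inE => -> ->;
    rewrite !orbT.
split.
  split=> //; first by rewrite /= perm_sym perm_sort perm_sym perm_cons.
  move=> y; rewrite mem_insert_label inE /=; have [->|yx /= hy] := eqVneq y x => //=.
    by move=> _; rewrite path_perm_id // => k; apply: contra nxl => /(rel_dom t)[].
  by rewrite e // (path_perm_supp _ s' s).
apply/esym/insert_zero_row_raw => //; first exact: mem_insert_label.
move=> i; rewrite mem_rows => /andP[ci hi]; have hi' := sub _ hi.
have [n /andP[_ nN] en] := std_nat hi'; rewrite en lt_half prednK // => h.
have /hnx jc : (nx <= N.+1)%N by apply: leq_trans h nN.
exists nx%:R => //; rewrite lt_half prednK // leqnn ltr_nat ltn_neqAle h andbT.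
apply: contra ci => /eqP ei; move: jc; rewrite mem_cols ei -en.
by case/andP.
Qed.

Lemma insert_col_represents N ell E sigma a :
  {subset ell <= std_labels N} -> represents ell E sigma ->
  a%:R \in rows E ell ->
  represents (insert_label (Defs.half a) ell) (add_one E a%:R (Defs.half a))
    (insert_before sigma a%:R (Defs.half a)) /\
  raw (add_one E a%:R (Defs.half a)) (insert_label (Defs.half a) ell)
    = insert_col (raw E ell) (bottom_one_col (count (fun k => k < Defs.half a) (rows E ell))).
Proof.
move=> sub [s t pe e] ar; set x := Defs.half a.
have nxl : x \notin ell by apply/negP => /sub; apply/negP/half_std.
have s' := insert_label_asc s nxl; have me := mem_insert_label x ell.
have sub' : {subset ell <= insert_label x ell} by move=> y hy; rewrite me inE hy orbT.
have [ca ha] : ~~ is_col E ell a%:R /\ a%:R \in ell by apply/andP; rewrite -mem_rows.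
have c : consecutive (insert_label x ell) a%:R x.
  split; [exact: sub'|by rewrite me mem_head|by rewrite half_lt|].
  move=> y; rewrite me inE => /predU1P[->|/sub/std_nat[n _ ->]]; first by rewrite lexx orbT.
  rewrite ler_nat; case: leqP => //= h; rewrite le_eqVlt.
  by rewrite lt_half h orbT.
have Na := elimT (is_colPn _ t) ca.
split; last exact/esym/insert_col_raw.
split=> //; first exact: (add_col_rel t).
  by rewrite /= perm_sym perm_sort perm_sym perm_cons.
move=> y; rewrite me inE (path_perm_add_col _ s s' t sub' nxl c Na) /=.
have [->|yx /= hy] := eqVneq y x => //=.
  by rewrite path_perm_id ?transpR // => k; apply: contra nxl => /(rel_dom t)[].
rewrite e // /transp; case: eqP => // _; case: eqP => // zx.
by case/negP: nxl; rewrite -zx path_perm_mem.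
Qed.

Lemma del_row_represents ell E sigma x : represents ell E sigma ->
  x \in ell -> (forall k, ~~ E k x) -> (forall k, ~~ E x k) ->
  represents (filter (predC1 x) ell) E (del_fixpoint sigma x) /\
  raw E (filter (predC1 x) ell) = del_row (raw E ell) (index x (rows E ell)).
Proof.
move=> [s t pe e] hx N1 N2; have s' := asc_filter (predC1 x) s.
have t' : tableau_rel (filter (predC1 x) ell) E.
  apply: (tableau_rel_sub t) => i j ij; have [hi hj _] := rel_dom t ij.
  rewrite !mem_filter hi hj !andbT /=; split; apply/eqP => h.
    by case/negP: (N2 j); rewrite -h.
  by case/negP: (N1 i); rewrite -h.
split; last exact/esym/del_row_raw.
split=> //.
  by rewrite /= rem_filter ?(perm_uniq pe) ?asc_uniq // perm_filter.
by move=> y; rewrite mem_filter => /andP[_ hy] /=; rewrite e // (path_perm_supp _ s s').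
Qed.

Lemma del_col_represents ell E sigma i j : represents ell E sigma ->
  consecutive ell i j -> E i j -> (forall k, E k j -> k = i) ->
  represents (filter (predC1 j) ell) (del_one E i j) (collapse sigma j) /\
  raw (del_one E i j) (filter (predC1 j) ell)
    = del_col (raw E ell) (index j (cols E ell)).
Proof.
move=> [s t pe e] c ij Ej; split; last exact/esym/del_col_raw.
have [hi hj _] := rel_dom t ij.
split; [exact: asc_filter|exact: del_col_rel| |].
  by rewrite /= rem_filter ?(perm_uniq pe) ?asc_uniq // perm_filter.
move=> y; rewrite mem_filter => /andP[/= yj hy].
apply: (@transp_inj _ i j); rewrite -path_perm_del_col // !e //.
rewrite (corner_necessary s t c ij Ej) -[in RHS](transpK i j (path_perm E ell y)).
congr transp; rewrite /transp.
have ne : path_perm E ell y != i.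
  by rewrite -{1}(corner_necessary s t c ij Ej) (inj_eq (@path_perm_inj _ _)).
by rewrite (negbTE ne).
Qed.

Lemma add_box_represents ell E sigma i j : represents ell E sigma ->
  consecutive ell i j -> is_col E ell i -> ~~ is_col E ell j ->
  represents ell (add_box i j E) (swap_values sigma i j).
Proof.
move=> [s t pe e] c ci cj; have [hi hj ij _] := c.
have [k0 ki] := elimT (is_colP _ t) ci.
have Ni k : ~~ E i k by apply/negP => /(rel_bip t ki).
have Nj := elimT (is_colPn _ t) cj.
split=> // [|y hy]; first exact: add_box_rel.
rewrite path_perm_add_box // /transp /=; case: eqP => [_|_]; first by rewrite e.
by case: eqP => _; rewrite e.
Qed.

Lemma remove_box_represents ell E sigma i j : represents ell E sigma ->
  consecutive ell i j -> E i j ->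
  represents ell (remove_box i j E) (swap_values sigma i j).
Proof.
move=> [s t pe e] c ij; have [hi hj _ _] := c.
split=> // [|y hy]; first exact: remove_box_rel.
rewrite path_perm_remove_box // /transp /=; case: eqP => [_|_]; first by rewrite e.
by case: eqP => _; rewrite e.
Qed.

Lemma next_non_excedanceP N p m : (m <= N.+1)%N ->
  let nx := next_non_excedance N p m in
  [/\ (m < nx)%N, (nx <= N.+1)%N -> non_excedance p nx &
      forall k, (m < k < nx)%N -> (k <= N.+1)%N -> ~~ non_excedance p k].
Proof.
move=> hm; rewrite /next_non_excedance.
have := ohead_iotaP (non_excedance p) m.+1 (N.+1 - m).
case: (filter _ _) => [|nx l] /=.
  rewrite addSn subnKC // => h; split; [by rewrite ltnS (leq_trans hm)|by rewrite ltnn|].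
  by move=> k /andP[mk _] kN; apply: h; rewrite mk ltnS.
by move=> [h /andP[mn _] h']; split=> // k + _; apply: h'.
Qed.

Lemma prev_weak_excedanceP p m : (1 < m)%N -> weak_excedance p 1 ->
  let a := prev_weak_excedance p m in
  [/\ (0 < a < m)%N, weak_excedance p a &
      forall k, (a < k < m)%N -> ~~ weak_excedance p k].
Proof.
move=> hm w1; rewrite /prev_weak_excedance; set F := filter _ _.
have F1 : 1%N \in F by rewrite mem_filter w1 mem_iota /= add1n prednK // ltnW.
have sF : sorted ltn F by apply: (sorted_filter ltn_trans); apply: iota_ltn_sorted.
have inF k : k \in F -> (0 < k < m)%N /\ weak_excedance p k.
  by rewrite mem_filter mem_iota add1n prednK ?(ltnW hm) // => /andP[].
have [h w] : (0 < last 1%N F < m)%N /\ weak_excedance p (last 1%N F).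
  by apply: inF; have := mem_last 1%N F; rewrite inE => /predU1P[->|].
split=> // k /andP[ak km]; apply/negP => wk.
have : k \in F.
  by rewrite mem_filter wk mem_iota add1n prednK ?(ltnW hm) // km (leq_ltn_trans _ ak).
case: (lastP F) sF ak => [|G b] //; rewrite last_rcons (sorted_pairwise ltn_trans).
rewrite pairwise_rcons => /andP[/allP aG _] bk; rewrite mem_rcons inE => /predU1P[kb|/aG /= kb].
  by rewrite kb ltnn in bk.
by have := ltn_trans bk kb; rewrite ltnn.
Qed.

Lemma fun_at_std N E k : tableau_rel (std_labels N) E -> (0 < k <= N.+1)%N ->
  (fun_at (Phi_ffun N (raw E (std_labels N))) k)%:R = path_perm E (std_labels N) k%:R.
Proof.
move=> t /andP[k0 kN]; have s := std_labels_asc N; have sz := size_std_labels N.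
rewrite /fun_at /Phi_ffun Phi_raw // ffunE.
have -> : nth 0 (std_labels N) (inord k.-1 : 'I_N.+1) = k%:R.
  by rewrite inordK ?nth_std_labels prednK.
have hk : (k%:R : rat) \in std_labels N by rewrite mem_std_labels k0.
have /std_labelsP[k' hk' e] := path_perm_mem E hk.
rewrite e -(nth_std_labels hk') index_uniq ?sz ?asc_uniq // inordK //.
by rewrite nth_std_labels.
Qed.

Lemma std_represents N E : tableau_rel (std_labels N) E ->
  represents (std_labels N) E (to_set_perm N (fun_at (Phi_ffun N (raw E (std_labels N))))).
Proof.
move=> t; split; [exact: std_labels_asc|by []|exact: perm_refl|].
by move=> _ /std_nat[n hn ->] /=; rewrite natrK fun_at_std.
Qed.

Lemma non_excedance_std N E k : tableau_rel (std_labels N) E -> (0 < k <= N.+1)%N ->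
  non_excedance (fun_at (Phi_ffun N (raw E (std_labels N)))) k
    = is_col E (std_labels N) k%:R.
Proof.
move=> t hk; rewrite (is_col_lt _ (std_labels_asc N) t) -fun_at_std //.
by rewrite ltr_nat.
Qed.

Lemma weak_excedance_std N E k : tableau_rel (std_labels N) E -> (0 < k <= N.+1)%N ->
  weak_excedance (fun_at (Phi_ffun N (raw E (std_labels N)))) k
    = ~~ is_col E (std_labels N) k%:R.
Proof. by move=> t hk; rewrite -non_excedance_std // /non_excedance -leqNgt. Qed.

Lemma first_row N E : tableau_rel (std_labels N) E -> ~~ is_col E (std_labels N) 1.
Proof.
move=> t; have := @head_row E (std_labels N) 1 (std_labels_asc N) t.
by apply; rewrite (mem_std_labels N 1).
Qed.

Lemma row_len_corner E ell i j : asc ell -> consecutive ell i j ->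
  i \in rows E ell -> j \in cols E ell ->
  row_len (raw E ell) (index i (rows E ell)) = (index j (cols E ell)).+1.
Proof.
move=> s c ir jc; have [_ _ ij _] := c.
apply/eqP; rewrite eqn_leq andbC lt_row_len_raw // !index_mem ir jc !nth_index // ij /=.
rewrite leqNgt lt_row_len_raw // nth_index //; apply/and3P => -[_ h ijc].
have [_ hc _] := nth_cols_mem h; have := consecutive_lt c hc ijc.
by rewrite -{1}(nth_index 0 jc) leNgt nth_cols_lt ?index_mem // ltnS leqnn.
Qed.

Lemma corner_raw N E i : tableau_rel (std_labels N) E ->
  i%:R \in rows E (std_labels N) ->
  corner (raw E (std_labels N)) (index i%:R (rows E (std_labels N)))
    = (i <= N)%N && is_col E (std_labels N) i.+1%:R.
Proof.
move=> t ir; have s := std_labels_asc N; set ell := std_labels N in t ir s *.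
have [ci hi] : ~~ is_col E ell i%:R /\ i%:R \in ell by apply/andP; rewrite -mem_rows.
have hr : (index i%:R (rows E ell) < size (rows E ell))%N by rewrite index_mem.
have i0 : (0 < i)%N by move: hi; rewrite mem_std_labels => /andP[].
apply/idP/andP => [h|[iN cj]].
  move: h; rewrite /corner lt_row_len_raw // nth_index // => /and3P[_ hc].
  set c := row_len _ _ in hc *; set y := nth _ _ _ => iy.
  have [_ hy cy] := nth_cols_mem hc; rewrite -/y in hy cy.
  have [n /andP[_ nN] yn] := std_nat hy; move: iy; rewrite yn ltr_nat => iy.
  have iN : (i <= N)%N by rewrite -ltnS; apply: leq_trans nN.
  split=> //; apply/negPn/negP => cj.
  have jr : i.+1%:R \in rows E ell by rewrite mem_rows cj mem_std_labels.
  have hr' : ((index i%:R (rows E ell)).+1 <= index i.+1%:R (rows E ell))%N.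
    by rewrite -(nth_rows_lt (E := E) s) ?index_mem // !nth_index // ltr_nat.
  have : ~~ (c < c)%N by rewrite ltnn.
  rewrite {2}/c lt_row_len_raw // hc (leq_ltn_trans hr') ?index_mem //= => /negP; apply.
  apply: le_lt_trans (_ : _ <= i.+1%:R) _.
    rewrite -[leRHS](nth_index 0 jr) leNgt nth_rows_lt ?index_mem -?leqNgt //.
    by rewrite (leq_ltn_trans hr') ?index_mem.
  rewrite -/y yn ltr_nat ltn_neqAle iy andbT; apply: contra cj => /eqP->.
  by rewrite -yn.
have jc : i.+1%:R \in cols E ell by rewrite mem_cols cj mem_std_labels.
have c : consecutive ell i%:R i.+1%:R by apply: consecutive_std; rewrite i0.
rewrite /corner (row_len_corner s c ir jc) ltnS leqNgt lt_row_len_raw // nth_index //.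
apply/and3P => -[h _]; have [_ hk _] := nth_rows_mem h => kj.
have := consecutive_gt c hk kj; rewrite -[leRHS](nth_index 0 ir) leNgt.
by rewrite nth_rows_lt // ltnS leqnn.
Qed.

Lemma size_move_label N x y : x \in std_labels N ->
  size (insert_label y (filter (predC1 x) (std_labels N))) = N.+1.
Proof.
move=> hx; have u := asc_uniq (std_labels_asc N).
have h : size (filter (predC1 x) (std_labels N)) = N.
  by rewrite -(rem_filter _ u) size_rem // size_std_labels.
by rewrite size_sort /= h.
Qed.

Lemma filter_sub (a : pred rat) ell : {subset filter a ell <= ell}.
Proof. by move=> y; rewrite mem_filter => /andP[]. Qed.

Lemma hop_right_corresponds N E i : tableau_rel (std_labels N) E -> (1 < i <= N)%N ->
  ~~ is_col E (std_labels N) i%:R -> is_col E (std_labels N) i.+1%:R ->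
  corresponds N
    (hop_right_at (raw E (std_labels N)) (index i%:R (rows E (std_labels N))))
    (perm_hop_right_at N (fun_at (Phi_ffun N (raw E (std_labels N)))) i).
Proof.
move=> t /andP[i1 iN] ci cj; have s := std_labels_asc N; have R := std_represents t.
have hp k := @fun_at_std N E k t.
have np k := @non_excedance_std N E k t; have wp k := @weak_excedance_std N E k t.
move: R hp np wp; set p := fun_at _; set ell := std_labels N in t ci cj s * => R hp np wp.
have i0 : (0 < i)%N by apply: ltnW.
have c : consecutive ell i%:R i.+1%:R by apply: consecutive_std; rewrite i0.
have [hi hj ij _] := c; set j : rat := i.+1%:R in cj c hj ij *.
have Ni := elimT (is_colPn _ t) ci; have [k kj] := elimT (is_colP _ t) cj.
have ir : i%:R \in rows E ell by rewrite mem_rows ci.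
have jc : j \in cols E ell by rewrite mem_cols cj.
set r := index i%:R (rows E ell).
have hr : (r < size (rows E ell))%N by rewrite index_mem.
have rl : (row_len (raw E ell) r).-1 = index j (cols E ell) by rewrite (row_len_corner s c ir jc).
have entE r' : entry (raw E ell) r' (index j (cols E ell))
    = (r' < size (rows E ell))%N && E (nth 0 (rows E ell) r') j.
  by rewrite entry_raw // index_mem jc nth_index.
have pi : (p i == i) = ~~ E i%:R j.
  rewrite -(corner_eq_row s t c Ni cj) -hp ?eqr_nat // i0; exact: leqW.
rewrite /hop_right_at /perm_hop_right_at rl entE hr nth_index // pi.
have [Eij|nij] /= := boolP (E i%:R j).
  have lt_i : (p i.+1 < i)%N = (path_perm E ell j < i%:R) by rewrite -hp ?ltr_nat // ltnS.
  have lij := corner_lt_row s t c Eij.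
  have aboveE : one_above (raw E ell) r (index j (cols E ell))
      = has (fun k => E k j && (k != i%:R)) ell.
    apply/hasP/hasP => [[r' ]|[k' _ /andP[kj' ki]]].
      rewrite mem_iota add0n /= entE => r'r /andP[hr' e].
      exists (nth 0 (rows E ell) r'); first by have [] := rel_dom t e.
      by rewrite e -[X in _ != X](nth_index 0 ir) nth_uniq ?(asc_uniq (rows_asc E s)) // ltn_eqF.
    have [k'r _ e] := entry_raw_index s t kj'.
    exists (index k' (rows E ell)); last by rewrite entE index_mem k'r nth_index.
    rewrite mem_iota add0n -(nth_rows_lt (E := E) s) ?index_mem // !nth_index //=.
    have [hk' _ lk'] := rel_dom t kj'.
    by rewrite lt_neqAle ki (consecutive_gt c).
  rewrite aboveE -lij -lt_i; case: ifP => lt.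
    have [k' _ /andP[k'j ki]] : exists2 k, k \in ell & E k j && (k != i%:R).
      by apply/hasP; rewrite -lij -lt_i.
    have tD := remove_box_rel t c Eij.
    have di : is_col (remove_box i%:R j E) ell i%:R.
      by apply/(is_colP _ tD); exists k'; apply: (remove_box_above t Eij).
    have /= := remove_box_raw s t c Eij di; rewrite -/r rl => ->.
    by apply: represents_corresponds; [exact: size_std_labels|exact: remove_box_represents].
  (* necessary 1: the new column comes just after the row above row [i] *)
  have Ej k' : E k' j -> k' = i%:R.
    move=> k'j; have [hk' _ _] := rel_dom t k'j; apply/eqP/negPn/negP => ki.
    by move/negbT: lt; rewrite lt_i lij => /hasPn/(_ _ hk'); rewrite k'j ki.
  have [R1 e1] := del_col_represents R c Eij Ej.
  have w1 : weak_excedance p 1 by rewrite wp // (first_row t).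
  have [/andP[a0 ai] wa amax] := prev_weak_excedanceP i1 w1.
  set a := prev_weak_excedance p i in a0 ai wa amax *.
  have aN : (a <= N.+1)%N by apply: leq_trans (ltnW ai) _; apply: leqW.
  have r1 : rows (del_one E i%:R j) (filter (predC1 j) ell) = rows E ell.
    exact: rows_del_one.
  have ar : a%:R \in rows (del_one E i%:R j) (filter (predC1 j) ell).
    by rewrite r1 mem_rows mem_std_labels a0 aN -wp ?wa // a0.
  have [R2 e2] := insert_col_represents (@filter_sub _ ell) R1 ar.
  have cnt : count (fun k => k < Defs.half a) (rows (del_one E i%:R j) (filter (predC1 j) ell)) = r.
    rewrite r1 /r index_rows //; apply: eq_in_count => y.
    rewrite mem_rows => /andP[cy hy]; move: cy.
    have [n hn ->] := std_nat hy; rewrite -wp // half_lt ltr_nat => wn.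
    apply/idP/idP => [na|ni]; first exact: leq_ltn_trans ai.
    rewrite leqNgt; apply/negP => an; have := amax n; rewrite an ni => /(_ isT).
    by rewrite wn.
  move: e2; rewrite cnt e1 => <-.
  by apply: represents_corresponds; [exact: size_move_label|].
(* empty row: shortened by the column [i + 1], it moves down to the next column *)
have N2 := corner_zero t c Ni kj nij.
have [R1 e1] := del_row_represents R hi Ni N2.
have := @next_non_excedanceP N p i.+1; rewrite ltnS => /(_ iN)[m1 m2 m3].
set nx := next_non_excedance N p i.+1 in m1 m2 m3 *.
have nx0 : (0 < nx)%N by apply: leq_trans m1.
have [s1 t1 _ _] := R1.
have c1 := cols_ell s1 s t1 t.
have [|R2 e2] := @insert_zero_row_represents N _ _ _ nx (@filter_sub _ ell) R1 nx0.
  by move=> h; rewrite c1 mem_cols mem_std_labels nx0 h -np ?m2 // nx0.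
have cnt : count (fun j => Defs.half nx.-1 < j) (cols E (filter (predC1 i%:R) ell))
    = index j (cols E ell).
  rewrite c1 index_cols //; apply: eq_in_count => y.
  rewrite mem_cols => /andP[cy hy]; move: cy.
  have [n hn ->] := std_nat hy; rewrite -np // lt_half prednK // ltr_nat => wn.
  apply/idP/idP => [|jn]; first exact: leq_trans.
  rewrite leqNgt; apply/negP => an; have := m3 n; rewrite an jn => /(_ isT).
  by case/andP: hn => _ -> /(_ isT); rewrite wn.
move: e2; rewrite cnt e1 => <-.
by apply: represents_corresponds; [exact: size_move_label|].
Qed.

Definition all_correspond N (l : seq raw_tableau) (l' : seq set_perm) : Prop :=
  all (is_tableau N.+1) l /\ map (@Norm N) l' = map (Phi_ffun N) l.

Lemma all_correspond1 N s sigma : corresponds N s sigma ->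
  all_correspond N [:: s] [:: sigma].
Proof. by move=> [t e]; split; rewrite /= ?t ?e. Qed.

Lemma all_correspond_map N (A B : eqType) (F : A -> raw_tableau) (G : B -> set_perm)
    (h : A -> B) L :
  {in L, forall a, corresponds N (F a) (G (h a))} ->
  all_correspond N (map F L) (map G (map h L)).
Proof.
move=> H; split; first by rewrite all_map; apply/allP => a /H[].
by rewrite -!map_comp; apply/eq_in_map => a /H[_ /= ->].
Qed.

Lemma enter_left_correspond N E : (0 < N)%N -> tableau_rel (std_labels N) E ->
  all_correspond N (enter_left (raw E (std_labels N)))
    (perm_enter_left N (fun_at (Phi_ffun N (raw E (std_labels N))))).
Proof.
move=> N0 t; have s := std_labels_asc N; have R := std_represents t.
have hp k := @fun_at_std N E k t.
have np k := @non_excedance_std N E k t; have wp k := @weak_excedance_std N E k t.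
have c1 := first_row t.
move: R hp np wp; set p := fun_at _; set ell := std_labels N in t s c1 * => R hp np wp.
have n0 : (0 < size ell)%N by rewrite size_std_labels.
have c : consecutive ell 1%:R 2%:R by apply: (@consecutive_std N 1).
have [h1 h2 _ _] := c.
have r1 : (1%:R : rat) \in rows E ell by rewrite mem_rows h1 andbT.
rewrite /enter_left /perm_enter_left ncols_raw //.
have [c2|c2] := boolP (is_col E ell 2%:R); last first.
  (* then 1 and 2 are rows, so that every column has at least two boxes *)
  have -> : (p 2 == 1)%N = false.
    by have := wp 2%N N0; rewrite c2 => h; apply: gtn_eqF.
  case: (posnP (size (cols E ell))) => [-> //|cn0].
  have hc : ((size (cols E ell)).-1 < size (cols E ell))%N by rewrite prednK.
  rewrite col_len_raw //; have [_ hy cy] := nth_cols_mem hc; set y := nth _ _ _ in hy cy *.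
  have r2 : (2%:R : rat) \in rows E ell by rewrite mem_rows h2 c2.
  have y2 : 2%:R < y.
    have [n hn yn] := std_nat hy; rewrite yn in cy *; rewrite ltr_nat.
    case: n hn cy {yn} => [|[|[|n]]] // _; first by rewrite (negbTE c1).
    by rewrite (negbTE c2).
  have lt12 : (index (1%:R : rat) (rows E ell) < index (2%:R : rat) (rows E ell))%N.
    by rewrite -(nth_rows_lt (E := E) s) ?index_mem // !nth_index // ltr_nat.
  have : (index (2%:R : rat) (rows E ell) < count (fun k => (k < y)%R) (rows E ell))%N.
    by rewrite lt_count_rows ?index_mem // nth_index.
  move=> /(leq_ltn_trans (leq_ltn_trans (leq0n _) lt12)) h.
  by rewrite gtn_eqF //=.
have j2 : (2%:R : rat) \in cols E ell by rewrite mem_cols c2.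
have hc : (index (2%:R : rat) (cols E ell) < size (cols E ell))%N by rewrite index_mem.
(* 1 is a row, so that 2 labels the rightmost column, of length 1 *)
have szc : size (cols E ell) = (index (2%:R : rat) (cols E ell)).+1.
  apply/eqP; rewrite eqn_leq hc andbT leqNgt; apply/negP => h.
  have [_ hy cy] := nth_cols_mem h; set y := nth _ _ _ in hy cy *.
  have y2 : y < 2%:R by rewrite -[ltRHS](nth_index 0 j2) nth_cols_lt.
  have [n hn yn] := std_nat hy; move: y2 cy; rewrite yn ltr_nat.
  by case: n hn {yn} => [|[|n]] // _ _; rewrite (negbTE c1).
have [k kj] := elimT (is_colP _ t) c2.
have Ej k' : E k' 2%:R -> k' = 1%:R.
  by move=> /(rel_dom t)[/std_nat[n hn ->] _]; rewrite ltr_nat; case: n hn => [|[|n]].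
have E12 : E 1%:R 2%:R by rewrite -(Ej _ kj).
have -> : (p 2 == 1)%N.
  by rewrite -(eqr_nat rat) hp ?(corner_necessary s t c E12 Ej).
rewrite szc /= col_len_raw // nth_index //.
have -> : count (fun k => k < 2%:R) (rows E ell) = 1%N.
  rewrite (eq_in_count (a2 := pred1 1%:R)).
    by rewrite count_uniq_mem ?r1 //; apply/asc_uniq/rows_asc.
  move=> x; rewrite mem_rows => /andP[_ /std_nat[n hn ->]] /=.
  by rewrite ltr_nat eqr_nat; case: n hn => [|[|n]].
rewrite eqxx /=; apply: all_correspond1.
have [R1 e1] := del_col_represents R c E12 Ej.
have := @next_non_excedanceP N p 2; rewrite ltnS => /(_ N0)[m1 m2 m3].
set nx := next_non_excedance N p 2 in m1 m2 m3 *.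
have nx0 : (0 < nx)%N by apply: leq_trans m1.
have cD := cols_del_one s t E12 Ej.
have [|R2 e2] := @insert_zero_row_represents N _ _ _ nx (@filter_sub _ ell) R1 nx0.
  move=> h; rewrite cD mem_filter mem_cols mem_std_labels nx0 h -np ?m2 ?nx0 // andbT /=.
  by rewrite eqr_nat gtn_eqF.
have cnt : count (fun j => Defs.half nx.-1 < j)
      (cols (del_one E 1%:R 2%:R) (filter (predC1 2%:R) ell))
    = index (2%:R : rat) (cols E ell).
  rewrite cD index_cols // count_filter; apply: eq_in_count => y.
  rewrite mem_cols => /andP[cy hy]; move: cy.
  have [n hn ->] := std_nat hy; rewrite -np //= lt_half prednK // ltr_nat eqr_nat => wn.
  apply/andP/idP => [[nxn _]|n2]; first exact: leq_trans nxn.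
  rewrite gtn_eqF // leqNgt; split=> //; apply/negP => an; have := m3 n; rewrite an n2 => /(_ isT).
  by case/andP: hn => _ -> /(_ isT); rewrite wn.
move: e2; rewrite cnt e1 => <-.
by apply: represents_corresponds; [exact: size_move_label|].
Qed.

Lemma exit_right_correspond N E : (0 < N)%N -> tableau_rel (std_labels N) E ->
  all_correspond N (exit_right (raw E (std_labels N)))
    (perm_exit_right N (fun_at (Phi_ffun N (raw E (std_labels N))))).
Proof.
move=> N0 t; have s := std_labels_asc N; have R := std_represents t.
have hp k := @fun_at_std N E k t.
have np k := @non_excedance_std N E k t; have wp k := @weak_excedance_std N E k t.
have c1 := first_row t.
move: R hp np wp; set p := fun_at _; set ell := std_labels N in t s c1 * => R hp np wp.
have h1 : (1%:R : rat) \in ell by rewrite mem_std_labels.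
have hN : (N.+1%:R : rat) \in ell by rewrite mem_std_labels leqnn.
have maxN y : y \in ell -> y <= N.+1%:R.
  by move=> /std_nat[n /andP[_ hn] ->]; rewrite ler_nat.
have r1 : (1%:R : rat) \in rows E ell by rewrite mem_rows h1 andbT.
rewrite /exit_right /perm_exit_right nrows_raw.
have [cN|cN] := boolP (is_col E ell N.+1%:R).
  have -> : (p N.+1 == N.+1) = false.
    by apply/negbTE; rewrite neq_ltn -[X in X || _]/(non_excedance p N.+1) np ?cN // leqnn.
  case: ltnP => //= h; have hr : ((size (rows E ell)).-1 < size (rows E ell))%N.
    by rewrite prednK // ltnW.
  (* the last step goes west, so that every row meets the leftmost column *)
  have jN : (N.+1%:R : rat) \in cols E ell by rewrite mem_cols cN.
  rewrite gtn_eqF //; apply: leq_ltn_trans (leq0n (index (N.+1%:R : rat) (cols E ell))) _.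
  have [_ hy cy] := nth_rows_mem hr.
  rewrite lt_row_len_raw // hr index_mem jN nth_index //= lt_neqAle maxN // andbT.
  by apply: contraNneq cy => ->.
have rN : (N.+1%:R : rat) \in rows E ell by rewrite mem_rows cN.
have hr : (index (N.+1%:R : rat) (rows E ell) < size (rows E ell))%N by rewrite index_mem.
(* the last label is that of the last row, which is therefore empty *)
have szr : size (rows E ell) = (index (N.+1%:R : rat) (rows E ell)).+1.
  apply/eqP; rewrite eqn_leq hr andbT leqNgt; apply/negP => h.
  have [_ hy _] := nth_rows_mem h; have := maxN _ hy.
  by rewrite -[leRHS](nth_index 0 rN) leNgt nth_rows_lt // ltnSn.
have lt1N : (index (1%:R : rat) (rows E ell) < index (N.+1%:R : rat) (rows E ell))%N.
  by rewrite -(nth_rows_lt (E := E) s) ?index_mem // !nth_index // ltr_nat.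
have NN k : ~~ E N.+1%:R k.
  by apply/negP => /(rel_dom t)[_ /maxN]; rewrite leNgt => /negbTE->.
have Nc := elimT (is_colPn _ t) cN.
have -> : p N.+1 == N.+1 by rewrite -(eqr_nat rat) hp ?path_perm_id ?leqnn.
rewrite szr /= ltnS (leq_ltn_trans _ lt1N) //= .
have -> : row_len (raw E ell) (index (N.+1%:R : rat) (rows E ell)) = 0%N.
  apply/eqP; rewrite -leqn0 leqNgt lt_row_len_raw // nth_index //.
  by apply/and3P => -[_ /nth_cols_mem[_ /maxN]]; rewrite leNgt => /negbTE->.
rewrite eqxx; apply: all_correspond1.
have [R1 e1] := del_row_represents R hN Nc NN.
have w1 : weak_excedance p 1 by rewrite wp // c1.
have N1 : (1 < N.+1)%N by rewrite ltnS.
have [/andP[a0 aN] wa amax] := prev_weak_excedanceP N1 w1.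
set a := prev_weak_excedance p N.+1 in a0 aN wa amax *.
have [_ t1 _ _] := R1; have rD := rows_del_label s t t1.
have ar : a%:R \in rows E (filter (predC1 N.+1%:R) ell).
  rewrite rD mem_filter mem_rows mem_std_labels a0 (ltnW aN) -wp ?wa ?a0 ?(ltnW aN) //=.
  by rewrite eqr_nat ltn_eqF.
have [R2 e2] := insert_col_represents (@filter_sub _ ell) R1 ar.
have cnt : count (fun k => k < Defs.half a) (rows E (filter (predC1 N.+1%:R) ell))
    = index (N.+1%:R : rat) (rows E ell).
  rewrite rD index_rows // count_filter; apply: eq_in_count => y.
  rewrite mem_rows => /andP[cy hy]; move: cy.
  have [n hn ->] := std_nat hy; rewrite -wp //= half_lt ltr_nat eqr_nat => wn.
  apply/andP/idP => [[na _]|nN]; first exact: leq_ltn_trans aN.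
  rewrite ltn_eqF // leqNgt; split=> //; apply/negP => an; have := amax n.
  by rewrite an nN wn => /(_ isT).
move: e2; rewrite cnt e1 => <-.
by apply: represents_corresponds; [exact: size_move_label|].
Qed.

(** Identifies the list of the labels at which moves are possible with the list of
    the corresponding rows, both being increasing. *)
Lemma iota_labels (L : seq nat) (h : nat -> nat) (P : pred nat) m k :
  {in L &, {homo h : r r' / (r < r')%N}} -> sorted ltn L ->
  (forall i, (m <= i < m + k)%N && P i <-> exists2 r, r \in L & i = h r) ->
  [seq i <- iota m k | P i] = map h L.
Proof.
move=> hh sL H; apply: (irr_sorted_eq ltn_trans ltnn).
- by apply: (sorted_filter ltn_trans); apply: iota_ltn_sorted.
- exact: (homo_sorted_in hh (allss _) sL).
move=> i; rewrite mem_filter mem_iota andbC; apply/idP/mapP => [/H|/H]; first by [].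
by [].
Qed.

Lemma hop_right_correspond N E : (0 < N)%N -> tableau_rel (std_labels N) E ->
  all_correspond N (hop_right (raw E (std_labels N)))
    (perm_hop_right N (fun_at (Phi_ffun N (raw E (std_labels N))))).
Proof.
move=> N0 t; have s := std_labels_asc N.
have np k := @non_excedance_std N E k t; have wp k := @weak_excedance_std N E k t.
have c1 := first_row t; have H := hop_right_corresponds t.
have cr i := @corner_raw N E i t.
move: H np wp cr; set p := fun_at _; set ell := std_labels N in t s c1 * => H np wp cr.
have r1 : (1%:R : rat) \in rows E ell by rewrite mem_rows c1 mem_std_labels.
pose h r := Num.truncn (nth 0 (rows E ell) r).
have hnat r : (r < size (rows E ell))%N -> exists2 n, (0 < n <= N.+1)%N &
    [/\ nth 0 (rows E ell) r = n%:R, h r = n & n%:R \in rows E ell].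
  move=> hr; have [hy /std_nat[n hn e] _] := nth_rows_mem hr.
  by exists n => //; rewrite /h e natrK -e.
have inL r : r \in [seq r <- iota 1 (nrows (raw E ell)).-1 | corner (raw E ell) r] ->
    [/\ (0 < r)%N, (r < size (rows E ell))%N & corner (raw E ell) r].
  rewrite mem_filter mem_iota nrows_raw add1n => /and3P[-> r0].
  by case: (size _) => [|n] /=; [case: r r0|split].
have rlab r n : (r < size (rows E ell))%N -> nth 0 (rows E ell) r = n%:R ->
    index (n%:R : rat) (rows E ell) = r.
  by move=> hr <-; rewrite index_uniq //; apply/asc_uniq/rows_asc.
have range r : r \in [seq r <- iota 1 (nrows (raw E ell)).-1 | corner (raw E ell) r] ->
    [/\ (1 < h r <= N)%N, ~~ is_col E ell (h r)%:R, is_col E ell (h r).+1%:R &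
        index ((h r)%:R : rat) (rows E ell) = r].
  move=> /inL[r0 hr c]; have [n hn [e -> nr]] := hnat _ hr.
  have ei := rlab _ _ hr e; have := cr n nr; rewrite ei c => /esym/andP[nN cn].
  split=> //; last by move: nr; rewrite mem_rows => /andP[].
  rewrite nN andbT; case: n hn {nN cn nr} e ei => [|[|n]] // _ e ei.
  have : nth 0 (rows E ell) 0 < nth 0 (rows E ell) r by rewrite nth_rows_lt // (leq_ltn_trans _ hr).
  have [m /andP[m0 _] [-> _ _]] := hnat 0%N (leq_ltn_trans (leq0n _) hr).
  by rewrite e ltr_nat ltnNge m0.
suff eL : [seq i <- iota 2 N.-1 | weak_excedance p i && non_excedance p i.+1]
    = map h [seq r <- iota 1 (nrows (raw E ell)).-1 | corner (raw E ell) r].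
  rewrite /perm_hop_right eL; apply: (@all_correspond_map _ nat nat) => r.
  by move=> /range[hn c c' e]; rewrite -{1}e; apply: H.
apply: iota_labels.
- move=> r r' /inL[_ hr _] /inL[_ hr' _]; rewrite -(nth_rows_lt (E := E) s) //.
  have [n _ [-> -> _]] := hnat _ hr; have [n' _ [-> -> _]] := hnat _ hr'.
  by rewrite ltr_nat.
- by apply: (sorted_filter ltn_trans); apply: iota_ltn_sorted.
move=> i; rewrite add2n prednK //; split.
  move=> /andP[/andP[i2 iN] /andP[]]; rewrite ltnS in iN.
  have i0 : (0 < i)%N by apply: ltnW.
  rewrite wp ?i0 ?(leqW iN) // np ?ltnS ?iN // => ci cj.
  have ir : (i%:R : rat) \in rows E ell by rewrite mem_rows ci mem_std_labels i0 leqW.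
  exists (index (i%:R : rat) (rows E ell)); last by rewrite /h nth_index // natrK.
  rewrite mem_filter cr // iN cj mem_iota nrows_raw add1n /=.
  have lt1 : (index (1%:R : rat) (rows E ell) < index (i%:R : rat) (rows E ell))%N.
    by rewrite -(nth_rows_lt (E := E) s) ?index_mem // !nth_index // ltr_nat.
  have hri : (index (i%:R : rat) (rows E ell) < size (rows E ell))%N by rewrite index_mem.
  by rewrite (leq_ltn_trans _ lt1) // prednK // (leq_ltn_trans _ hri).
move=> [r /range[/andP[i2 iN] ci cj _] ->]; rewrite i2 ltnS iN /=.
by rewrite wp ?ci ?(ltnW i2) ?(leqW iN) //= np.
Qed.

(** A move at the corner of row [r] changes row [r.+1], whose label is [i.+1] if
    the move is indexed by [i]; the label [i] before it is that of a column. *)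
Lemma hop_left_correspond N E : (0 < N)%N -> tableau_rel (std_labels N) E ->
  all_correspond N (hop_left (raw E (std_labels N)))
    (perm_hop_left N (fun_at (Phi_ffun N (raw E (std_labels N))))).
Proof.
move=> N0 t; have s := std_labels_asc N; have R := std_represents t.
have np k := @non_excedance_std N E k t; have wp k := @weak_excedance_std N E k t.
have c1 := first_row t; have cr i := @corner_raw N E i t.
move: R np wp cr; set p := fun_at _; set ell := std_labels N in t s c1 * => R np wp cr.
have r1 : (1%:R : rat) \in rows E ell by rewrite mem_rows c1 mem_std_labels.
pose h r := (Num.truncn (nth 0 (rows E ell) r.+1)).-1.
have hnat r : (r < size (rows E ell))%N -> exists2 n, (0 < n <= N.+1)%N &
    [/\ nth 0 (rows E ell) r = n%:R, Num.truncn (nth 0 (rows E ell) r) = n,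
        n%:R \in rows E ell & index (n%:R : rat) (rows E ell) = r].
  move=> hr; have [hy /std_nat[n hn e] _] := nth_rows_mem hr.
  exists n => //; rewrite e natrK; split=> //; first by rewrite -e.
  by rewrite -e index_uniq //; apply/asc_uniq/rows_asc.
have inL r : r \in [seq r <- iota 0 (nrows (raw E ell)).-1 | corner (raw E ell) r] ->
    (r.+1 < size (rows E ell))%N /\ corner (raw E ell) r.
  rewrite mem_filter mem_iota nrows_raw add0n => /andP[->] /=.
  by case: (size _).
have range r : r \in [seq r <- iota 0 (nrows (raw E ell)).-1 | corner (raw E ell) r] ->
    [/\ (0 < h r <= N)%N, is_col E ell (h r)%:R, ~~ is_col E ell (h r).+1%:R &
        index ((h r).+1%:R : rat) (rows E ell) = r.+1].
  move=> /inL[hr1 c]; have hr : (r < size (rows E ell))%N by apply: ltnW.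
  have [n hn [e _ nr ei]] := hnat _ hr; have [m /andP[m0 mN] [e' tm mr ei']] := hnat _ hr1.
  have := cr n nr; rewrite ei c => /esym/andP[nN cn].
  have nm : (n < m)%N by rewrite -(ltr_nat rat) -e -e' nth_rows_lt.
  rewrite /h tm prednK //.
  have m1 : (0 < m.-1 <= N)%N.
    rewrite -ltnS prednK // (leq_ltn_trans _ nm) ?(andP hn).1 //=.
    by rewrite -ltnS prednK.
  split=> //; last by move: mr; rewrite mem_rows => /andP[].
  apply/negPn/negP => cm; have mr' : (m.-1%:R : rat) \in rows E ell.
    by rewrite mem_rows cm mem_std_labels; case/andP: m1 => -> /leqW.
  have : (index (m.-1%:R : rat) (rows E ell) < r.+1)%N.
    rewrite -ei' -(nth_rows_lt (E := E) s) ?index_mem // !nth_index // ltr_nat.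
    by rewrite prednK.
  rewrite ltnS leq_eqVlt => /predU1P[er|].
    have mn : m.-1 = n by apply/eqP; rewrite -(eqr_nat rat) -e -er nth_index.
    by move: mr; rewrite mem_rows -(prednK m0) mn cn.
  rewrite -{1}ei -(nth_rows_lt (E := E) s) ?index_mem // !nth_index // ltr_nat.
  by rewrite ltnNge -ltnS prednK // nm.
suff eL : [seq i <- iota 1 N | non_excedance p i && weak_excedance p i.+1]
    = map h [seq r <- iota 0 (nrows (raw E ell)).-1 | corner (raw E ell) r].
  rewrite /perm_hop_left eL; apply: (@all_correspond_map _ nat nat) => r /range[hn c c' e].
  have cc : consecutive ell (h r)%:R (h r).+1%:R by apply: consecutive_std.
  rewrite -e (add_box_raw s t cc c c'); apply: represents_corresponds; first exact: size_std_labels.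
  exact: add_box_represents.
apply: iota_labels.
- move=> r r' /inL[hr _] /inL[hr' _]; rewrite -ltnS -(nth_rows_lt (E := E) s) //.
  have [n /andP[n0 _] [en tn _ _]] := hnat _ hr.
  have [n' /andP[n0' _] [en' tn' _ _]] := hnat _ hr'.
  by rewrite en en' ltr_nat /h tn tn' -[in X in _ -> X]ltnS !prednK.
- by apply: (sorted_filter ltn_trans); apply: iota_ltn_sorted.
move=> i; rewrite add1n ltnS; split.
  move=> /andP[/andP[i0 iN] /andP[]].
  rewrite np ?i0 ?(leqW iN) // wp ?ltnS ?iN // => ci cj.
  have jr : (i.+1%:R : rat) \in rows E ell by rewrite mem_rows cj mem_std_labels /= ltnS.
  have lt1 : (index (1%:R : rat) (rows E ell) < index (i.+1%:R : rat) (rows E ell))%N.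
    by rewrite -(nth_rows_lt (E := E) s) ?index_mem // !nth_index // ltr_nat.
  have hj : (index (i.+1%:R : rat) (rows E ell) < size (rows E ell))%N by rewrite index_mem.
  case er : (index (i.+1%:R : rat) (rows E ell)) lt1 hj => [|r] // _ hj.
  have hr : (r < size (rows E ell))%N by apply: ltnW.
  exists r; last by rewrite /h -er nth_index // natrK.
  rewrite mem_filter mem_iota nrows_raw add0n.
  have [n /andP[n0 _] [e _ nr ei]] := hnat _ hr.
  have ni : (n < i.+1)%N.
    by rewrite -(ltr_nat rat) -e -[X in _ < X](nth_index 0 jr) er nth_rows_lt.
  have {}ni : (n < i)%N.
    rewrite ltn_neqAle -ltnS ni andbT; apply: contraTneq nr => ->.
    by rewrite mem_rows ci.
  rewrite -{1}ei cr // (leq_trans (ltnW ni) iN) /=; apply/andP; split; last first.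
    by case: (size _) hj.
  apply/negPn/negP => cn.
  have nr' : (n.+1%:R : rat) \in rows E ell.
    by rewrite mem_rows cn mem_std_labels /= ltnS (leq_trans (ltnW ni) iN).
  have : (r < index (n.+1%:R : rat) (rows E ell))%N.
    by rewrite -{1}ei -(nth_rows_lt (E := E) s) ?index_mem // !nth_index // ltr_nat.
  rewrite ltnNge -ltnS -er -(nth_rows_lt (E := E) s) ?index_mem // !nth_index // ltr_nat.
  by rewrite ltnS ni.
move=> [r /range[/andP[i0 iN] ci cj _] ->]; rewrite i0 iN /=.
by rewrite np ?ci ?i0 ?(leqW iN) //= wp.
Qed.

(** * The chains *)

Lemma Phi_ffun_inj N s s' : is_tableau N.+1 s -> is_tableau N.+1 s' ->
  Phi_ffun N s = Phi_ffun N s' -> s = s'.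
Proof.
move=> /raw_surj[E t ->] /raw_surj[E' t' ->] e; apply: eq_raw.
apply: (path_perm_rel_inj (std_labels_asc N) t t') => _ /std_nat[n hn ->].
by rewrite -!fun_at_std // e.
Qed.

Lemma Phi_ffunE N (S : tableau N.+1) : [ffun i => Phi S i] = Phi_ffun N (val S).
Proof. by apply/ffunP => i; rewrite !ffunE permE. Qed.

Lemma Phi_bij N : bijective (@Phi N).
Proof.
have inj : injective (@Phi N).
  move=> S T e; apply/val_inj/(@Phi_ffun_inj N); try exact: valP.
  by rewrite -!Phi_ffunE e.
have surj (pi : 'S_N.+1) : exists S : tableau N.+1, Phi S = pi.
  have s := std_labels_asc N; have sz := size_std_labels N.
  pose f (x : rat) : rat := (pi (inord (Num.truncn x).-1)).+1%:R.
  have fE k : (k < N.+1)%N -> f k.+1%:R = (pi (inord k)).+1%:R by rewrite /f natrK.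
  have [||E t e] := @path_perm_surj (std_labels N) f s.
  - by move=> _ /std_labelsP[k hk ->]; rewrite fE // mem_std_labels /= ltn_ord.
  - move=> _ _ /std_labelsP[k hk ->] /std_labelsP[k' hk' ->]; rewrite !fE //.
    move=> /eqP; rewrite eqr_nat eqSS => /eqP/val_inj/perm_inj/(congr1 val) /=.
    by rewrite !inordK // => ->.
  have ts : is_tableau N.+1 (raw E (std_labels N)).
    by rewrite -sz; apply: raw_is_tableau; rewrite ?sz.
  exists (Sub (raw E (std_labels N)) ts); apply/permP => k; apply/val_inj/eqP.
  have := fun_at_std t (k := k.+1) (ltn_ord k); rewrite e ?mem_std_labels ?ltn_ord //.
  rewrite fE // inord_val => /eqP; rewrite eqr_nat eqSS /fun_at /= inord_val ffunE permE.
  by rewrite SubK.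
have [g gK] := fin_all_exists surj.
by exists g => // S; apply: inj; rewrite gK.
Qed.

Lemma weighted_correspond (R : realFieldType) N (w : R) l l' : all_correspond N l l' ->
  weighted N w (map (@Norm N) l') = [seq (m.1, Phi_ffun N m.2) | m <- weighted N w l] /\
  all (fun m => is_tableau N.+1 m.2) (weighted N w l).
Proof.
move=> [tl ->]; split; first by rewrite /weighted -!map_comp; apply: eq_map.
by rewrite /weighted all_map; exact: tl.
Qed.

(** Both chains list their moves in the same order, with the same weights. *)
Lemma moves_correspond (R : realFieldType) N (alpha beta q : R) s : (0 < N)%N ->
  is_tableau N.+1 s ->
  perm_moves alpha beta q (Phi_ffun N s)
    = [seq (m.1, Phi_ffun N m.2) | m <- tableau_moves N alpha beta q s] /\
  all (fun m => is_tableau N.+1 m.2) (tableau_moves N alpha beta q s).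
Proof.
move=> N0 /raw_surj[E t ->].
have [e1 t1] := weighted_correspond alpha (enter_left_correspond N0 t).
have [e2 t2] := weighted_correspond (1 : R) (hop_right_correspond N0 t).
have [e3 t3] := weighted_correspond beta (exit_right_correspond N0 t).
have [e4 t4] := weighted_correspond q (hop_left_correspond N0 t).
by rewrite /perm_moves /tableau_moves e1 e2 e3 e4 !map_cat !all_cat t1 t2 t3 t4.
Qed.

Theorem proposition6p3 (R : realFieldType) (N : nat) (alpha beta q : R)
  (N_ge1 : (1 <= N)%N)
  (alpha_gt0 : 0 < alpha) (beta_gt0 : 0 < beta) (q_ge0 : 0 <= q)
  (PT_chain01 : forall S T : tableau N.+1,
     0 <= PT_chain alpha beta q S T <= 1) :
  bijective (@Phi N) /\
  forall S T : tableau N.+1,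
    perm_chain alpha beta q (Phi S) (Phi T) = PT_chain alpha beta q S T.
Proof.
split=> [|S T]; first exact: Phi_bij.
rewrite /perm_chain /PT_chain !Phi_ffunE /transition.
have [-> /allP tm] := moves_correspond alpha beta q N_ge1 (valP S).
have eq_Phi s s' : is_tableau N.+1 s -> is_tableau N.+1 s' ->
    (Phi_ffun N s == Phi_ffun N s') = (s == s').
  by move=> h h'; apply/eqP/eqP => [/(Phi_ffun_inj h h')|->].
rewrite (eq_Phi _ _ (valP S) (valP T)); case: ifP => _; rewrite big_map /=.
  congr (1 - _); rewrite big_seq_cond [RHS]big_seq_cond; apply: eq_bigl => m.
  by apply: andb_id2l => /tm h; rewrite (eq_Phi _ _ h (valP S)).
rewrite big_seq_cond [RHS]big_seq_cond; apply: eq_bigl => m.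
by apply: andb_id2l => /tm h; rewrite (eq_Phi _ _ h (valP T)).
Qed.
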